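(* Let $B$ be a convex body in $\mathbb{R}^n$ and let $\varepsilon>0$. There exists a convex body $K\subset\mathbb{R}^n$ such that $d(K,B)\le 1+\varepsilon$ and the number of contact points of $K$ with its John ellipsoid is less than $$m(n,\varepsilon)=C(\varepsilon)\cdot n\cdot \log n ,$$ where $C(\varepsilon)>0$ depends only on $\varepsilon$.
   Context: A convex body in $\mathbb{R}^n$ is a compact convex set with nonempty interior (not assumed to be symmetric). $d(K,B)$ is the Banach--Mazur distance between convex bodies: the infimum of all $\lambda\ge 1$ for which there exist an invertible linear map $T:\mathbb{R}^n\to\mathbb{R}^n$ and points $x,y\in\mathbb{R}^n$ with $K-x\subset T(B-y)\subset \lambda (K-x)$. The John ellipsoid of $K$ is the (unique) ellipsoid of maximal volume contained in $K$. A contact point of $K$ with its John ellipsoid $\mathcal{D}$ is a point lying in both the boundary of $K$ and the boundary of $\mathcal{D}$.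
   Formalization: The dimension is assumed to satisfy n ≥ 2, because for n = 1 the bound C(ε)·n·log n equals 0 while every interval has two contact points with its John ellipsoid, so the claim as printed fails there. *)

(* Defs.v *)
From mathcomp Require Import all_boot all_order all_algebra.
From mathcomp Require Import all_classical all_reals all_analysis.

Set Implicit Arguments.
Unset Strict Implicit.
Unset Printing Implicit Defensive.

Import Order.TTheory GRing.Theory Num.Theory.
Import numFieldNormedType.Exports.

Local Open Scope classical_set_scope.
Local Open Scope ring_scope.

(* R^n is 'rV[R]_n with the library's product topology; an invertible linear
   map is u |-> u *m A with A \in unitmx. *)

Definition convex_body (R : realType) (n : nat) (K : set 'rV[R]_n) : Prop :=
  [/\ compact K, convex_set K & K° !=set0].

(* d(K, B), taken in the extended reals so that the infimum of an empty set of
   ratios would be +oo. *)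
Definition banach_mazur (R : realType) (n : nat) (K B : set 'rV[R]_n) : \bar R :=
  ereal_inf [set lambda%:E | lambda in [set lambda : R | 1 <= lambda /\
    exists (A : 'M[R]_n) (x y : 'rV[R]_n),
      [/\ A \in unitmx,
          [set k - x | k in K] `<=` [set (b - y) *m A | b in B] &
          [set (b - y) *m A | b in B] `<=` [set lambda *: (k - x) | k in K]]]].

Definition euclidean_unit_ball (R : realType) (n : nat) : set 'rV[R]_n :=
  [set u | \sum_(i < n) u 0 i ^+ 2 <= 1].

Definition ellipsoid (R : realType) (n : nat) (E : set 'rV[R]_n) : Prop :=
  exists (c : 'rV[R]_n) (A : 'M[R]_n),
    A \in unitmx /\ E = [set c + u *m A | u in @euclidean_unit_ball R n].

(* n-dimensional Lebesgue measure as the n-fold product of lebesgue_measure,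
   computed by integrating the volumes of the sections, as in product_measure1.
   R^0 is a single point, of mass 1.  This is the Lebesgue measure on Borel
   sets, and it is only applied to ellipsoids. *)
Fixpoint volume (R : realType) (n : nat) : set 'rV[R]_n -> \bar R :=
  match n with
  | 0 => fun S => (\1_S 0)%:E
  | m.+1 => fun S =>
      (\int[@lebesgue_measure R]_(t in [set: R])
         volume [set y : 'rV[R]_m | S (row_mx (t%:M : 'rV[R]_1) y)])%E
  end.

Definition max_volume_ellipsoid (R : realType) (n : nat)
    (K D : set 'rV[R]_n) : Prop :=
  [/\ ellipsoid D, D `<=` K &
      forall E : set 'rV[R]_n, ellipsoid E -> E `<=` K ->
        (volume E <= volume D)%E].

Definition john_ellipsoid (R : realType) (n : nat) (K D : set 'rV[R]_n) : Prop :=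
  unique (max_volume_ellipsoid K) D.

Definition boundary (T : topologicalType) (A : set T) : set T :=
  closure A `\` A°.

Definition contact_points (R : realType) (n : nat) (K D : set 'rV[R]_n) :
    set 'rV[R]_n :=
  boundary K `&` boundary D.

(* Main.v *)
Require Import Defs.
From mathcomp Require Import all_boot all_order all_algebra.
From mathcomp Require Import all_classical all_reals all_analysis.
From mathcomp Require Import measurable_realfun ring lra zify.

Set Implicit Arguments.
Unset Strict Implicit.
Unset Printing Implicit Defensive.

Import Order.TTheory GRing.Theory Num.Theory.
Import numFieldNormedType.Exports.

Local Open Scope classical_set_scope.
Local Open Scope ring_scope.

(** By compactness, [B] is squeezed between two nearly equal homothetic copies
    of a polytope ([polytope_approx]).  The ellipsoid of maximal volume in the
    polytope exists, and the first-order condition for its determinant gives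
    John's decomposition: after an affine change of variables there are unit
    vectors [g j], normals of active constraints, and weights such that
    the weighted sum of the [(g j)^T *m g j] is the identity and the weighted
    sum of the [g j] vanishes ([polytope_john]).  Conversely, a body that
    contains the unit ball and lies in the half-spaces tangent to it at
    the vectors of such a decomposition has the unit ball as its unique John
    ellipsoid ([unit_ball_is_john]).  This rests on the fact that the iterated
    integral of sections gives an ellipsoid a volume proportional to its
    determinant ([volume_affine_ball]).  Hence it suffices to find a
    decomposition with [O(n ln n)] vectors that is exact and belongs to a body
    close to the polytope.

    Sparsification.  Let [M] be the weighted sum, and consider the potential
    [tr ((M - 1) ^ (2 p)) + n d ^ p] with [p] of order [ln n].  Given weights
    [c] on [S] points, one minimises the potential times
    [exp (- kappa sum c_i x_i ^ 2)] over multipliers [x_i] between [0] and [4],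
    of mean one, that keep the barycentre at the origin.  The second-order condition,
    summed over directions that move only multipliers strictly between
    the bounds ([second_order]), shows that these are at most a quarter of all;
    another quarter at most equal [4], and the rest vanish.  So the support
    is halved while the potential grows by a factor
    [exp (O(p ^ 2 n / (d S)))] ([halve]).  The exponents form a geometric series,
    and stopping at [S] of order [n p / d] keeps the spectrum of [M] within
    [delta] of one ([sparsify]).

    Exactness.  The sparse decomposition is centred but only approximately the
    identity.  Maximising the determinant of [A] under a bound on the weighted
    sum of the lengths [enorm (u i *m A)] yields, as first-order condition, an
    exact decomposition on the directions of the vectors [u i *m A], with the
    same barycentre because [A] is linear.  The extreme lengths bound the
    spectrum of [A], hence themselves: no length drops much below one, and the
    norm of [A] does not exceed one by much ([exact_position]).

    Few contacts.  The new vectors need not be normals of the polytope, so it is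
    enlarged by [1 + 3 delta] and truncated by the half-spaces tangent to the
    ball at them: the result stays close to [B] and touches the ball at these
    points only ([truncated_polytope], [few_contacts_nearby]). *)

(** * Euclidean structure on row vectors and trace forms on matrices *)

Section Dot.
Variables (R : realType).

Definition dot n (u v : 'rV[R]_n) : R := \sum_i u 0 i * v 0 i.
Definition enorm n (u : 'rV[R]_n) : R := Num.sqrt (dot u u).

Lemma dotE n (u v : 'rV[R]_n) : (u *m v^T) 0 0 = dot u v.
Proof. by rewrite mxE; apply: eq_bigr => i _; rewrite mxE. Qed.

Lemma dotC n (u v : 'rV[R]_n) : dot u v = dot v u.
Proof. by apply: eq_bigr => i _; rewrite mulrC. Qed.

Lemma dotDl n (u v w : 'rV[R]_n) : dot (u + v) w = dot u w + dot v w.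
Proof. by rewrite -!dotE mulmxDl mxE. Qed.

Lemma dotDr n (u v w : 'rV[R]_n) : dot w (u + v) = dot w u + dot w v.
Proof. by rewrite !(dotC w) dotDl. Qed.

Lemma dotZl n a (u w : 'rV[R]_n) : dot (a *: u) w = a * dot u w.
Proof. by rewrite -!dotE -scalemxAl mxE. Qed.

Lemma dotZr n a (u w : 'rV[R]_n) : dot w (a *: u) = a * dot w u.
Proof. by rewrite !(dotC w) dotZl. Qed.

Lemma dotNl n (u w : 'rV[R]_n) : dot (- u) w = - dot u w.
Proof. by rewrite -scaleN1r dotZl mulN1r. Qed.

Lemma dotNr n (u w : 'rV[R]_n) : dot w (- u) = - dot w u.
Proof. by rewrite !(dotC w) dotNl. Qed.

Lemma dotBl n (u v w : 'rV[R]_n) : dot (u - v) w = dot u w - dot v w.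
Proof. by rewrite dotDl dotNl. Qed.

Lemma dotBr n (u v w : 'rV[R]_n) : dot w (u - v) = dot w u - dot w v.
Proof. by rewrite dotDr dotNr. Qed.

Lemma dot0l n (w : 'rV[R]_n) : dot 0 w = 0.
Proof. by rewrite -(scale0r 0) dotZl mul0r. Qed.

Lemma dot0r n (w : 'rV[R]_n) : dot w 0 = 0.
Proof. by rewrite dotC dot0l. Qed.

Lemma dot_suml n (I : Type) (r : seq I) (F : I -> 'rV[R]_n) w :
  dot (\sum_(i <- r) F i) w = \sum_(i <- r) dot (F i) w.
Proof. by rewrite -dotE mulmx_suml summxE; apply: eq_bigr => i _; rewrite dotE. Qed.

Lemma dot_sumr n (I : Type) (r : seq I) (F : I -> 'rV[R]_n) w :
  dot w (\sum_(i <- r) F i) = \sum_(i <- r) dot w (F i).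
Proof. by rewrite dotC dot_suml; apply: eq_bigr => i _; rewrite dotC. Qed.

Lemma dot_sqr n (u : 'rV[R]_n) : dot u u = \sum_i u 0 i ^+ 2.
Proof. by apply: eq_bigr => i _; rewrite expr2. Qed.

Lemma dot_mulmx m n (u : 'rV[R]_m) (A : 'M[R]_(m, n)) v :
  dot (u *m A) v = dot u (v *m A^T).
Proof. by rewrite -!dotE trmx_mul trmxK mulmxA. Qed.

Lemma dot_mulmxr m n (u : 'rV[R]_m) (A : 'M[R]_(m, n)) v :
  dot v (u *m A) = dot (v *m A^T) u.
Proof. by rewrite dotC dot_mulmx dotC. Qed.

Lemma dot_ge0 n (u : 'rV[R]_n) : 0 <= dot u u.
Proof. by apply: sumr_ge0 => i _; rewrite -expr2 sqr_ge0. Qed.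

Lemma dot_eq0 n (u : 'rV[R]_n) : (dot u u == 0) = (u == 0).
Proof.
apply/idP/eqP => [|->]; last by rewrite dot0l.
rewrite psumr_eq0 => [/allP u0|i _]; last by rewrite -expr2 sqr_ge0.
apply/rowP => i; rewrite mxE; apply/eqP.
by have := u0 i (mem_index_enum _); rewrite /= mulf_eq0 orbb.
Qed.

Lemma dot_gt0 n (u : 'rV[R]_n) : (0 < dot u u) = (u != 0).
Proof. by rewrite lt0r dot_ge0 andbT dot_eq0. Qed.

Lemma cauchy_schwarz n (u v : 'rV[R]_n) : dot u v ^+ 2 <= dot u u * dot v v.
Proof.
have [->|v0] := eqVneq v 0; first by rewrite !dot0r expr0n mulr0.
have v_gt0 : 0 < dot v v by rewrite dot_gt0.
have := dot_ge0 (dot v v *: u - dot u v *: v).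
rewrite !(dotBl, dotBr, dotZl, dotZr) (dotC v u) => H.
have {}H : 0 <= dot v v * (dot u u * dot v v - dot u v ^+ 2).
  by apply: le_trans H _; rewrite le_eqVlt; apply/orP; left; apply/eqP; ring.
by rewrite pmulr_rge0 // subr_ge0 in H.
Qed.

Lemma enorm_ge0 n (u : 'rV[R]_n) : 0 <= enorm u.
Proof. exact: sqrtr_ge0. Qed.

Lemma sqr_enorm n (u : 'rV[R]_n) : enorm u ^+ 2 = dot u u.
Proof. by rewrite sqr_sqrtr // dot_ge0. Qed.

Lemma enorm_gt0 n (u : 'rV[R]_n) : (0 < enorm u) = (u != 0).
Proof. by rewrite sqrtr_gt0 dot_gt0. Qed.

Lemma enorm0 n : enorm (0 : 'rV[R]_n) = 0.
Proof. by rewrite /enorm dot0l sqrtr0. Qed.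

Lemma enormZ n a (u : 'rV[R]_n) : enorm (a *: u) = `|a| * enorm u.
Proof. by rewrite /enorm dotZl dotZr mulrA -expr2 sqrtrM ?sqr_ge0 // sqrtr_sqr. Qed.

Lemma dot_le_enorm n (u v : 'rV[R]_n) : dot u v <= enorm u * enorm v.
Proof.
rewrite /enorm -sqrtrM ?dot_ge0 //; apply: le_trans (ler_norm _) _.
by rewrite -sqrtr_sqr ler_wsqrtr // cauchy_schwarz.
Qed.

Lemma enorm_leP n (u : 'rV[R]_n) c : 0 <= c -> (enorm u <= c) = (dot u u <= c ^+ 2).
Proof. by move=> c0; rewrite -sqr_enorm ler_pXn2r // nnegrE ?enorm_ge0. Qed.

Lemma ler_enormD n (u v : 'rV[R]_n) : enorm (u + v) <= enorm u + enorm v.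
Proof.
rewrite enorm_leP ?addr_ge0 ?enorm_ge0 // dotDl !dotDr -!sqr_enorm (dotC v u).
by have := dot_le_enorm u v; lra.
Qed.

Lemma coord_le_enorm n (u : 'rV[R]_n) i : `|u 0 i| <= enorm u.
Proof.
rewrite -sqrtr_sqr ler_wsqrtr // /dot (bigD1 i) //= -expr2 lerDl.
by apply: sumr_ge0 => j _; rewrite -expr2 sqr_ge0.
Qed.

(** Equality case of the Cauchy-Schwarz inequality against a unit vector. *)
Lemma dot_eq_enorm n (u v : 'rV[R]_n) :
  dot v v = 1 -> dot u v = enorm u -> u = enorm u *: v.
Proof.
move=> v1 uv; apply/eqP; rewrite -subr_eq0 -dot_eq0.
rewrite !(dotBl, dotBr, dotZl, dotZr) v1 (dotC v u) uv -sqr_enorm.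
by apply/eqP; ring.
Qed.

Lemma dot_line n (u v : 'rV[R]_n) t :
  dot (u + t *: v) (u + t *: v) = dot u u + t * (2 * dot u v) + t ^+ 2 * dot v v.
Proof. by rewrite !(dotDl, dotDr, dotZl, dotZr) (dotC v u); ring. Qed.

Lemma dot_unit_eq n (u v : 'rV[R]_n) :
  dot u u <= 1 -> dot v v = 1 -> 1 <= dot u v -> u = v.
Proof.
move=> u1 v1 uv; apply/eqP; rewrite -subr_eq0 -dot_eq0 eq_le dot_ge0 andbT.
by rewrite !(dotBl, dotBr) (dotC v u) v1; lra.
Qed.

Lemma dot_delta n (u : 'rV[R]_n) i : dot u (delta_mx 0 i) = u 0 i.
Proof.
rewrite /dot (bigD1 i) //= mxE !eqxx mulr1 big1 ?addr0 // => j /negPf ji.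
by rewrite mxE ji andbF mulr0.
Qed.

Lemma dot_delta_mx n i : dot (delta_mx 0 i : 'rV[R]_n) (delta_mx 0 i) = 1.
Proof. by rewrite dot_delta mxE !eqxx. Qed.

End Dot.

Section Trace.
Variables (R : realType).

Lemma frob_ge0 m n (A : 'M[R]_(m, n)) : 0 <= \tr (A *m A^T).
Proof.
apply: sumr_ge0 => i _; rewrite mxE; apply: sumr_ge0 => j _.
by rewrite mxE -expr2 sqr_ge0.
Qed.

Lemma frobE m n (A : 'M[R]_(m, n)) : \tr (A *m A^T) = \sum_i \sum_j A i j ^+ 2.
Proof. by apply: eq_bigr => i _; rewrite mxE; apply: eq_bigr => j _; rewrite mxE expr2. Qed.

Lemma frob_eq0 m n (A : 'M[R]_(m, n)) : \tr (A *m A^T) = 0 -> A = 0.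
Proof.
rewrite frobE => /eqP; rewrite psumr_eq0; last first.
  by move=> i _; apply: sumr_ge0 => j _; rewrite sqr_ge0.
move=> /allP A0; apply/matrixP => i j; rewrite mxE.
have := A0 i (mem_index_enum _); rewrite /= psumr_eq0; last first.
  by move=> k _; rewrite sqr_ge0.
by move=> /allP /(_ j (mem_index_enum _)) /=; rewrite sqrf_eq0 => /eqP.
Qed.

Lemma frob_row m n (A : 'M[R]_(m, n)) :
  \tr (A *m A^T) = \sum_i dot (row i A) (row i A).
Proof.
rewrite frobE; apply: eq_bigr => i _; apply: eq_bigr => j _.
by rewrite !mxE expr2.
Qed.

Lemma tr_cross_le m n (A B : 'M[R]_(m, n)) :
  2 * \tr (A *m B^T) <= \tr (A *m A^T) + \tr (B *m B^T).
Proof.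
have := frob_ge0 (A - B); rewrite linearB /= mulmxBl !mulmxBr !raddfB /=.
have -> : \tr (B *m A^T) = \tr (A *m B^T) by rewrite -mxtrace_tr trmx_mul trmxK.
by lra.
Qed.

Lemma frob_line m n (A B : 'M[R]_(m, n)) t :
  \tr ((A + t *: B) *m (A + t *: B)^T) =
  \tr (A *m A^T) + t * (2 * \tr (A *m B^T)) + t ^+ 2 * \tr (B *m B^T).
Proof.
have BA : \tr (B *m A^T) = \tr (A *m B^T) by rewrite -mxtrace_tr trmx_mul trmxK.
rewrite [(_ + _)^T]linearD /= [(t *: B)^T]linearZ /= mulmxDl !mulmxDr !mxtraceD.
by rewrite -!scalemxAl -!scalemxAr !mxtraceZ BA; ring.
Qed.

Lemma mulmx_outer n (u : 'rV[R]_n) (x : 'rV[R]_n) : x *m (u^T *m u) = dot x u *: u.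
Proof. by rewrite mulmxA [x *m u^T]mx11_scalar dotE mul_scalar_mx. Qed.

Lemma tr_outer n (u : 'rV[R]_n) (A : 'M[R]_n) : \tr (u^T *m u *m A) = dot (u *m A) u.
Proof. by rewrite -mulmxA mxtrace_mulC /mxtrace big_ord1 dotE. Qed.

Lemma tr_outer1 n (u : 'rV[R]_n) : \tr (u^T *m u) = dot u u.
Proof. by rewrite mxtrace_mulC /mxtrace big_ord1 dotE. Qed.

Lemma tr_outer_sq m n (u : 'rV[R]_m) (Y : 'M[R]_(m, n)) :
  \tr (u^T *m u *m Y *m (u^T *m u *m Y)^T) = dot u u * dot (u *m Y) (u *m Y).
Proof.
rewrite -(mulmxA u^T); move: (u *m Y) => w.
rewrite (trmx_mul u^T) trmxK mulmxA -(mulmxA u^T).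
by rewrite [w *m w^T]mx11_scalar dotE mul_mx_scalar -scalemxAl mxtraceZ tr_outer1 mulrC.
Qed.

Lemma dot_mulmx_frob n m (u : 'rV[R]_n) (A : 'M[R]_(n, m)) :
  dot (u *m A) (u *m A) <= dot u u * \tr (A *m A^T).
Proof.
have -> : \tr (A *m A^T) = \sum_j dot (row j A^T) (row j A^T).
  by rewrite -frob_row trmxK mxtrace_mulC.
rewrite mulr_sumr; apply: ler_sum => j _.
have -> : (u *m A) 0 j = dot u (row j A^T).
  by rewrite mxE; apply: eq_bigr => i _; rewrite !mxE.
by rewrite -expr2 cauchy_schwarz.
Qed.

End Trace.

(** * Polynomials in a small parameter *)

Section SmallParameter.
Variables (R : realType).

Lemma poly_bounded (p : {poly R}) : exists2 K : R, 0 <= K &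
  forall t, `|t| <= 1 -> `|p.[t]| <= K.
Proof.
exists (\sum_(i < size p) `|p`_i|); first by apply: sumr_ge0.
move=> t t1; rewrite horner_coef; apply: le_trans (ler_norm_sum _ _ _) _.
apply: ler_sum => i _; rewrite normrM normrX ler_piMr //.
by rewrite exprn_ile1.
Qed.

(** A second-order coefficient is nonnegative if it dominates a cubic error. *)
Lemma quad_coef_ge0 (a K t0 : R) : 0 < t0 -> 0 <= K ->
  (forall t, 0 < t -> t <= t0 -> 0 <= a * t ^+ 2 + K * t ^+ 3) -> 0 <= a.
Proof.
move=> t00 K0 H; rewrite leNgt; apply/negP => a0.
pose t := Num.min t0 (- a / (2 * (K + 1))).
have s0 : 0 < - a / (2 * (K + 1)) by rewrite divr_gt0 ?oppr_gt0 //; lra.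
have t_gt0 : 0 < t by rewrite lt_min t00 s0.
have := H t t_gt0; rewrite ge_min lexx => /(_ isT).
have -> : a * t ^+ 2 + K * t ^+ 3 = t ^+ 2 * (a + K * t) by ring.
rewrite pmulr_rge0 ?exprn_gt0 // => H1.
have tle : t <= - a / (2 * (K + 1)) by rewrite ge_min lexx orbT.
have : t * (2 * (K + 1)) <= - a by rewrite -ler_pdivlMr //; lra.
by nra.
Qed.

(** Traceless perturbations change the determinant of the identity only to
    second order: [det (1 + t H)] is a polynomial in [t] whose linear
    coefficient is the trace, read off the characteristic polynomial. *)
Lemma det_traceless n (H : 'M[R]_n) : \tr H = 0 ->
  exists2 K : R, 0 <= K & forall t, 0 < t -> t <= 1 -> 1 - K * t ^+ 2 <= \det (1%:M + t *: H).
Proof.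
case: n H => [|n] H trH.
  by exists 0 => // t _ _; rewrite mul0r subr0 det_mx00.
pose p := char_poly (- H).
have size_p : size p = n.+2 by rewrite size_char_poly.
have pn : p`_n.+1 = 1.
  by have /monicP := char_poly_monic (- H); rewrite lead_coefE size_p.
have pn1 : p`_n = 0.
  by have := @char_poly_trace R n.+1 (- H) isT; rewrite raddfN /= trH !oppr0.
pose q : {poly R} := \poly_(i < n) p`_(n.-1 - i).
have [K K0 HK] := poly_bounded q; exists K => // t t0 t1.
suff -> : \det (1%:M + t *: H) = 1 + t ^+ 2 * q.[t].
  have := HK t; rewrite ger0_norm ?(ltW t0) // => /(_ t1) Hq.
  have : - K <= q.[t] by have := ler_norm (- q.[t]); rewrite normrN; lra.
  have : 0 <= t ^+ 2 by rewrite sqr_ge0.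
  by nra.
have -> : 1%:M + t *: H = t *: ((t^-1)%:M - (- H)).
  by rewrite opprK scalerDr scale_scalar_mx divff ?gt_eqF.
have -> : \det (t *: ((t^-1)%:M - (- H))) = t ^+ n.+1 * p.[t^-1].
  rewrite detZ; congr (_ * _).
  rewrite /p /char_poly /char_poly_mx -horner_evalE -det_map_mx; congr (\det _).
  by rewrite map_mxB map_scalar_mx /= /horner_eval hornerX -map_mx_comp map_mx_id // => x; rewrite /= hornerC.
rewrite horner_coef size_p !big_ord_recr /= pn pn1 mul0r addr0 mul1r mulrDr addrC.
rewrite -exprMn divff ?gt_eqF // expr1n; congr (1 + _).
rewrite horner_poly !mulr_sumr (reindex_inj rev_ord_inj) /=.
apply: eq_bigr => i _.
have -> : (n.-1 - i)%N = (n - i.+1)%N by case: (n) i => [[]//|m] i; rewrite subSS.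
rewrite mulrCA [RHS]mulrCA; congr (_ * _).
rewrite exprVn -exprD; apply: (canLR (mulfK _)); first by rewrite expf_neq0 ?gt_eqF.
by rewrite -exprD; congr (_ ^+ _); have := ltn_ord i; lia.
Qed.

End SmallParameter.

(** * Extrema on compact sets cut out by continuous inequalities *)

Section Extrema.
Variables (R : realType).

Lemma cont_coord m n (i : 'I_m) (j : 'I_n) : continuous (fun x : 'M[R]_(m, n) => x i j).
Proof. exact: coord_continuous. Qed.

Lemma cont_cst (T : topologicalType) (a : R) : continuous (fun _ : T => a).
Proof. by move=> x; exact: cvg_cst. Qed.

Lemma cont_add (T : topologicalType) (f g : T -> R) :
  continuous f -> continuous g -> continuous (fun x => f x + g x).
Proof. by move=> cf cg x; apply: cvgD; [exact: cf|exact: cg]. Qed.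

Lemma cont_opp (T : topologicalType) (f : T -> R) :
  continuous f -> continuous (fun x => - f x).
Proof. by move=> cf x; apply: cvgN; exact: cf. Qed.

Lemma cont_sub (T : topologicalType) (f g : T -> R) :
  continuous f -> continuous g -> continuous (fun x => f x - g x).
Proof. by move=> cf cg; apply: cont_add => //; apply: cont_opp. Qed.

Lemma cont_mul (T : topologicalType) (f g : T -> R) :
  continuous f -> continuous g -> continuous (fun x => f x * g x).
Proof. by move=> cf cg x; apply: cvgM; [exact: cf|exact: cg]. Qed.

Lemma cont_sum (T : topologicalType) (I : Type) (r : seq I) (P : pred I) (F : I -> T -> R) :
  (forall i, P i -> continuous (F i)) -> continuous (fun x => \sum_(i <- r | P i) F i x).
Proof.
move=> cF; elim: r => [|i r IH].
  by under eq_fun do rewrite big_nil; apply: cont_cst.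
under eq_fun do rewrite big_cons; case: (boolP (P i)) => [/cF ci|_] //.
exact: cont_add.
Qed.

Lemma cont_prod (T : topologicalType) (I : Type) (r : seq I) (P : pred I) (F : I -> T -> R) :
  (forall i, P i -> continuous (F i)) -> continuous (fun x => \prod_(i <- r | P i) F i x).
Proof.
move=> cF; elim: r => [|i r IH].
  by under eq_fun do rewrite big_nil; apply: cont_cst.
under eq_fun do rewrite big_cons; case: (boolP (P i)) => [/cF ci|_] //.
exact: cont_mul.
Qed.

Lemma cont_exprn (T : topologicalType) (f : T -> R) k :
  continuous f -> continuous (fun x => f x ^+ k).
Proof.
move=> cf; elim: k => [|k IH]; first exact: cont_cst.
by under eq_fun do rewrite exprS; apply: cont_mul.
Qed.

Lemma cont_sqrt (T : topologicalType) (f : T -> R) :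
  continuous f -> continuous (fun x => Num.sqrt (f x)).
Proof. by move=> cf x; apply: continuous_comp; [exact: cf|exact: sqrt_continuous]. Qed.

Lemma cont_exp (T : topologicalType) (f : T -> R) :
  continuous f -> continuous (fun x => expR (f x)).
Proof. by move=> cf x; apply: continuous_comp; [exact: cf|exact: continuous_expR]. Qed.

(** Continuity of matrix-valued maps is used through their entries only. *)
Definition mx_cont (T : topologicalType) m n (F : T -> 'M[R]_(m, n)) :=
  forall i j, continuous (fun x => F x i j).

Lemma mx_cont_cst (T : topologicalType) m n (A : 'M[R]_(m, n)) : mx_cont (fun _ : T => A).
Proof. by move=> i j; apply: cont_cst. Qed.

Lemma mx_cont_id m n : mx_cont (fun x : 'M[R]_(m, n) => x).
Proof. by move=> i j; exact: cont_coord. Qed.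

Lemma mx_cont_add (T : topologicalType) m n (F G : T -> 'M[R]_(m, n)) :
  mx_cont F -> mx_cont G -> mx_cont (fun x => F x + G x).
Proof. by move=> cF cG i j; under eq_fun do rewrite mxE; apply: cont_add. Qed.

Lemma mx_cont_opp (T : topologicalType) m n (F : T -> 'M[R]_(m, n)) :
  mx_cont F -> mx_cont (fun x => - F x).
Proof. by move=> cF i j; under eq_fun do rewrite mxE; apply: cont_opp. Qed.

Lemma mx_cont_mul (T : topologicalType) m n p (F : T -> 'M[R]_(m, n)) (G : T -> 'M[R]_(n, p)) :
  mx_cont F -> mx_cont G -> mx_cont (fun x => F x *m G x).
Proof.
move=> cF cG i j; under eq_fun do rewrite mxE.
by apply: cont_sum => k _; apply: cont_mul.
Qed.

Lemma mx_cont_tr (T : topologicalType) m n (F : T -> 'M[R]_(m, n)) :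
  mx_cont F -> mx_cont (fun x => (F x)^T).
Proof. by move=> cF i j; under eq_fun do rewrite mxE; apply: cF. Qed.

Lemma mx_cont_exp (T : topologicalType) n (F : T -> 'M[R]_n) k :
  mx_cont F -> mx_cont (fun x => F x ^+ k).
Proof.
move=> cF; elim: k => [|k IH]; first exact: mx_cont_cst.
by under eq_fun do rewrite exprS; apply: mx_cont_mul.
Qed.

Lemma cont_mxtrace (T : topologicalType) n (F : T -> 'M[R]_n) :
  mx_cont F -> continuous (fun x => \tr (F x)).
Proof. by move=> cF; apply: cont_sum => i _. Qed.

Lemma cont_det (T : topologicalType) n (F : T -> 'M[R]_n) :
  mx_cont F -> continuous (fun x => \det (F x)).
Proof.
move=> cF; apply: cont_sum => s _; apply: cont_mul; first exact: cont_cst.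
by apply: cont_prod => i _.
Qed.

Lemma cont_dot (T : topologicalType) n (F G : T -> 'rV[R]_n) :
  mx_cont F -> mx_cont G -> continuous (fun x => dot (F x) (G x)).
Proof. by move=> cF cG; apply: cont_sum => i _; apply: cont_mul. Qed.

Lemma cont_enorm (T : topologicalType) n (F : T -> 'rV[R]_n) :
  mx_cont F -> continuous (fun x => enorm (F x)).
Proof. by move=> cF; apply: cont_sqrt; apply: cont_dot. Qed.

Lemma closed_le0 (T : topologicalType) (I : Type) (g : I -> T -> R) :
  (forall i, continuous (g i)) -> closed [set x | forall i, g i x <= 0].
Proof.
move=> cg.
have -> : [set x | forall i, g i x <= 0] = \bigcap_(i in setT) (g i @^-1` [set y | y <= 0]).
  by apply/seteqP; split=> x /= H; [move=> i _; exact: H|move=> i; exact: (H i Logic.I)].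
apply: closed_bigI => i _; apply: preimage_closed; last exact: closed_le.
by move=> x _; exact: cg.
Qed.

Lemma compact_le0 N (I : Type) (g : I -> 'rV[R]_N -> R) (M : R) :
  (forall i, continuous (g i)) ->
  (forall x, (forall i, g i x <= 0) -> forall j, `|x 0 j| <= M) ->
  compact [set x | forall i, g i x <= 0].
Proof.
move=> cg bM; apply: bounded_closed_compact; last exact: closed_le0.
exists (Num.max M 0); split; first exact: num_real.
move=> y My x /= Hx; rewrite [`|x|]mx_normrE; apply: bigmax_le.
  by apply: ltW; apply: le_lt_trans My; rewrite le_max lexx orbT.
move=> [i j] _ /=; rewrite (ord1 i); apply: le_trans (bM x Hx j) _.
by apply: ltW; apply: le_lt_trans My; rewrite le_max lexx.
Qed.

Lemma argmax_le0 N (I : Type) (g : I -> 'rV[R]_N -> R) (M : R) (F : 'rV[R]_N -> R) x0 :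
  (forall i, continuous (g i)) -> continuous F ->
  (forall x, (forall i, g i x <= 0) -> forall j, `|x 0 j| <= M) ->
  (forall i, g i x0 <= 0) ->
  exists2 x, (forall i, g i x <= 0) & forall y, (forall i, g i y <= 0) -> F y <= F x.
Proof.
move=> cg cF bM gx0.
have [|||c cA cmax] := @EVT_max_rV R N F [set x | forall i, g i x <= 0].
- by exists x0.
- exact: compact_le0 cg bM.
- by apply: continuous_subspaceT.
exists c; first by move: cA; rewrite inE.
by move=> y gy; apply: cmax; rewrite inE.
Qed.

Lemma argmin_le0 N (I : Type) (g : I -> 'rV[R]_N -> R) (M : R) (F : 'rV[R]_N -> R) x0 :
  (forall i, continuous (g i)) -> continuous F ->
  (forall x, (forall i, g i x <= 0) -> forall j, `|x 0 j| <= M) ->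
  (forall i, g i x0 <= 0) ->
  exists2 x, (forall i, g i x <= 0) & forall y, (forall i, g i y <= 0) -> F x <= F y.
Proof.
move=> cg cF bM gx0.
have [x gx xmax] := argmax_le0 cg (cont_opp cF) bM gx0.
by exists x => // y /xmax; rewrite lerN2.
Qed.

End Extrema.

(** * Traces of powers of a symmetric matrix *)

Section PowerTraces.
Variables (R : realType) (n : nat).
Implicit Types (X D : 'M[R]_n).

Lemma exprmx_tr X k : (X ^+ k)^T = X^T ^+ k.
Proof.
elim: k => [|k IH]; first by rewrite !expr0 -[1%R]/(1%:M) trmx1.
by rewrite exprS -[X * _]/(X *m _) trmx_mul IH exprSr.
Qed.

(** A discretely convex sequence is bounded by its end values. *)
Lemma convex_seq_max (r : nat -> R) m :
  (forall i, (i.+2 <= m)%N -> 2 * r i.+1 <= r i + r i.+2) ->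
  forall i, (i <= m)%N -> r i <= Num.max (r 0%N) (r m).
Proof.
move=> cvx.
have P i : (i < m)%N -> r i <= r 0%N \/ r i <= r i.+1.
  elim: i => [|i IH] im; first by left.
  case: (IH (ltnW im)) => H; have := cvx i im;
    by case: (leP (r i.+1) (r i.+2)); [right|move=> *; left; lra].
move=> i im; rewrite -(subKn im); elim: (m - i)%N (leq_subr i m) => [|k IH] km.
  by rewrite subn0 le_max lexx orbT.
have := P (m - k.+1)%N; rewrite subnSK // => /(_ (leq_subr _ _)) [] H.
  by rewrite le_max H.
by apply: le_trans H (IH (ltnW km)).
Qed.

Lemma frob_pow X k : X^T = X -> \tr (X ^+ k *m (X ^+ k)^T) = \tr (X ^+ k.*2).
Proof. by move=> sX; rewrite exprmx_tr sX -addnn exprD. Qed.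

(** The even moments, rescaled by the powers of [d], form a discretely convex
    sequence, which is bounded by its first and last terms. *)
Lemma tr_pow_interp X p (d : R) : X^T = X -> 0 < d ->
  d * \tr (X ^+ p.*2) <= \tr (X ^+ p.+1.*2) + n%:R * d ^+ p.+1.
Proof.
move=> sX d0.
pose r i := \tr (X ^+ i.*2) / d ^+ i.
have cvx i : (i.+2 <= p.+1)%N -> 2 * r i.+1 <= r i + r i.+2.
  move=> _.
  have := tr_cross_le (d *: X ^+ i) (X ^+ i.+2).
  rewrite [(d *: _)^T]linearZ /= -!scalemxAl -scalemxAr !mxtraceZ.
  rewrite !frob_pow // exprmx_tr sX -[X ^+ i *m _]/(X ^+ i * _) -exprD.
  have -> : (i + i.+2)%N = i.+1.*2 by lia.
  move=> H; rewrite /r.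
  rewrite -(ler_pM2r (exprn_gt0 i.+2 d0)) [in X in _ <= X]mulrDl.
  have e1 : 2 * (\tr (X ^+ i.+1.*2) / d ^+ i.+1) * d ^+ i.+2 = 2 * (d * \tr (X ^+ i.+1.*2)).
    by rewrite !exprS; field; rewrite ?expf_neq0 ?gt_eqF.
  have e2 : \tr (X ^+ i.*2) / d ^+ i * d ^+ i.+2 = d * (d * \tr (X ^+ i.*2)).
    by rewrite !exprS; field; rewrite ?expf_neq0 ?gt_eqF.
  have e3 : \tr (X ^+ i.+2.*2) / d ^+ i.+2 * d ^+ i.+2 = \tr (X ^+ i.+2.*2).
    by rewrite !exprS; field; rewrite ?expf_neq0 ?gt_eqF.
  by rewrite e1 e2 e3.
have := convex_seq_max cvx (leqnSn p).
rewrite /r expr0 divr1 -[X ^+ 0]/(1%:M) mxtrace1 => H.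
have hp : 0 <= \tr (X ^+ p.+1.*2) by rewrite -frob_pow // frob_ge0.
have : \tr (X ^+ p.*2) / d ^+ p <= n%:R + \tr (X ^+ p.+1.*2) / d ^+ p.+1.
  apply: le_trans H _; rewrite ge_max; apply/andP; split.
    by rewrite lerDl divr_ge0 // exprn_ge0 // ltW.
  by rewrite lerDr.
rewrite -(ler_pM2r (exprn_gt0 p.+1 d0)) mulrDl.
have -> : \tr (X ^+ p.*2) / d ^+ p * d ^+ p.+1 = d * \tr (X ^+ p.*2).
  by rewrite !exprS; field; rewrite ?expf_neq0 ?gt_eqF.
by rewrite divfK ?expf_neq0 ?gt_eqF // addrC.
Qed.

(** Among the words with two letters [D] and [2 m] letters [X], the trace is
    largest when the two letters [D] are adjacent: as a function of the
    position of [D], the squared Frobenius norms of the half words are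
    discretely convex, and they bound the trace of the product of two half
    words. *)
Lemma tr_word_le X D m a b : X^T = X -> D^T = D -> (a + b)%N = m.*2 ->
  \tr (D *m X ^+ a *m D *m X ^+ b) <= \tr (D *m D *m X ^+ m.*2).
Proof.
move=> sX sD ab.
pose W i := X ^+ i *m D *m X ^+ (m - i).
pose e i := \tr (W i *m (W i)^T).
have WT i : (W i)^T = X ^+ (m - i) *m D *m X ^+ i.
  by rewrite /W !trmx_mul !exprmx_tr sX sD mulmxA.
have XD i j : X ^+ i *m X ^+ j = X ^+ (i + j) by rewrite exprD.
have WW i j : (i <= m)%N -> (j <= m)%N ->
    \tr (W i *m (W j)^T) = \tr (D *m X ^+ (m.*2 - (i + j)) *m D *m X ^+ (i + j)).
  move=> im jm; rewrite WT /W !mulmxA mxtrace_mulC !mulmxA XD.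
  rewrite -!mulmxA (mulmxA (X ^+ (m - i))) XD !mulmxA.
  have -> : (m - i + (m - j))%N = (m.*2 - (i + j))%N by lia.
  by rewrite -!mulmxA mxtrace_mulC !mulmxA (addnC j).
have e0 : e 0%N = \tr (D *m D *m X ^+ m.*2).
  rewrite /e WW // addn0 subn0 -[X ^+ 0]/(1%:M) mulmx1 mxtrace_mulC.
  by rewrite mulmxA.
have em : e m = \tr (D *m D *m X ^+ m.*2).
  by rewrite /e WW // addnn subnn -[X ^+ 0]/(1%:M) mulmx1.
have cvx i : (i.+2 <= m)%N -> 2 * e i.+1 <= e i + e i.+2.
  move=> im; have := tr_cross_le (W i) (W i.+2); rewrite WW ?(ltnW (ltnW im)) //.
  by rewrite /e [in X in _ -> X <= _]WW ?(ltnW im) // addSnnS.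
have emax i : (i <= m)%N -> e i <= \tr (D *m D *m X ^+ m.*2).
  by move=> im; have := convex_seq_max cvx im; rewrite e0 em maxxx.
have : 2 * \tr (D *m X ^+ a *m D *m X ^+ b) <= e b./2 + e (b - b./2)%N.
  have := tr_cross_le (W b./2) (W (b - b./2)%N).
  rewrite WW; [|lia|lia].
  have -> : (m.*2 - (b./2 + (b - b./2)))%N = a by lia.
  have -> : (b./2 + (b - b./2))%N = b by lia.
  exact.
have := emax b./2; have := emax (b - b./2)%N.
by move=> /(_ ltac:(lia)) h1 /(_ ltac:(lia)) h2 h3; lra.
Qed.

(** The coefficients of [t] and [t ^+ 2] in [(X + t *: D) ^+ m]. *)
Fixpoint pow_d1 X D m : 'M[R]_n :=
  if m is k.+1 then pow_d1 X D k *m X + X ^+ k *m D else 0.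

Fixpoint pow_d2 X D m : 'M[R]_n :=
  if m is k.+1 then pow_d2 X D k *m X + pow_d1 X D k *m D else 0.

Lemma pow_expand X D m : exists P : 'M[{poly R}]_n, forall t : R,
  (X + t *: D) ^+ m = X ^+ m + t *: pow_d1 X D m + t ^+ 2 *: pow_d2 X D m
                      + t ^+ 3 *: map_mx (horner_eval t) P.
Proof.
elim: m => [|m [P IH]].
  exists 0 => t; rewrite !expr0 /= !scaler0 !addr0.
  by rewrite map_mx0 scaler0 addr0.
exists (P *m (map_mx polyC X + 'X *: map_mx polyC D) + map_mx polyC (pow_d2 X D m *m D)).
move=> t; rewrite exprSr IH /= map_mxD map_mxM map_mxD map_mxZ.
rewrite -!map_mx_comp !map_mx_id; try by move=> x; rewrite /= /horner_eval hornerC.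
rewrite -[_ * (X + _)]/(_ *m _).
have -> : poly_horner_eval__canonical__GRing_RMorphism t 'X = t by rewrite /= /horner_eval hornerX.
rewrite -/(map_mx (horner_eval t) P); set Q := map_mx _ P; set A := pow_d1 _ _ _; set B := pow_d2 _ _ _.
rewrite [X ^+ m.+1]exprSr -[_ ^+ m * X]/(X ^+ m *m X) !mulmxDl !mulmxDr.
have sAr a (U V : 'M[R]_n) : U *m (a *: V) = a *: (U *m V) by rewrite -scalemxAr.
have sAl a (U V : 'M[R]_n) : (a *: U) *m V = a *: (U *m V) by rewrite -scalemxAl.
rewrite !sAl !sAr.
move: (X ^+ m *m X) (X ^+ m *m D) (A *m X) (A *m D) (B *m X) (B *m D) (Q *m X) (Q *m D).
move=> M1 M2 M3 M4 M5 M6 M7 M8; apply/matrixP => i j; rewrite !mxE; ring.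
Qed.

Lemma tr_pow_expand X D m : exists2 K : R, 0 <= K & forall t, `|t| <= 1 ->
  \tr ((X + t *: D) ^+ m) <=
  \tr (X ^+ m) + t * \tr (pow_d1 X D m) + t ^+ 2 * \tr (pow_d2 X D m) + K * `|t| ^+ 3.
Proof.
have [P HP] := pow_expand X D m.
have [K K0 HK] := poly_bounded (\tr P); exists K => // t t1.
rewrite HP !raddfD /= !linearZ /= !lerD2l.
have -> : \tr (map_mx (horner_eval t) P) = (\tr P).[t].
  by rewrite trace_map_mx.
apply: le_trans (ler_norm _) _; rewrite normrM normrX mulrC.
by rewrite ler_wpM2r ?exprn_ge0 // HK.
Qed.

Lemma pow_d1E X D m : pow_d1 X D m = \sum_(i < m) X ^+ i *m D *m X ^+ (m.-1 - i).
Proof.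
elim: m => [|m IH] /=; first by rewrite big_ord0.
rewrite IH big_ord_recr /= subnn -[X ^+ 0]/(1%:M) mulmx1 mulmx_suml; congr (_ + _).
apply: eq_bigr => i _; rewrite -mulmxA -[X ^+ _ *m X]/(X ^+ _ * X) -exprSr.
by congr (_ *m X ^+ _); have := ltn_ord i; lia.
Qed.

Lemma pow_d2E X D m :
  pow_d2 X D m = \sum_(j < m) pow_d1 X D j *m D *m X ^+ (m.-1 - j).
Proof.
elim: m => [|m IH] /=; first by rewrite big_ord0.
rewrite IH big_ord_recr /= subnn -[X ^+ 0]/(1%:M) mulmx1 mulmx_suml; congr (_ + _).
apply: eq_bigr => i _; rewrite -mulmxA -[X ^+ _ *m X]/(X ^+ _ * X) -exprSr.
by congr (_ *m X ^+ _); have := ltn_ord i; lia.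
Qed.

(** The second coefficient is a sum of fewer than [m ^ 2] words, [m] being the
    exponent; a cyclic rotation brings each of them to the form compared in
    [tr_word_le]. *)
Lemma tr_pow_d2_le X D p : X^T = X -> D^T = D ->
  \tr (pow_d2 X D p.+1.*2) <= (p.+1.*2 ^ 2)%:R * \tr (D *m D *m X ^+ p.*2).
Proof.
move=> sX sD; set s := \tr (D *m D *m _); set m := p.+1.*2.
have s0 : 0 <= s.
  rewrite /s; have := frob_ge0 (X ^+ p *m D).
  rewrite trmx_mul sD exprmx_tr sX mulmxA mxtrace_mulC !mulmxA.
  by rewrite -[X ^+ p *m X ^+ p]/(X ^+ p * X ^+ p) -exprD addnn -mulmxA mxtrace_mulC.
rewrite pow_d2E raddf_sum /=.
(* The sum over all pairs of positions majorises the sum over ordered pairs. *)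
have -> : (m ^ 2)%:R * s = \sum_(j < m) m%:R * s.
  by rewrite sumr_const card_ord -[RHS]mulr_natl mulrA -natrM mulnn.
apply: ler_sum => j _.
rewrite pow_d1E mulmx_suml mulmx_suml raddf_sum /=.
have -> : m%:R * s = \sum_(i < m) s by rewrite sumr_const card_ord mulr_natl.
apply: (@le_trans _ _ (\sum_(i < j) s)).
  apply: ler_sum => i _.
  rewrite mxtrace_mulC !mulmxA -[X ^+ _ *m X ^+ _]/(X ^+ _ * X ^+ _) -exprD.
  rewrite mxtrace_mulC !mulmxA -[_ *m D *m X ^+ _]mulmxA mxtrace_mulC -!mulmxA.
  rewrite !mulmxA.
  by apply: tr_word_le => //; have := ltn_ord i; have := ltn_ord j; rewrite /m; lia.
rewrite !sumr_const !card_ord -(mulr_natl s m) -(mulr_natl s j) ler_wpM2r // ler_nat.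
exact: ltnW.
Qed.

End PowerTraces.

(** * Averaging over the kernel of a linear constraint *)

Section Projector.
Variables (R : realType).

Lemma row_free_gram k N (W : 'M[R]_(k, N)) : row_free W -> W *m W^T \in unitmx.
Proof.
move=> fW; rewrite -row_free_unit; apply/row_freeP.
suff : \rank (W *m W^T) = k by move=> rk; apply/row_freeP; rewrite /row_free rk.
apply/eqP; rewrite -[_ == k]/(row_free _) -kermx_eq0; apply/eqP/row_matrixP => i.
rewrite row0; set v := row i _.
have vK : v *m (W *m W^T) = 0.
  by apply/sub_kermxP; rewrite row_sub.
have : dot (v *m W) (v *m W) = 0.
  by rewrite dot_mulmx -mulmxA vK dot0r.
move=> /eqP; rewrite dot_eq0 => /eqP vW.
by apply: (row_free_inj fW); rewrite vW mul0mx.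
Qed.

(** The orthogonal projector onto the solutions [z] of [z *m G = 0]. *)
Lemma kernel_projector N r (G : 'M[R]_(N, r)) : exists P : 'M[R]_N,
  [/\ P *m G = 0, P^T = P, P *m P = P & N%:R - r%:R <= \tr P].
Proof.
pose W := row_base G^T; pose S := W *m W^T.
have fW : row_free W by exact: row_base_free.
have uS : S \in unitmx by exact: row_free_gram.
have ST : S^T = S by rewrite /S trmx_mul trmxK.
have [Y GY] : exists Y, G^T = Y *m W.
  by apply/submxP; rewrite eq_row_base.
clearbody W; pose Q := W^T *m invmx S *m W.
have QT : Q^T = Q by rewrite /Q !trmx_mul trmx_inv ST trmxK mulmxA.
have QW : Q *m W^T = W^T by rewrite /Q -mulmxA mulmxKV.
have QQ : Q *m Q = Q by rewrite {2}/Q !mulmxA QW.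
exists (1%:M - Q); split.
- have -> : G = W^T *m Y^T by rewrite -trmx_mul -GY trmxK.
  by rewrite mulmxA mulmxBl mul1mx QW subrr mul0mx.
- by rewrite linearB /= trmx1 QT.
- by rewrite mulmxBl !mulmxBr !mul1mx mulmx1 QQ subrr subr0.
- rewrite raddfB /= mxtrace1 lerD2l lerN2 /Q -mulmxA mxtrace_mulC -mulmxA mulVmx //.
  by rewrite mxtrace1 ler_nat rank_leq_row.
Qed.

Variables (N : nat) (P : 'M[R]_N).
Hypotheses (PT : P^T = P) (PP : P *m P = P).

Lemma projE i j : P i j = P j i.
Proof. by rewrite -{1}PT mxE. Qed.

Lemma proj_diag i : P i i = \sum_j P i j ^+ 2.
Proof. by rewrite -{1}PP mxE; apply: eq_bigr => j _; rewrite expr2 (projE j i). Qed.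

Lemma proj_diag_le1 i : P i i <= 1.
Proof.
have : P i i ^+ 2 <= P i i.
  rewrite [leRHS]proj_diag (bigD1 i) //= lerDl.
  by apply: sumr_ge0 => j _; rewrite sqr_ge0.
have : 0 <= P i i by rewrite proj_diag; apply: sumr_ge0 => j _; rewrite sqr_ge0.
by nra.
Qed.

(** Restricting a projector to the coordinates in [f] loses at most the
    dimension of its kernel. *)
Lemma proj_trace_restrict (f : pred 'I_N) r : N%:R - r <= \tr P ->
  #|f|%:R - r <= \sum_(i | f i) P i i.
Proof.
rewrite /mxtrace (bigID f) /= => H.
have : \sum_(i | ~~ f i) P i i <= #|[predC f]|%:R.
  rewrite -sum1_card natr_sum; apply: ler_sum => i _; exact: proj_diag_le1.
have : (#|f| + #|[predC f]|)%N = N by rewrite cardC card_ord.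
by move=> /(congr1 (fun k : nat => k%:R : R)); rewrite natrD; lra.
Qed.

Lemma proj_contract (g : 'rV[R]_N) : dot (g *m P) (g *m P) <= dot g g.
Proof.
have e : dot (g *m P) (g *m P) = dot (g *m P) g by rewrite dot_mulmxr PT -mulmxA PP.
have := dot_ge0 (g - g *m P); rewrite !(dotBl, dotBr) e (dotC g).
by lra.
Qed.

(** The entries at each position form a vector, which the projector contracts. *)
Lemma proj_bessel m n (V : 'I_N -> 'M[R]_(m, n)) :
  \sum_i \tr ((\sum_j P i j *: V j) *m (\sum_j P i j *: V j)^T)
  <= \sum_j \tr (V j *m (V j)^T).
Proof.
under eq_bigr do rewrite frobE.
under [leRHS]eq_bigr do rewrite frobE.
rewrite exchange_big [leRHS]exchange_big /=; apply: ler_sum => a _.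
rewrite exchange_big [leRHS]exchange_big /=; apply: ler_sum => b _.
have := proj_contract (\row_j V j a b); rewrite !dot_sqr.
have -> : \sum_i (\row_j V j a b) 0 i ^+ 2 = \sum_i V i a b ^+ 2.
  by apply: eq_bigr => i _; rewrite mxE.
apply: le_trans; rewrite le_eqVlt; apply/orP; left; apply/eqP.
apply: eq_bigr => i _; congr (_ ^+ 2); rewrite summxE mxE.
by apply: eq_bigr => j _; rewrite !mxE mulrC projE.
Qed.

End Projector.

(** * Sparsification of a decomposition of the identity *)

Lemma fin_small (R : realType) (I : finType) (P : I -> R -> Prop) :
  (forall i, exists2 e, 0 < e & forall t, `|t| <= e -> P i t) ->
  exists2 e, 0 < e & forall i t, `|t| <= e -> P i t.
Proof.
move=> H; suff [e e0 He] : exists2 e, 0 < e & forall i, i \in enum I -> forall t, `|t| <= e -> P i t.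
  by exists e => // i; apply: He; rewrite mem_enum.
elim: (enum I) => [|i s [e e0 IH]]; first by exists 1.
have [e' e'0 He'] := H i; exists (Num.min e e'); first by rewrite lt_min e0.
move=> j; rewrite inE => /orP[/eqP-> t|js t]; rewrite le_min => /andP[t1 t2].
  exact: He'.
exact: IH.
Qed.

Section Sparsify.
Variables (R : realType) (n N : nat) (u : 'I_N -> 'rV[R]_n).
Hypothesis n_gt0 : (0 < n)%N.
Hypothesis u1 : forall i, dot (u i) (u i) = 1.

Definition gram (c : 'rV[R]_N) : 'M[R]_n := \sum_i c 0 i *: ((u i)^T *m u i).
Definition moment (c : 'rV[R]_N) : 'rV[R]_n := \sum_i c 0 i *: u i.
Definition supp (c : 'rV[R]_N) : pred 'I_N := fun i => 0 < c 0 i.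

Lemma gram_tr c : (gram c)^T = gram c.
Proof.
rewrite /gram raddf_sum; apply: eq_bigr => i _ /=.
by rewrite linearZ /= trmx_mul trmxK.
Qed.

Lemma gramD c y : gram (c + y) = gram c + gram y.
Proof. by rewrite /gram -big_split; apply: eq_bigr => i _ /=; rewrite mxE scalerDl. Qed.

Lemma gramZ a c : gram (a *: c) = a *: gram c.
Proof. by rewrite /gram scaler_sumr; apply: eq_bigr => i _ /=; rewrite mxE scalerA. Qed.

Lemma momentD c y : moment (c + y) = moment c + moment y.
Proof. by rewrite /moment -big_split; apply: eq_bigr => i _ /=; rewrite mxE scalerDl. Qed.

Lemma momentZ a c : moment (a *: c) = a *: moment c.
Proof. by rewrite /moment scaler_sumr; apply: eq_bigr => i _ /=; rewrite mxE scalerA. Qed.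

Lemma tr_gram c : \tr (gram c) = \sum_i c 0 i.
Proof.
rewrite /gram raddf_sum; apply: eq_bigr => i _ /=.
by rewrite mxtraceZ tr_outer1 u1 mulr1.
Qed.

Lemma dot_gram c x : dot (x *m gram c) x = \sum_i c 0 i * dot x (u i) ^+ 2.
Proof.
rewrite /gram mulmx_sumr dot_suml; apply: eq_bigr => i _.
by rewrite -scalemxAr mulmx_outer !dotZl (dotC (u i)) expr2.
Qed.

Lemma tr_gram_mul c (Y : 'M[R]_n) :
  \tr (gram c *m (Y *m Y^T)) = \sum_i c 0 i * dot (u i *m Y) (u i *m Y).
Proof.
rewrite /gram mulmx_suml raddf_sum; apply: eq_bigr => i _ /=.
by rewrite -scalemxAl mxtraceZ tr_outer [in RHS]dot_mulmxr mulmxA.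
Qed.

Lemma tr_gram_mul_le c (b : R) (Y : 'M[R]_n) :
  (forall x, dot (x *m gram c) x <= b * dot x x) ->
  \tr (gram c *m (Y *m Y^T)) <= b * \tr (Y *m Y^T).
Proof.
move=> H; rewrite mulmxA mxtrace_mulC mulmxA (mxtrace_mulC Y).
rewrite -{2 4}(trmxK Y) frob_row mulr_sumr; apply: ler_sum => i _.
apply: le_trans (H _); rewrite mxE -dotE.
rewrite le_eqVlt; apply/orP; left; apply/eqP; rewrite !mxE.
by apply: eq_bigr => j _; rewrite -row_mul !mxE.
Qed.

Definition dev c : 'M[R]_n := gram c - 1%:M.

(** The constant term makes the lower moments comparable to the highest one. *)
Definition potential p d c := \tr (dev c ^+ p.*2) + n%:R * d ^+ p.

Lemma dev_tr c : (dev c)^T = dev c.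
Proof. by rewrite /dev linearB /= gram_tr trmx1. Qed.

Lemma potential_gt0 p d c : 0 < d -> 0 < potential p d c.
Proof.
move=> d0; rewrite /potential ltr_wpDl ?mulr_gt0 ?exprn_gt0 ?ltr0n //.
by rewrite -frob_pow ?dev_tr // frob_ge0.
Qed.

Definition cmul (c x : 'rV[R]_N) : 'rV[R]_N := \row_i (c 0 i * x 0 i).

Lemma cmulDr c x y : cmul c (x + y) = cmul c x + cmul c y.
Proof. by apply/rowP => i; rewrite !mxE mulrDr. Qed.

Lemma cmulZr a c x : cmul c (a *: x) = a *: cmul c x.
Proof. by apply/rowP => i; rewrite !mxE mulrCA. Qed.

Lemma mx_cont_gram c : mx_cont (fun x => gram (cmul c x)).
Proof.
move=> i j; under eq_fun do rewrite /gram summxE.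
apply: cont_sum => k _; under eq_fun do rewrite mxE.
apply: cont_mul; last exact: cont_cst.
under eq_fun do rewrite mxE.
by apply: cont_mul; [exact: cont_cst|exact: cont_coord].
Qed.

Lemma mx_cont_moment c : mx_cont (fun x => moment (cmul c x)).
Proof.
move=> i j; under eq_fun do rewrite /moment summxE.
apply: cont_sum => k _; under eq_fun do rewrite mxE.
apply: cont_mul; last exact: cont_cst.
under eq_fun do rewrite mxE.
by apply: cont_mul; [exact: cont_cst|exact: cont_coord].
Qed.

Lemma cont_potential p d c : continuous (fun x => potential p d (cmul c x)).
Proof.
apply: cont_add; last exact: cont_cst.
apply: cont_mxtrace; apply: mx_cont_exp => i j.
under eq_fun do rewrite /dev !mxE.
apply: cont_add; last exact: cont_cst.
exact: mx_cont_gram.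
Qed.

(** The factor [64] is that of the reward in [halve], and [32 * n] bounds the
    energy. *)
Definition halving_cost : R := 32 * 64.

Lemma halving_cost_gt0 : 0 < halving_cost.
Proof. by rewrite mulr_gt0 ?ltr0n. Qed.

Section Halve.
Variables (q : nat) (d : R) (c : 'rV[R]_N).
Let p := q.+1.
Hypothesis d_gt0 : 0 < d.
Hypothesis c_ge0 : forall i, 0 <= c 0 i.
Hypothesis c_bal : moment c = 0.
Hypothesis c_le2 : forall x, dot (x *m gram c) x <= 2 * dot x x.
Let S := #|supp c|.

Definition energy (x : 'rV[R]_N) := \sum_i c 0 i * x 0 i ^+ 2.
Definition total (x : 'rV[R]_N) := \sum_(i | supp c i) x 0 i.

(** The multipliers keep the barycentre at the origin and have mean one on the
    support, so that at most a quarter of them can reach the upper bound. *)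
Definition admissible (x : 'rV[R]_N) :=
  [/\ forall i, 0 <= x 0 i <= 4, moment (cmul c x) = 0 & total x = S%:R].

Lemma energyD x y t : energy (x + t *: y) =
  energy x + t * (2 * \sum_i c 0 i * x 0 i * y 0 i) + t ^+ 2 * energy y.
Proof.
rewrite /energy !mulr_sumr -!big_split /=; apply: eq_bigr => i _.
by rewrite !mxE; ring.
Qed.

Lemma cont_energy : continuous energy.
Proof.
apply: cont_sum => i _; apply: cont_mul; first exact: cont_cst.
by under eq_fun do rewrite expr2; apply: cont_mul; exact: cont_coord.
Qed.

(** The factor [expR (- kappa * energy x)] rewards multipliers of large energy
    and so pushes them towards the end values [0] and [4]. *)
Lemma exists_minimizer (kappa : R) : exists2 x, admissible x &
  forall y, admissible y ->
    potential p d (cmul c x) * expR (- kappa * energy x) <=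
    potential p d (cmul c y) * expR (- kappa * energy y).
Proof.
pose g (o : option ('I_N * bool)) (x : 'rV[R]_N) : R := match o with
  | None => dot (moment (cmul c x)) (moment (cmul c x)) + (total x - S%:R) * (total x - S%:R)
  | Some (i, true) => - x 0 i
  | Some (i, false) => x 0 i - 4 end.
have admE x : admissible x <-> forall o, g o x <= 0.
  split=> [[x04 mx tx] [[i []]|]|H] /=.
  - by have /andP[? _] := x04 i; rewrite oppr_le0.
  - by have /andP[_ ?] := x04 i; rewrite subr_le0.
  - by rewrite mx tx subrr dot0l mul0r addr0.
  have := H None; rewrite /= -expr2 => H0.
  have h1 := dot_ge0 (moment (cmul c x)); have h2 := sqr_ge0 (total x - S%:R).
  split.
  - move=> i; have := H (Some (i, true)); have := H (Some (i, false)) => /=.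
    by rewrite oppr_le0 subr_le0 => -> ->.
  - by apply/eqP; rewrite -dot_eq0; apply/eqP; lra.
  - by apply/eqP; rewrite -subr_eq0 -sqrf_eq0; apply/eqP; lra.
have cg o : continuous (g o).
  case: o => [[i []]|] /=.
  - by apply: cont_opp; exact: cont_coord.
  - by apply: cont_sub; [exact: cont_coord|exact: cont_cst].
  apply: cont_add; first by apply: cont_dot; exact: mx_cont_moment.
  by apply: cont_mul; (apply: cont_sub; [apply: cont_sum => i _; exact: cont_coord|exact: cont_cst]).
have cF : continuous (fun x => potential p d (cmul c x) * expR (- kappa * energy x)).
  apply: cont_mul; first exact: cont_potential.
  by apply: cont_exp; apply: cont_mul; [exact: cont_cst|exact: cont_energy].
have bg x : (forall o, g o x <= 0) -> forall j, `|x 0 j| <= 4.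
  by move=> /admE[x04 _ _] j; have /andP[? ?] := x04 j; rewrite ger0_norm.
have g1 o : g o (const_mx 1) <= 0.
  move: o; apply/admE; split.
  - by move=> i; rewrite mxE; lra.
  - suff -> : cmul c (const_mx 1) = c by [].
    by apply/rowP => i; rewrite !mxE mulr1.
  - rewrite /total (eq_bigr (fun=> 1)); last by move=> i _; rewrite mxE.
    by rewrite sumr_const.
have [x /admE ax xmin] := argmin_le0 cg cF bg g1.
by exists x => // y /admE /xmin.
Qed.

(** Multipliers strictly between the bounds can move both ways, so along a
    direction supported on them the first-order terms cancel, and the
    second-order condition says that the reward does not exceed the second
    derivative of the potential. *)
Lemma second_order (kappa : R) (x y : 'rV[R]_N) : 0 < kappa -> admissible x ->
  (forall y, admissible y ->
    potential p d (cmul c x) * expR (- kappa * energy x) <=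
    potential p d (cmul c y) * expR (- kappa * energy y)) ->
  (forall i, y 0 i != 0 -> 0 < x 0 i < 4) ->
  moment (cmul c y) = 0 -> total y = 0 ->
  potential p d (cmul c x) * kappa * energy y <=
    (p.*2 ^ 2)%:R * \tr (gram (cmul c y) *m gram (cmul c y) *m dev (cmul c x) ^+ q.*2).
Proof.
move=> k0 [x04 mx tx] xmin yfree my ty.
set X := dev (cmul c x); set D := gram (cmul c y).
set Psi := potential p d (cmul c x).
have Psi0 : 0 < Psi by exact: potential_gt0.
have [t1 t10 Ht1] : exists2 e, 0 < e & forall i t, `|t| <= e -> 0 <= x 0 i + t * y 0 i <= 4.
  apply: fin_small => i; have [->|yi] := eqVneq (y 0 i) 0.
    by exists 1 => // t _; rewrite mulr0 addr0.
  have /andP[xi0 xi4] := yfree i yi.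
  have a0 : 0 < `|y 0 i| by rewrite normr_gt0.
  exists (Num.min (x 0 i) (4 - x 0 i) / `|y 0 i|).
    by rewrite divr_gt0 // lt_min xi0 subr_gt0.
  move=> t; rewrite ler_pdivlMr // -normrM le_min ler_norml => /andP[/andP[a b] e].
  by have := ler_norm (t * y 0 i); have := e; lra.
have adm t : `|t| <= t1 -> admissible (x + t *: y).
  move=> tt1; split.
  - by move=> i; rewrite !mxE; exact: Ht1.
  - by rewrite cmulDr cmulZr momentD momentZ mx my scaler0 addr0.
  - rewrite -tx -[RHS]addr0 -(mulr0 t) -ty /total mulr_sumr -big_split.
    by apply: eq_bigr => i _; rewrite !mxE.
have [K K0 HK] := tr_pow_expand X D p.*2.
pose L := \tr (pow_d1 X D p.*2) - Psi * kappa * (2 * \sum_i c 0 i * x 0 i * y 0 i).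
pose Q := \tr (pow_d2 X D p.*2) - Psi * kappa * energy y.
have ineq t : `|t| <= Num.min t1 1 -> 0 <= t * L + t ^+ 2 * Q + K * `|t| ^+ 3.
  rewrite le_min => /andP[tt1 tle1].
  have := xmin _ (adm t tt1); rewrite cmulDr cmulZr energyD.
  set e1 := 2 * _; set qt := energy x + _ + _.
  rewrite -/Psi => H.
  have {}H : Psi * expR (kappa * (qt - energy x)) <= potential p d (cmul c x + t *: cmul c y).
    rewrite -(ler_pM2r (expR_gt0 (- kappa * qt))) -mulrA -expRD.
    by apply: le_trans H; rewrite le_eqVlt; apply/orP; left; apply/eqP; congr (_ * expR _); ring.
  have {}H : Psi * (1 + kappa * (qt - energy x)) <= potential p d (cmul c x + t *: cmul c y).
    apply: le_trans H; rewrite ler_pM2l //; exact: expR_ge1Dx.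
  have := HK t tle1.
  have -> : X + t *: D = dev (cmul c x + t *: cmul c y).
    by rewrite /X /D /dev gramD gramZ addrAC.
  have : potential p d (cmul c x + t *: cmul c y) = \tr (dev (cmul c x + t *: cmul c y) ^+ p.*2) + n%:R * d ^+ p by [].
  have : Psi = \tr (X ^+ p.*2) + n%:R * d ^+ p by [].
  move: H; rewrite /qt /L /Q -/e1; nra.
have Q0 : 0 <= Q.
  apply: (@quad_coef_ge0 R Q K (Num.min t1 1)) => //; first by rewrite lt_min t10 ltr01.
  move=> t t0 tle.
  have := ineq t; rewrite gtr0_norm // => /(_ tle).
  have := ineq (- t); rewrite normrN gtr0_norm // sqrrN => /(_ tle).
  by lra.
apply: (@le_trans _ _ (\tr (pow_d2 X D p.*2))); first by rewrite -subr_ge0.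
by apply: tr_pow_d2_le; [exact: dev_tr|exact: gram_tr].
Qed.

(** Minimising multipliers leave few of the weights alive: more than a quarter
    of them strictly between the bounds would contradict [second_order], and
    at most a quarter sit at the upper bound because the mean is one. *)
Lemma halve : (8 * n.+1 <= S)%N -> exists c' : 'rV[R]_N,
  [/\ forall i, 0 <= c' 0 i, moment c' = 0, (2 * #|supp c'| <= S)%N &
      potential p d c' <= potential p d c * expR (halving_cost * p%:R ^+ 2 * n%:R / d / S%:R)].
Proof.
move=> nS.
have S_gt0 : 0 < S%:R :> R by rewrite ltr0n; apply: leq_trans nS; rewrite muln_gt0.
have p_gt0 : 0 < p%:R :> R by rewrite ltr0n.
(* With this reward the second-order conditions, summed over the rows of a
   projector, read 64 * (#|free| - (n + 1)) <= 8 * S. *)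
pose kappa : R := 64 * p%:R ^+ 2 / (d * S%:R).
have k0 : 0 < kappa.
  rewrite /kappa; apply: divr_gt0; last exact: mulr_gt0.
  by apply: mulr_gt0; [rewrite ltr0n|apply: exprn_gt0].
have [x adx xmin] := exists_minimizer kappa.
have [x04 mx tx] := adx.
pose free := [pred i | supp c i && (0 < x 0 i < 4)].
have free_small : (4 * #|free| <= S)%N.
  rewrite leqNgt; apply/negP => Sfree.
  (* The directions are the rows of the projector onto the solutions of the
     n + 1 linear constraints; scaling by the square roots of the weights makes
     the energy of a row its Euclidean norm. *)
  pose sc i : R := (free i)%:R * Num.sqrt (c 0 i).
  pose isc i : R := (free i)%:R / Num.sqrt (c 0 i).
  pose G : 'M[R]_(N, n + 1) :=
    row_mx (\matrix_(j, k) (sc j * u j 0 k)) (\col_j isc j).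
  have [P [PG PT PP Ptr]] := kernel_projector G.
  have PGu i : \sum_j (P i j * sc j) *: u j = 0.
    apply/rowP => k; rewrite summxE mxE.
    transitivity ((P *m G) i (lshift 1 k)); last by rewrite PG mxE.
    by rewrite mxE; apply: eq_bigr => j _; rewrite row_mxEl !mxE mulrA.
  have PG1 i : \sum_j P i j * isc j = 0.
    transitivity ((P *m G) i (rshift n ord0)); last by rewrite PG mxE.
    by rewrite mxE; apply: eq_bigr => j _; rewrite row_mxEr !mxE.
  pose y i : 'rV[R]_N := \row_j (P i j * isc j).
  have cy i j : c 0 j * y i 0 j = P i j * sc j.
    rewrite mxE /isc /sc; case: (boolP (free j)) => [/andP[cj _]|_]; last by rewrite !mul0r !mulr0.
    have s0 : Num.sqrt (c 0 j) != 0 by rewrite gt_eqF // sqrtr_gt0.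
    by rewrite -{1}(sqr_sqrtr (c_ge0 j)); field.
  have gcy i : gram (cmul c (y i)) = \sum_j P i j *: (sc j *: ((u j)^T *m u j)).
    by rewrite /gram; apply: eq_bigr => j _; rewrite mxE cy scalerA.
  have ey i : energy (y i) = \sum_(j | free j) P i j ^+ 2.
    rewrite /energy [RHS]big_mkcond; apply: eq_bigr => j _.
    rewrite expr2 mulrA cy mxE /isc /sc.
    case: (boolP (free j)) => [/andP[cj _]|_]; last by rewrite !mul0r !mulr0.
    have s0 : Num.sqrt (c 0 j) != 0 by rewrite gt_eqF // sqrtr_gt0.
    by rewrite !mul1r; field.
  set Psi := potential p d (cmul c x).
  have Psi0 : 0 < Psi by exact: potential_gt0.
  set Y := dev (cmul c x) ^+ q.
  have YT : Y^T = Y by rewrite exprmx_tr dev_tr.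
  have so i : Psi * kappa * \sum_(j | free j) P i j ^+ 2 <=
      (p.*2 ^ 2)%:R * \tr ((\sum_j P i j *: (sc j *: ((u j)^T *m u j) *m Y))
        *m (\sum_j P i j *: (sc j *: ((u j)^T *m u j) *m Y))^T).
    rewrite -ey; apply: le_trans (second_order k0 adx xmin _ _ _) _.
    - move=> j; rewrite mxE /isc; case: (boolP (free j)) => [/andP[]//|_].
      by rewrite mul0r mulr0 eqxx.
    - rewrite /moment -[RHS](PGu i); apply: eq_bigr => j _; by rewrite mxE cy.
    - rewrite -[RHS](PG1 i) /total [LHS]big_mkcond; apply: eq_bigr => j _; rewrite mxE /isc.
      by case: ifP => // /negbT cj; rewrite /free /= (negPf cj) mul0r mulr0.
    rewrite ler_pM2l ?ltr0n ?expn_gt0 // le_eqVlt; apply/orP; left; apply/eqP.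
    have -> : \sum_j P i j *: (sc j *: ((u j)^T *m u j) *m Y) = gram (cmul c (y i)) *m Y.
      by rewrite gcy mulmx_suml; apply: eq_bigr => j _; rewrite -!scalemxAl.
    rewrite trmx_mul YT gram_tr -addnn exprD -[_ ^+ q * _]/(Y *m Y) !mulmxA.
    by rewrite [RHS]mxtrace_mulC !mulmxA.
  have : Psi * kappa * (#|free|%:R - (n + 1)%:R) <= (p.*2 ^ 2)%:R * (2 * (Psi / d)).
    apply: (@le_trans _ _ (\sum_i Psi * kappa * \sum_(j | free j) P i j ^+ 2)).
      have Pk0 : 0 < Psi * kappa by exact: mulr_gt0.
      rewrite -mulr_sumr (ler_pM2l Pk0).
      apply: le_trans (proj_trace_restrict PT PP free Ptr) _.
      rewrite exchange_big /= ler_sum // => j _.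
      by rewrite (proj_diag PT PP) ler_sum // => i _; rewrite (projE PT).
    apply: le_trans (ler_sum _ (fun i _ => so i)) _.
    rewrite -mulr_sumr ler_pM2l ?ltr0n ?expn_gt0 //.
    apply: le_trans (proj_bessel PT PP _) _.
    apply: (@le_trans _ _ (\tr (gram c *m (Y *m Y^T)))).
      rewrite tr_gram_mul; apply: ler_sum => j _.
      rewrite -!scalemxAl [X in _ *m X]linearZ /= -scalemxAr scalerA mxtraceZ.
      rewrite tr_outer_sq u1 mul1r.
      apply: ler_wpM2r; first exact: dot_ge0.
      rewrite /sc; case: (free j); last by rewrite !mul0r.
      by rewrite !mul1r -expr2 sqr_sqrtr.
    apply: le_trans (tr_gram_mul_le _ c_le2) _.
    rewrite ler_pM2l ?ltr0n // ler_pdivlMr // mulrC frob_pow ?dev_tr //.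
    exact: tr_pow_interp (dev_tr _) d_gt0.
  have pd0 : 0 < Psi * (p%:R ^+ 2 / d) by rewrite mulr_gt0 ?divr_gt0 ?exprn_gt0.
  have d0 : d != 0 by rewrite gt_eqF.
  have S0 : S%:R != 0 :> R by rewrite gt_eqF.
  have -> : Psi * kappa * (#|free|%:R - (n + 1)%:R) =
      Psi * (p%:R ^+ 2 / d) * (64 / S%:R * (#|free|%:R - (n + 1)%:R)).
    by rewrite /kappa; field; rewrite d0 S0.
  have -> : (p.*2 ^ 2)%:R * (2 * (Psi / d)) = Psi * (p%:R ^+ 2 / d) * 8.
    by rewrite -muln2 expnMn natrM natrX; field.
  rewrite ler_pM2l // mulrAC ler_pdivrMr // => H.
  have h1 : 8 * (n + 1)%:R <= S%:R :> R by rewrite -natrM ler_nat addn1.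
  have h2 : S%:R < 4 * #|free|%:R :> R by rewrite -natrM ltr_nat.
  by lra.
exists (cmul c x); split => //.
- by move=> i; rewrite mxE mulr_ge0 //; have /andP[] := x04 i.
- pose full := [pred i | supp c i && (x 0 i == 4)].
  have full_small : (4 * #|full| <= S)%N.
    rewrite -(ler_nat R) natrM -tx /total (bigID (fun i => x 0 i == 4)) /=.
    rewrite -[leLHS]addr0 lerD //; last by apply: sumr_ge0 => i _; have /andP[] := x04 i.
    rewrite -sum1_card natr_sum mulr_sumr ler_sum // => i /andP[_ /eqP->].
    by rewrite mulr1.
  have : (#|supp (cmul c x)| <= #|free| + #|full|)%N.
    rewrite -cardUI; apply: leq_trans (leq_addr _ _); apply: subset_leq_card.
    apply/fintype.subsetP => i; rewrite !inE unfold_in /= mxE => cx.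
    have /andP[xi0 xi4] := x04 i.
    have ci : supp c i.
      by rewrite /supp lt0r c_ge0 andbT; apply: contraTneq cx => ->; rewrite mul0r ltxx.
    have xi : 0 < x 0 i.
      by rewrite lt0r xi0 andbT; apply: contraTneq cx => ->; rewrite mulr0 ltxx.
    by rewrite ci xi /= lt_neqAle xi4 andbT orNb.
  by lia.
- (* The multipliers found do at least as well as the constant ones. *)
  have ad1 : admissible (const_mx 1).
    split.
    + by move=> i; rewrite mxE; lra.
    + suff -> : cmul c (const_mx 1) = c by [].
      by apply/rowP => i; rewrite !mxE mulr1.
    + rewrite /total (eq_bigr (fun=> 1)); last by move=> i _; rewrite mxE.
      by rewrite sumr_const.
  have c1 : cmul c (const_mx 1) = c by apply/rowP => i; rewrite !mxE mulr1.
  have := xmin _ ad1; rewrite c1 => H.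
  have {}H : potential p d (cmul c x) <= potential p d c * expR (kappa * (energy x - energy (const_mx 1))).
    rewrite -(ler_pM2r (expR_gt0 (- kappa * energy x))) -mulrA -expRD.
    by apply: le_trans H _; rewrite le_eqVlt; apply/orP; left; apply/eqP; congr (_ * expR _); ring.
  apply: le_trans H _; rewrite ler_pM2l ?potential_gt0 // ler_expR.
  have e1 : 0 <= energy (const_mx 1).
    by apply: sumr_ge0 => i _; rewrite mulr_ge0 ?sqr_ge0.
  have sc2 : \sum_i c 0 i <= 2 * n%:R.
    rewrite -tr_gram; have := tr_gram_mul_le 1%:M c_le2.
    by rewrite trmx1 !mulmx1 mxtrace1.
  have ex : energy x <= 32 * n%:R.
    apply: (@le_trans _ _ (16 * \sum_i c 0 i)); last by lra.
    rewrite mulr_sumr; apply: ler_sum => i _; rewrite mulrC ler_wpM2r //.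
    by have /andP[a b] := x04 i; nra.
  have -> : halving_cost * p%:R ^+ 2 * n%:R / d / S%:R = kappa * (32 * n%:R).
    by rewrite /kappa /halving_cost; field; rewrite !gt_eqF.
  by rewrite ler_pM2l //; lra.
Qed.

End Halve.

(** By the Cauchy-Schwarz inequality the square of the quadratic form of
    [X ^+ m] at a unit vector is at most the form of [X ^+ m.*2]; the exponent
    is a power of two because this doubling step is iterated. *)
Lemma form_pow_le (X : 'M[R]_n) k v : X^T = X -> dot v v = 1 ->
  dot (v *m X) v ^+ (2 ^ k.+1) <= \tr (X ^+ (2 ^ k.+1)).
Proof.
move=> sX v1.
have step m : dot (v *m X ^+ m) v ^+ 2 <= dot (v *m X ^+ m.*2) v.
  apply: le_trans (cauchy_schwarz _ _) _; rewrite v1 mulr1 dot_mulmxr exprmx_tr sX.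
  by rewrite -mulmxA -[X ^+ m *m X ^+ m]/(X ^+ m * X ^+ m) -exprD addnn.
have even j : 0 <= dot (v *m X ^+ j.*2) v by apply: le_trans (step j); exact: sqr_ge0.
have : dot (v *m X) v ^+ (2 ^ k.+1) <= dot (v *m X ^+ (2 ^ k.+1)) v.
  elim: k => [|k IH]; first exact: (step 1%N).
  rewrite [in leLHS]expnSr exprM [(2 ^ k.+2)%N]expnSr muln2.
  apply: le_trans (step _).
  rewrite ler_pXn2r // nnegrE; first by rewrite expnSr exprM sqr_ge0.
  by rewrite expnSr muln2; exact: even.
move=> H; apply: le_trans H _.
rewrite expnSr muln2 -addnn exprD -[_ * _]/(X ^+ (2 ^ k) *m X ^+ (2 ^ k)) mulmxA.
rewrite dot_mulmx exprmx_tr sX; apply: le_trans (dot_mulmx_frob _ _) _.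
by rewrite v1 mul1r exprmx_tr sX.
Qed.

Lemma dev_bound k d c (eta : R) : 0 <= eta -> 0 < d ->
  potential (2 ^ k) d c <= eta ^+ (2 ^ k).*2 ->
  forall x, `|dot (x *m gram c) x - dot x x| <= eta * dot x x.
Proof.
move=> eta0 d0 H x.
have -> : dot (x *m gram c) x - dot x x = dot (x *m dev c) x.
  by rewrite /dev mulmxBr mulmx1 dotBl.
have [->|x0] := eqVneq x 0; first by rewrite mul0mx dot0l mulr0 normr0.
have nx : 0 < enorm x by rewrite enorm_gt0.
pose v := (enorm x)^-1 *: x.
have xv : x = enorm x *: v by rewrite /v scalerA divff ?scale1r // gt_eqF.
have v1 : dot v v = 1.
  by rewrite /v dotZl dotZr -sqr_enorm; field; rewrite gt_eqF.
clearbody v.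
rewrite xv -scalemxAl !(dotZl, dotZr) v1 mulr1 !mulrA normrM ger0_norm; last first.
  by rewrite -expr2 sqr_ge0.
rewrite -(mulrA eta) mulrC ler_wpM2r //; first by rewrite -expr2 sqr_ge0.
rewrite -(@ler_pXn2r _ (2 ^ k.+1)) ?nnegrE ?expn_gt0 //.
rewrite -normrX ger0_norm; last by rewrite expnSr exprM sqr_ge0.
apply: le_trans (form_pow_le k (dev_tr c) v1) _.
rewrite expnSr muln2; apply: le_trans H.
by rewrite /potential lerDl mulr_ge0 ?exprn_ge0 // ltW.
Qed.

(** Repeated halving. The costs form a geometric series dominated by its last
    term, so the growth exponent is inversely proportional to the final
    number of points. *)
Lemma sparsify_iter k (d eta L : R) (c : 'rV[R]_N) :
  let p := (2 ^ k)%N in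
  let E := halving_cost * p%:R ^+ 2 * n%:R / d in
  0 < d -> 0 <= eta <= 1 -> 4 * n.+1%:R <= L ->
  n%:R * d ^+ p * expR (E / L) <= eta ^+ p.*2 ->
  (forall i, 0 <= c 0 i) -> moment c = 0 ->
  potential p d c <= n%:R * d ^+ p * expR (E / Num.max #|supp c|%:R L) ->
  exists c' : 'rV[R]_N, [/\ forall i, 0 <= c' 0 i, moment c' = 0, #|supp c'|%:R <= 2 * L &
      forall x, `|dot (x *m gram c') x - dot x x| <= eta * dot x x].
Proof.
move=> p E d0 /andP[eta0 eta1] L4 Hbase.
have L0 : 0 < L by apply: lt_le_trans L4; rewrite mulr_gt0 ?ltr0n.
have E0 : 0 <= E by rewrite /E divr_ge0 ?(ltW d0) // mulr_ge0 // mulr_ge0 ?exprn_ge0 // ltW // halving_cost_gt0.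
have [m] := ubnP #|supp c|; elim: m c => // m IH c; rewrite ltnS => Sm c0 cb Hc.
have mono M : L <= M -> E / M <= E / L.
  move=> LM; rewrite ler_wpM2l // lef_pV2 // posrE //; exact: lt_le_trans LM.
have nd0 : 0 < n%:R * d ^+ p by rewrite mulr_gt0 ?exprn_gt0 ?ltr0n.
have Hb : forall x, `|dot (x *m gram c) x - dot x x| <= eta * dot x x.
  apply: (@dev_bound k d) => //; apply: le_trans Hc _; apply: le_trans Hbase.
  by rewrite ler_pM2l // ler_expR mono // le_max lexx orbT.
have [small|big] := leP #|supp c|%:R (2 * L); first by exists c.
(* The deviation bound supplies the spectral hypothesis of the next halving. *)
have c2 x : dot (x *m gram c) x <= 2 * dot x x.
  have := ler_norm (dot (x *m gram c) x - dot x x); have := Hb x.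
  have := dot_ge0 x; nra.
have S8 : (8 * n.+1 <= #|supp c|)%N.
  by rewrite -(ler_nat R) natrM; apply: ltW; lra.
have SL : Num.max #|supp c|%:R L = #|supp c|%:R :> R.
  by apply/max_idPl; lra.
have p_gt0 : (0 < p)%N by rewrite expn_gt0.
have [c' [c'0 c'b c'S c'P]] := @halve p.-1 d c d0 c0 cb c2 S8.
rewrite prednK // in c'P.
have S0 : 0 < #|supp c|%:R :> R by apply: lt_trans big; rewrite mulr_gt0.
apply: (IH c') => //.
  apply: leq_trans Sm.
  have : (0 < #|supp c|)%N by rewrite -(ltr_nat R).
  by move: c'S; clear; lia.
apply: le_trans c'P _; apply: le_trans (ler_wpM2r (expR_ge0 _) Hc) _.
rewrite -[leLHS]mulrA -expRD SL ler_pM2l // ler_expR.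
rewrite -/E -[E / _ + _]mulr2n -[_ *+ 2]mulr_natr -mulrA ler_wpM2l //.
have -> : #|supp c|%:R^-1 * 2 = (#|supp c|%:R / 2)^-1 :> R by rewrite invf_div mulrC.
rewrite lef_pV2 ?posrE ?divr_gt0 //; last by rewrite lt_max L0 orbT.
rewrite ge_max; apply/andP; split; last by lra.
by rewrite ler_pdivlMr // mulrC -natrM ler_nat.
Qed.

End Sparsify.

(** * The volume of an ellipsoid *)

Section Reflection.
Variable (R : realType).

(** The Householder reflection exchanging [x] with a multiple of the first
    basis vector. *)
Lemma reflection n (x : 'rV[R]_n.+1) : exists O : 'M[R]_n.+1,
  [/\ O^T = O, O *m O = 1%:M & x *m O = enorm x *: delta_mx 0 0].
Proof.
set y := enorm x *: delta_mx 0 0; pose w := x - y.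
have yy : dot y y = dot x x.
  by rewrite /y !(dotZl, dotZr) dot_delta_mx mulr1 -expr2 sqr_enorm.
have [w0|w0] := eqVneq w 0.
  exists 1%:M; rewrite trmx1 mulmx1; split => //; rewrite mulmx1.
  by apply/eqP; rewrite -subr_eq0; apply/eqP.
have ww0 : dot w w != 0 by rewrite dot_eq0.
have ww : dot w w = 2 * dot x w.
  by rewrite /w !(dotBl, dotBr) (dotC y x) yy; ring.
pose H := w^T *m w.
have HH : H *m H = dot w w *: H.
  by rewrite /H mulmxA -(mulmxA w^T) [w *m _]mx11_scalar dotE mul_mx_scalar scalemxAl.
exists (1%:M - (2 / dot w w) *: H); split.
- by rewrite linearB linearZ /= trmx1 trmx_mul trmxK.
- rewrite mulmxBl !mulmxBr !mul1mx mulmx1 -scalemxAl -scalemxAr HH !scalerA.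
  have -> : 2 / dot w w * (2 / dot w w) * dot w w = 2 / dot w w + 2 / dot w w by field.
  by rewrite scalerDl opprB addrK subrK.
- rewrite mulmxBr mulmx1 -scalemxAr mulmx_outer scalerA.
  have -> : 2 / dot w w * dot x w = 1 by rewrite mulrAC -ww divff.
  by rewrite scale1r /w opprB addrC subrK.
Qed.

(** An invertible matrix becomes block upper triangular after an orthogonal
    change of the parameter. *)
Lemma orthogonal_block m (A : 'M[R]_(1 + m)) : A \in unitmx ->
  exists (Q : 'M[R]_(1 + m)) (a : R) (b : 'rV[R]_m) (T : 'M[R]_m),
  [/\ Q *m Q^T = 1%:M, 0 < a, T \in unitmx, `|\det A| = a * `|\det T| &
      A = Q *m block_mx (a%:M : 'M[R]_1) b 0 T].
Proof.
move=> uA; have [Q [OT OO Ox]] := reflection (col 0 A)^T.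
pose a := enorm (col 0 A)^T; pose B : 'M[R]_(1 + m) := Q *m A.
have detQ : `|\det Q| = 1.
  have : `|\det Q| ^+ 2 = 1 by rewrite -normrX expr2 -det_mulmx OO det1 normr1.
  by move=> /eqP; rewrite sqrf_eq1 => /orP[/eqP//|/eqP H]; have := normr_ge0 (\det Q); rewrite H; lra.
have dAB : `|\det A| = `|\det B| by rewrite det_mulmx normrM detQ mul1r.
have AQB : A = Q *m B by rewrite mulmxA OO mul1mx.
have B0 i : B i 0 = a *+ (i == 0).
  have -> : B i 0 = ((col 0 A)^T *m Q) 0 i.
    rewrite !mxE; apply: eq_bigr => j _; rewrite !mxE mulrC; congr (_ * _).
    by rewrite -{1}OT mxE.
  by rewrite Ox !mxE eqxx /= mulr_natr.
clearbody B; have Bblock : B = block_mx (a%:M : 'M[R]_1) (ursubmx B) 0 (drsubmx B).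
  rewrite -{1}(submxK B); congr block_mx.
    apply/matrixP => i j; rewrite !mxE !ord1.
    have -> : lshift m (0 : 'I_1) = 0 by apply: val_inj.
    by rewrite B0 eqxx.
  apply/matrixP => i j; rewrite !mxE !ord1.
  have -> : lshift m (0 : 'I_1) = 0 by apply: val_inj.
  by rewrite B0.
have detB : \det B = a * \det (drsubmx B) by rewrite {1}Bblock det_ublock det_scalar1.
have detA : `|\det A| = `|a * \det (drsubmx B)| by rewrite dAB detB.
have a_ge0 : 0 <= a by exact: enorm_ge0.
have : 0 < `|a * \det (drsubmx B)|.
  by rewrite -detA normr_gt0; move: uA; rewrite unitmxE unitfE.
rewrite normr_gt0 mulf_eq0 negb_or => /andP[a0 T0].
exists Q, a, (ursubmx B), (drsubmx B); split.
- by rewrite OT OO.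
- by rewrite lt0r a0.
- by rewrite unitmxE unitfE.
- by rewrite detA normrM ger0_norm.
- by rewrite -Bblock.
Qed.

End Reflection.

Section Volume.
Variable (R : realType).

Notation ball n := (@euclidean_unit_ball R n).

Lemma ballE n (u : 'rV[R]_n) : ball n u <-> dot u u <= 1.
Proof. by rewrite dot_sqr. Qed.

Definition affine_ball n (c : 'rV[R]_n) (A : 'M[R]_n) : set 'rV[R]_n :=
  [set c + u *m A | u in ball n].

Lemma affine_ball_orthogonal n (c : 'rV[R]_n) (O A : 'M[R]_n) : O *m O^T = 1%:M ->
  affine_ball c (O *m A) = affine_ball c A.
Proof.
move=> OO; have OO' : O^T *m O = 1%:M by exact: mulmx1C.
apply/seteqP; split=> x [u /ballE u1 <-].
  exists (u *m O); last by rewrite mulmxA.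
  by apply/ballE; rewrite dot_mulmx -mulmxA OO mulmx1.
exists (u *m O^T); last by rewrite -mulmxA (mulmxA O^T) OO' mul1mx.
by apply/ballE; rewrite dot_mulmx trmxK -mulmxA OO' mulmx1.
Qed.

Lemma integral_lebesgue_indic (A : set R) : measurable A ->
  (\int[@lebesgue_measure R]_(t in [set: R]) (\1_A t)%:E = lebesgue_measure A)%E.
Proof. by move=> mA; rewrite integral_indic // setIT. Qed.

Lemma volumeS n (S : set 'rV[R]_n.+1) : volume S =
  (\int[@lebesgue_measure R]_(t in [set: R])
     volume [set y : 'rV[R]_n | S (row_mx (t%:M : 'rV[R]_1) y)])%E.
Proof. by []. Qed.

Lemma volume0 n : volume (set0 : set 'rV[R]_n) = 0%E.
Proof.
elim: n => [|n IH] /=; first by rewrite indicE in_set0.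
rewrite (_ : (fun t => _) = cst 0%E) ?integral0 //; apply/funext => t /=.
by rewrite -[RHS]IH; congr volume; apply/seteqP; split.
Qed.

Lemma volume_set1 n (p : 'rV[R]_n) : volume [set p] = ((n == 0)%N%:R)%:E.
Proof.
elim: n p => [|n IH] p.
  by rewrite /= indicE mem_set //=; apply/rowP => -[].
pose q : 'rV[R]_(1 + n) := p.
have secE t : volume [set y | [set p] (row_mx (t%:M : 'rV[R]_1) y)] =
    (((n == 0)%N%:R)%:E * (\1_[set lsubmx q 0 0] t)%:E)%E.
  have [->|tp] := eqVneq t (lsubmx q 0 0).
    rewrite indicE mem_set // mule1 -(IH (rsubmx q)); congr volume.
    apply/seteqP; split=> y /=.
      by move=> e; rewrite /q -e row_mxKr.
    by move=> ->; rewrite -[p]/q -[RHS](hsubmxK q) [lsubmx q in RHS]mx11_scalar.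
  rewrite indicE memNset; last by move=> /eqP; rewrite (negPf tp).
  rewrite mule0 -(volume0 n); congr volume; apply/seteqP; split=> // y /= yp.
  by move: tp; rewrite -[q]/p -yp row_mxKl mxE eqxx mulr1n eqxx.
rewrite /=; under eq_integral do rewrite secE.
rewrite ge0_integralZl_EFin //; last first.
  by apply/measurable_EFinP; exact: measurable_indic.
by rewrite integral_lebesgue_indic // lebesgue_measure_set1 mule0.
Qed.

(** The section of a block triangular ellipsoid at height [c0 + a s] is an
    ellipsoid shrunk by the factor [sqrt (1 - s ^ 2)]. *)
Lemma section_affine_ball m (c0 a : R) (c b : 'rV[R]_m) (T : 'M[R]_m) (t : R) :
  0 < a -> let s := (t - c0) / a in
  [set y | affine_ball (row_mx c0%:M c : 'rV[R]_(1 + m))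
             (block_mx (a%:M : 'M[R]_1) b 0 T) (row_mx (t%:M : 'rV[R]_1) y)] =
  [set y | exists2 v, dot v v <= 1 - s ^+ 2 & y = c + s *: b + v *m T].
Proof.
move=> a0 s; apply/seteqP; split=> y /=.
  move=> [u /ballE u1]; rewrite -(hsubmxK (u : 'rV[R]_(1 + m))) in u1 *.
  set u0 := lsubmx _ in u1 *; set v := rsubmx _ in u1 *.
  rewrite mul_row_block mulmx0 addr0 add_row_mx => /eq_row_mx[e1 e2].
  have u0s : u0 0 0 = s.
    move: e1 => /matrixP/(_ 0 0); rewrite mul_mx_scalar !mxE eqxx !mulr1n /s => <-.
    by field; rewrite gt_eqF.
  exists v; last first.
    by rewrite -e2 [u0]mx11_scalar u0s mul_scalar_mx addrA.
  move: u1; rewrite /dot big_split_ord /= big_ord1 !row_mxEl u0s -expr2.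
  under eq_bigr do rewrite row_mxEr.
  by rewrite lerBrDl.
move=> [v v1 ->]; exists (row_mx s%:M v).
  apply/ballE; rewrite /dot big_split_ord /= big_ord1 !row_mxEl mxE eqxx mulr1n -expr2.
  under eq_bigr do rewrite row_mxEr.
  by rewrite -lerBrDl.
rewrite mul_row_block mulmx0 addr0 add_row_mx addrA.
congr row_mx; last by rewrite mul_scalar_mx.
rewrite mul_scalar_mx; apply/matrixP => i j; rewrite !mxE !ord1 eqxx !mulr1n /s.
by field; rewrite gt_eqF.
Qed.

Lemma integral_affine (G : R -> R) (a b : R) : 0 < a -> continuous G -> (forall x, 0 <= G x) ->
  (\int[lebesgue_measure]_t (a * G t)%:E = \int[lebesgue_measure]_t (G ((t - b) / a))%:E)%E.
Proof.
move=> a0 cG G0.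
pose F t := (t - b) / a.
have dF (t : R) : is_derive t 1 F a^-1.
  rewrite (_ : F = (fun t => a^-1 *: (t - b))).
    by apply: is_derive_eq; rewrite subr0 scaler1.
  by apply/funext => x; rewrite /F mulrC.
have F' : F^`()%classic = cst a^-1.
  by apply/funext => t; rewrite derive1E; apply: derive_val.
rewrite (@increasing_ge0_integration_by_substitutionT R F (fun t => a * G t)).
- apply: eq_integral => t _; rewrite F' /=; congr (_%:E).
  rewrite -[((_ \o _) * _) t]/(a * G (F t) * a^-1).
  by rewrite mulrAC divff ?mul1r // gt_eqF.
- by move=> x y xy; rewrite /F ltr_pM2r ?invr_gt0 // ltrD2r.
- by rewrite F'; exact: cst_continuous.
- by rewrite F'; exact: is_cvg_cst.
- by rewrite F'; exact: is_cvg_cst.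
- by move=> t; have [] := dF t.
- apply/cvgrNyPle => M; near=> x; rewrite /F ler_pdivrMr // lerBlDr.
  by near: x; apply: nbhs_ninfty_le; rewrite num_real.
- apply/cvgryPge => M; near=> x; rewrite /F ler_pdivlMr // lerBrDr.
  by near: x; apply: nbhs_pinfty_ge; rewrite num_real.
- by apply: cont_mul => //; exact: cont_cst.
- by move=> x; rewrite mulr_ge0 // ltW.
Unshelve. all: by end_near.
Qed.

Lemma volume_section m (p : 'rV[R]_m.+1) (T : 'M[R]_m.+1) (r : R) (w : R) : T \in unitmx ->
  (forall c A, A \in unitmx -> volume (@affine_ball m.+1 c A) = (w * `|\det A|)%:E) ->
  volume [set y | exists2 v, dot v v <= r & y = p + v *m T] =
    (w * `|\det T| * Num.sqrt r ^+ m.+1)%:E.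
Proof.
move=> uT IH; have [r0|r0|r0] := ltrgtP r 0.
- rewrite ltr0_sqrtr // expr0n mulr0 -[RHS](volume0 m.+1); congr volume.
  by apply/seteqP; split=> // y /= [v vr _]; have := dot_ge0 v; lra.
- have s0 : 0 < Num.sqrt r by rewrite sqrtr_gt0.
  rewrite (_ : [set y | _] = affine_ball p (Num.sqrt r *: T)).
    rewrite IH; last by rewrite unitmxZ // unitfE gt_eqF.
    rewrite detZ normrM ger0_norm ?exprn_ge0 ?(ltW s0) //.
    by congr (_%:E); ring.
  apply/seteqP; split=> y /=.
    move=> [v vr ->]; exists ((Num.sqrt r)^-1 *: v); last first.
      by rewrite -scalemxAl -scalemxAr scalerA mulVf ?gt_eqF // scale1r.
    apply/ballE; rewrite dotZl dotZr mulrA -expr2 exprVn sqr_sqrtr ?(ltW r0) //.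
    by rewrite mulrC ler_pdivrMr // mul1r.
  move=> [u /ballE u1 <-]; exists (Num.sqrt r *: u).
    by rewrite dotZl dotZr mulrA -expr2 sqr_sqrtr ?(ltW r0) // ler_piMr // ltW.
  by rewrite -scalemxAl -scalemxAr.
- rewrite r0 sqrtr0 expr0n mulr0 (_ : [set y | _] = [set p]); first by rewrite volume_set1.
  apply/seteqP; split=> y /=.
    move=> [v vr ->]; have /eqP : dot v v = 0 by apply/eqP; rewrite eq_le vr dot_ge0.
    by rewrite dot_eq0 => /eqP->; rewrite mul0mx addr0.
  by move=> ->; exists 0; rewrite ?dot0l ?r0 // mul0mx addr0.
Qed.

(** The volume of the section at height [s] of a ball of dimension [m.+2],
    relative to the ball of dimension [m.+1]; it vanishes beyond the ball,
    where the square root of a negative number is [0]. *)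
Definition cap m (s : R) : R := Num.sqrt (1 - s ^+ 2) ^+ m.+1.

Lemma cont_cap m : continuous (cap m).
Proof.
apply: cont_exprn; apply: cont_sqrt; apply: cont_sub; first exact: cont_cst.
by apply: cont_exprn => x; exact: cvg_id.
Qed.

Lemma cap_ge0 m s : 0 <= cap m s.
Proof. by rewrite exprn_ge0 // sqrtr_ge0. Qed.

Lemma integral_cap m : exists2 k : R, 0 < k &
  (\int[lebesgue_measure]_t (cap m t)%:E = k%:E)%E.
Proof.
have mcap : measurable_fun [set: measurableTypeR R] (fun t => (cap m t)%:E).
  by apply/measurable_EFinP; apply: continuous_measurable_fun; exact: cont_cap.
have c0 t : (0 <= (cap m t)%:E)%E by rewrite lee_fin cap_ge0.
have indI (a b : R) (k : R) : 0 <= k -> a < b ->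
    (\int[@lebesgue_measure R]_t (k * \1_`[a, b] t)%:E = (k * (b - a))%:E)%E.
  move=> k0 ab; under eq_integral do rewrite EFinM.
  rewrite ge0_integralZl_EFin //; last first.
    by apply/measurable_EFinP; exact: measurable_indic.
  by rewrite integral_lebesgue_indic // lebesgue_measure_itv /= lte_fin ab EFinM EFinB.
have up : (\int[lebesgue_measure]_t (cap m t)%:E <= 2%:E)%E.
  have -> : 2%:E = (1 * (1 - (- 1)))%:E :> \bar R by congr (_%:E); lra.
  have lt11 : -1 < 1 :> R by lra.
  rewrite -indI //.
  apply: ge0_le_integral => //.
    by apply/measurable_EFinP; apply: measurable_funM => //; exact: measurable_indic.
  move=> t _; rewrite lee_fin mul1r indicE /cap.
  have [t1|t1] := leP (t ^+ 2) 1.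
    rewrite mem_set; last first.
      by rewrite /= in_itv /= -ler_norml -(ler_pXn2r (n := 2)) ?nnegrE // expr1n real_normK ?num_real.
    rewrite /= exprn_ile1 ?sqrtr_ge0 // -[leRHS]sqrtr1 ler_wsqrtr //.
    by rewrite lerBlDr lerDl sqr_ge0.
  by rewrite ltr0_sqrtr ?expr0n //; lra.
have low : ((2^-1 ^+ m.+1)%:E <= \int[lebesgue_measure]_t (cap m t)%:E)%E.
  have -> : (2^-1 ^+ m.+1)%:E = (2^-1 ^+ m.+1 * (2^-1 - (- 2^-1)))%:E :> \bar R.
    by congr (_%:E); lra.
  have lt22 : - 2^-1 < 2^-1 :> R by lra.
  rewrite -indI ?exprn_ge0 //.
  apply: ge0_le_integral => //.
  - by apply/measurable_EFinP; apply: measurable_funM => //; exact: measurable_indic.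
  move=> t _; rewrite lee_fin indicE /cap.
  have [|] := boolP (t \in _); last by rewrite mulr0 exprn_ge0 // sqrtr_ge0.
  rewrite inE /= in_itv /= => /andP[t1 t2]; rewrite mulr1.
  rewrite ler_pXn2r ?nnegrE ?sqrtr_ge0 //.
  have -> : 2^-1 = Num.sqrt (2^-1 ^+ 2) :> R by rewrite sqrtr_sqr ger0_norm.
  by apply: ler_wsqrtr; nra.
move: up low; case: (\int[lebesgue_measure]_t _)%E => [k||] //.
rewrite !lee_fin => _ low; exists k => //; apply: lt_le_trans low.
by rewrite exprn_gt0.
Qed.

(** By induction on the dimension: after an orthogonal change of the parameter
    the sections are ellipsoids whose volumes are known, and the integral of
    their scaling factors does not depend on the ellipsoid.  Volumes are only
    compared with each other, which is why the constant stays implicit. *)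
Theorem volume_affine_ball n : exists2 w : R, 0 < w &
  forall c A, A \in unitmx -> volume (@affine_ball n c A) = (w * `|\det A|)%:E.
Proof.
elim: n => [|m [w w0 IH]].
  exists 1 => // c A _; rewrite /= indicE det_mx00 normr1 mulr1 mem_set //.
  by exists 0; [apply/ballE; rewrite dot0l|apply/rowP => -[]].
have red (c : 'rV[R]_m.+1) (A : 'M[R]_(1 + m)) : A \in unitmx -> exists a b T, [/\ 0 < a, T \in unitmx,
    `|\det A| = a * `|\det T| & forall t, let s := (t - c 0 0) / a in
    [set y | @affine_ball m.+1 c A (row_mx (t%:M : 'rV[R]_1) y)] =
    [set y | exists2 v, dot v v <= 1 - s ^+ 2 & y = (rsubmx (c : 'rV[R]_(1 + m)) + s *: b) + v *m T]].
  move=> uA; have [Q [a [b [T [QQ a0 uT dA AE]]]]] := orthogonal_block uA.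
  exists a, b, T; split=> // t s.
  rewrite -section_affine_ball // AE affine_ball_orthogonal //.
  have cE : c = row_mx (c 0 0)%:M (rsubmx (c : 'rV[R]_(1 + m))).
    rewrite -[LHS](hsubmxK (c : 'rV[R]_(1 + m))) [lsubmx _]mx11_scalar; congr (row_mx (_%:M) _).
    by rewrite mxE; congr (c _ _); apply: val_inj.
  by rewrite {1}cE.
(* In dimension one the sections are points or empty, and the powers of the
   square root degenerate to indicators. *)
case: m w w0 IH red => [|m] w w0 IH red.
  exists 2 => // c A uA; have [a [b [T [a0 uT dA secE]]]] := red c A uA.
  rewrite dA det_mx00 normr1 mulr1 /=.
  transitivity (\int[@lebesgue_measure R]_(t in [set: R]) (\1_`[c 0 0 - a, c 0 0 + a] t)%:E)%E.
    apply: eq_integral => t _; congr (_%:E); rewrite secE !indicE; congr (_%:R); congr nat_of_bool.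
    set s := (t - c 0 0) / a.
    have ts : t = c 0 0 + a * s by rewrite /s; field; rewrite gt_eqF.
    apply/idP/idP; rewrite !inE /= in_itv /=.
      move=> [v vs _]; have s1 : s ^+ 2 <= 1 by have := dot_ge0 v; lra.
      by rewrite ts; apply/andP; split; nra.
    rewrite {1 2}ts => /andP[h1 h2]; exists 0; last by apply/rowP => -[].
    rewrite dot0l subr_ge0.
    have s1 : - 1 <= s by rewrite -(ler_pM2l a0); lra.
    have s2 : s <= 1 by rewrite -(ler_pM2l a0); lra.
    by nra.
  rewrite integral_lebesgue_indic // lebesgue_measure_itv /= lte_fin ifT; last by lra.
  by rewrite -EFinB; congr (_%:E); lra.
have [k k0 kE] := integral_cap m.
exists (w * k); first by rewrite mulr_gt0.
move=> c A uA; have [a [b [T [a0 uT dA secE]]]] := red c A uA.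
have dT0 : 0 < `|\det T| by rewrite normr_gt0 -unitfE -unitmxE.
rewrite dA volumeS.
transitivity (\int[@lebesgue_measure R]_(t in [set: R])
    (w * `|\det T| * cap m ((t - c 0 0) / a))%:E)%E.
  by apply: eq_integral => t _; rewrite secE (volume_section _ _ uT IH).
rewrite -(@integral_affine (fun s => w * `|\det T| * cap m s)) //; last 2 first.
- by apply: cont_mul; [exact: cont_cst|exact: cont_cap].
- by move=> x; rewrite !mulr_ge0 ?cap_ge0 // ltW.
under eq_integral do rewrite mulrA EFinM.
rewrite ge0_integralZl_EFin //.
- by rewrite kE -EFinM; congr (_%:E); ring.
- by move=> t _; rewrite lee_fin cap_ge0.
- by apply/measurable_EFinP; apply: continuous_measurable_fun; exact: cont_cap.
- by rewrite !mulr_ge0 // ltW.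
Qed.

End Volume.

(** * A decomposition of the identity characterises the John ellipsoid *)

Section JohnConverse.
Variable (R : realType).

(** An ellipsoid does not change under an orthogonal change of its parameter,
    so its matrix may be taken triangular with positive diagonal: the
    determinant and the trace then involve the same numbers. *)
Lemma orthogonal_trig n (A : 'M[R]_n) : A \in unitmx ->
  exists (Q L : 'M[R]_n),
  [/\ Q *m Q^T = 1%:M, is_trig_mx L, forall i, 0 < L i i & A = Q *m L^T].
Proof.
elim: n A => [|m IH] A uA.
  exists 1%:M, A; split; first by rewrite trmx1 mulmx1.
  - by apply/is_trig_mxP => -[].
  - by case.
  - by apply/matrixP => -[].
have [Q [a [b [T [QQ a0 uT _ ->]]]]] := @orthogonal_block R m A uA.
have [Q' [L [QQ' /is_trig_mxP tL L0 ->]]] := IH T uT.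
pose Z : 'M[R]_(1 + m) := block_mx 1%:M 0 0 Q'.
pose M : 'M[R]_(1 + m) := block_mx (a%:M : 'M[R]_1) 0 b^T L.
have ZZ : Z *m Z^T = 1%:M.
  rewrite /Z tr_block_mx !trmx0 trmx1 mulmx_block !mulmx0 !mul0mx mulmx1 !addr0 add0r QQ'.
  by rewrite -scalar_mx_block.
have ZM : block_mx (a%:M : 'M[R]_1) b 0 (Q' *m L^T) = Z *m M^T.
  rewrite /Z /M tr_block_mx trmx0 trmxK tr_scalar_mx mulmx_block.
  by rewrite !mul1mx !mul0mx !mulmx0 !addr0 !add0r.
have tM : @is_trig_mx R (1 + m) (1 + m) M.
  by rewrite /M is_trig_block_mx // eqxx scalar_mx_is_trig /=; apply/is_trig_mxP.
have M0 (i : 'I_(1 + m)) : 0 < M i i.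
  rewrite -(splitK i); case: (fintype.split i) => j /=.
    by rewrite /M block_mxEul !ord1 mxE eqxx.
  by rewrite /M block_mxEdr.
exists (Q *m Z), M; split.
- by rewrite trmx_mul mulmxA -(mulmxA Q) ZZ mulmx1.
- exact: tM.
- exact: M0.
- by rewrite ZM mulmxA.
Qed.

(** The left-hand side is the support function of the ellipsoid at [v]. *)
Lemma affine_ball_halfspace n (c : 'rV[R]_n) A v :
  (forall x, affine_ball c A x -> dot x v <= 1) -> enorm (v *m A^T) + dot c v <= 1.
Proof.
move=> H; set w := v *m A^T.
have [w0|w0] := eqVneq w 0.
  rewrite w0 enorm0 add0r -[c]addr0 -(mul0mx _ A); apply: H.
  by exists 0 => //; apply/ballE; rewrite dot0l.
have nw : enorm w != 0 by rewrite gt_eqF // enorm_gt0.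
have -> : enorm w + dot c v = dot (c + ((enorm w)^-1 *: w) *m A) v.
  by rewrite dotDl dot_mulmx -/w dotZl -sqr_enorm expr2 mulrA mulVf // mul1r addrC.
apply: H.
exists ((enorm w)^-1 *: w) => //; apply/ballE.
clearbody w; rewrite dotZl dotZr -sqr_enorm le_eqVlt; apply/orP; left; apply/eqP.
by field.
Qed.

(** The eigenvalue is read off at the last nonzero coordinate of the
    eigenvector. *)
Lemma trig_eigenvalue n (L : 'M[R]_n) (v : 'rV[R]_n) lam :
  is_trig_mx L -> (forall i, L i i = 1) -> v != 0 -> v *m L = lam *: v -> lam = 1.
Proof.
move=> /is_trig_mxP tL L1 v0 vL.
have [i0 vi0] : exists i, v 0 i != 0.
  apply/existsP; rewrite -negb_forall; apply: contra v0 => /forallP H.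
  by apply/eqP/rowP => i; rewrite mxE; apply/eqP; have := H i.
have [l vl lmax] := @arg_maxnP _ i0 (fun i => v 0 i != 0) val vi0.
have : (v *m L) 0 l = v 0 l.
  rewrite mxE (bigD1 l) //= L1 mulr1 big1 ?addr0 // => j jl.
  have [lj|lj] := ltnP l j.
    have [->|vj] := eqVneq (v 0 j) 0; first by rewrite mul0r.
    by have := lmax j vj; rewrite /= leqNgt lj.
  rewrite tL ?mulr0 // ltn_neqAle lj andbT.
  by apply: contra jl => /eqP e; apply/eqP/val_inj.
rewrite vL mxE -[RHS]mul1r => /eqP; rewrite -subr_eq0 -mulrBl mulf_eq0 (negPf vl) orbF.
by rewrite subr_eq0 => /eqP.
Qed.

Section Contact.
Variables (n m : nat) (v : 'I_m -> 'rV[R]_n) (b : 'rV[R]_m).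
Hypothesis n_gt0 : (0 < n)%N.
Hypothesis v1 : forall i, dot (v i) (v i) = 1.
Hypothesis b_gt0 : forall i, 0 < b 0 i.
Hypothesis gram1 : gram v b = 1%:M.
Hypothesis bal : moment v b = 0.

Lemma sum_weights : \sum_i b 0 i = n%:R.
Proof. by rewrite -(tr_gram v1) gram1 mxtrace1. Qed.

Lemma sum_dot_moment c : \sum_i b 0 i * dot c (v i) = 0.
Proof.
rewrite -[RHS](dot0r c) -bal /moment dot_sumr.
by apply: eq_bigr => i _; rewrite dotZr.
Qed.

Lemma tr_decomposition L : \tr L = \sum_i b 0 i * dot (v i *m L) (v i).
Proof.
rewrite -[L in LHS]mul1mx -gram1 /gram mulmx_suml raddf_sum; apply: eq_bigr => i _ /=.
by rewrite -scalemxAl mxtraceZ tr_outer.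
Qed.

(** Summing the support inequalities against the weights bounds the trace of a
    triangular factor by [n]; the inequality of the means then bounds the
    determinant, and equality propagates back. *)
Lemma john_det_le c A : A \in unitmx ->
  (forall i, enorm (v i *m A^T) + dot c (v i) <= 1) ->
  `|\det A| <= 1 /\ (1 <= `|\det A| -> affine_ball c A = @euclidean_unit_ball R n).
Proof.
move=> uA H; have [Q [L [QQ tL L0 AE]]] := orthogonal_trig uA.
have vL i : enorm (v i *m A^T) = enorm (v i *m L).
  have QQ' : Q^T *m Q = 1%:M by exact: mulmx1C.
  by rewrite AE trmx_mul trmxK mulmxA /enorm dot_mulmx trmxK -mulmxA QQ' mulmx1.
have detQ : `|\det Q| = 1.
  have : `|\det Q| ^+ 2 = 1 by rewrite -normrX expr2 -{2}det_tr -det_mulmx QQ det1 normr1.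
  by move=> /eqP; rewrite sqrf_eq1 => /orP[/eqP//|/eqP E]; have := normr_ge0 (\det Q); rewrite E; lra.
have detA : `|\det A| = \prod_i L i i.
  rewrite AE det_mulmx normrM detQ mul1r det_tr det_trig // ger0_norm //.
  by apply: prodr_ge0 => i _; rewrite ltW.
have ineq : \sum_i b 0 i * (enorm (v i *m L) - dot (v i *m L) (v i)) <= n%:R - \tr L.
  have <- : \sum_i (b 0 i - b 0 i * dot c (v i) - b 0 i * dot (v i *m L) (v i)) = n%:R - \tr L.
    by rewrite !sumrB sum_weights sum_dot_moment subr0 -tr_decomposition.
  apply: ler_sum => i _.
  have := H i; rewrite vL; have := b_gt0 i; nra.
have term0 i : 0 <= b 0 i * (enorm (v i *m L) - dot (v i *m L) (v i)).
  apply: mulr_ge0; [exact: ltW|rewrite subr_ge0]; apply: le_trans (dot_le_enorm _ _) _.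
  have -> : enorm (v i) = 1 by rewrite /enorm v1 sqrtr1.
  by rewrite mulr1.
have trL : \tr L <= n%:R.
  rewrite -subr_ge0; apply: le_trans ineq.
  by apply: sumr_ge0 => i _; exact: term0.
have n0 : 0 < n%:R :> R by rewrite ltr0n.
have [agm agm_eq] := @leif_AGM R 'I_n predT (fun i => L i i) (fun i _ => ltW (L0 i)).
rewrite cardT size_enum_ord in agm agm_eq.
have mean1 : (\sum_(i in predT) L i i) / n%:R <= 1 by rewrite ler_pdivrMr // mul1r.
have mean0 : 0 <= (\sum_(i in predT) L i i) / n%:R.
  by rewrite divr_ge0 // sumr_ge0 // => i _; rewrite ltW.
split; first by rewrite detA; apply: le_trans agm _; rewrite exprn_ile1.
rewrite detA => det1.
have mean_eq : (\sum_(i in predT) L i i) / n%:R = 1.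
  apply/eqP; rewrite eq_le mean1 /= leNgt; apply/negP => lt1.
  have : ((\sum_(i in predT) L i i) / n%:R) ^+ n < 1 by rewrite exprn_ilt1 // -lt0n.
  by move=> /(le_lt_trans agm); rewrite ltNge det1.
have alleq : [forall i in predT, forall j in predT, L i i == L j j].
  by rewrite -agm_eq eq_le agm mean_eq expr1n.
have L1 i : L i i = 1.
  have : \sum_(j in predT) L j j = n%:R * L i i.
    rewrite (eq_bigr (fun _ => L i i)) ?sumr_const ?cardT ?size_enum_ord ?mulr_natl //.
    move=> j _; apply/eqP; move: alleq => /forallP/(_ j)/implyP/(_ isT)/forallP/(_ i).
    by move=> /implyP/(_ isT).
  by move: mean_eq => + e; rewrite e mulrAC divff ?mul1r // gt_eqF.
have trn : \tr L = n%:R.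
  by rewrite /mxtrace (eq_bigr (fun _ => 1)) ?sumr_const ?cardT ?size_enum_ord.
have eq_term i : enorm (v i *m L) = dot (v i *m L) (v i).
  have : \sum_i b 0 i * (enorm (v i *m L) - dot (v i *m L) (v i)) == 0.
    rewrite eq_le (le_trans ineq) ?trn ?subrr //.
    by apply: sumr_ge0 => j _; exact: term0.
  rewrite psumr_eq0 // => /allP/(_ i (mem_index_enum _)) /=.
  by rewrite mulf_eq0 gt_eqF //= subr_eq0 => /eqP.
(* Equality in Cauchy-Schwarz makes each v i an eigenvector of L. *)
have vLv i : v i *m L = v i.
  have e := dot_eq_enorm (v1 i) (esym (eq_term i)).
  have vi0 : v i != 0 by rewrite -dot_eq0 v1 oner_eq0.
  have := trig_eigenvalue tL L1 vi0 e => lam1.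
  by rewrite e lam1 scale1r.
have LI : L = 1%:M.
  rewrite -[LHS]mul1mx -gram1 /gram mulmx_suml; apply: eq_bigr => i _.
  by rewrite -scalemxAl -mulmxA vLv.
have c0 : c = 0.
  have cv i : dot c (v i) = 0.
    have le0 j : dot c (v j) <= 0.
      by have := H j; rewrite vL vLv /enorm v1 sqrtr1; lra.
    have : \sum_i b 0 i * - dot c (v i) == 0.
      by rewrite (eq_bigr (fun i => - (b 0 i * dot c (v i)))) ?sumrN ?sum_dot_moment ?oppr0 // => j _; rewrite mulrN.
    rewrite psumr_eq0 => [/allP/(_ i (mem_index_enum _)) /=|j _].
      by rewrite mulf_eq0 gt_eqF //= oppr_eq0 => /eqP.
    by rewrite mulr_ge0 ?oppr_ge0 // ltW.
  apply/eqP; rewrite -dot_eq0 -[X in dot X _]mulmx1 -gram1 dot_gram.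
  by rewrite big1 // => i _; rewrite cv expr0n mulr0.
rewrite c0 AE LI trmx1 affine_ball_orthogonal //.
apply/seteqP; split=> x; first by move=> [u u1 <-]; rewrite add0r mulmx1.
by move=> x1; exists x; rewrite // add0r mulmx1.
Qed.

(** By [volume_affine_ball] volumes of ellipsoids compare as determinants. *)
Theorem unit_ball_is_john (K : set 'rV[R]_n) :
  @euclidean_unit_ball R n `<=` K -> (forall x i, K x -> dot x (v i) <= 1) ->
  john_ellipsoid K (@euclidean_unit_ball R n).
Proof.
move=> DK Kv; have [w w0 volE] := volume_affine_ball R n.
have DE : @euclidean_unit_ball R n = affine_ball 0 1%:M.
  apply/seteqP; split=> x; last by move=> [u u1 <-]; rewrite add0r mulmx1.
  by move=> x1; exists x; rewrite // add0r mulmx1.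
have volD : volume (@euclidean_unit_ball R n) = w%:E.
  by rewrite DE volE ?unitmx1 // det1 normr1 mulr1.
have inK c A : A \in unitmx -> affine_ball c A `<=` K -> `|\det A| <= 1 /\
    (1 <= `|\det A| -> affine_ball c A = @euclidean_unit_ball R n).
  move=> uA AK; apply: john_det_le => // i; apply: affine_ball_halfspace => x /AK.
  exact: Kv.
split.
  split => //; first by exists 0, 1%:M; rewrite unitmx1.
  move=> E [c [A [uA ->]]] EK; rewrite -/(affine_ball c A) volE // volD lee_fin.
  by rewrite ger_pMr //; have [] := inK c A uA EK.
move=> E [[c [A [uA EE]]] EK Emax].
have := Emax (@euclidean_unit_ball R n).
move: EK; rewrite EE -/(affine_ball c A) => EK; rewrite volE // volD lee_fin.
rewrite ler_pMr // => H.
have [_ ->] := inK c A uA EK => //.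
by apply: H => //; exists 0, 1%:M; rewrite unitmx1.
Qed.

End Contact.
End JohnConverse.

(** * Restoring an exact decomposition by a small linear change *)

Section Perturb.
Variable (R : realType).

(** The norm expanded to first order, with an explicit quadratic error. *)
Lemma enorm_perturb n (v : 'rV[R]_n) (H : 'M[R]_n) t : dot v v = 1 ->
  enorm (v *m (1%:M + t *: H)) <=
  1 + t * dot (v *m H) v + t ^+ 2 * dot (v *m H) (v *m H).
Proof.
move=> v1; set a := dot (v *m H) v; set q := dot (v *m H) (v *m H).
have q0 : 0 <= q by exact: dot_ge0.
have aq : a ^+ 2 <= q by have := cauchy_schwarz (v *m H) v; rewrite v1 mulr1.
have pos : 0 <= 1 + t * a + t ^+ 2 * q.
  have tq : t ^+ 2 * a ^+ 2 <= t ^+ 2 * q by rewrite ler_wpM2l ?sqr_ge0.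
  by have := sqr_ge0 (1 + t * a / 2); have := sqr_ge0 (t * a); nra.
rewrite enorm_leP // mulmxDr mulmx1 -scalemxAr dotDl !dotDr !dotZl !dotZr v1 (dotC v) -/a -/q.
have : 0 <= (t * a + t ^+ 2 * q) ^+ 2 by exact: sqr_ge0.
have : 0 <= t ^+ 2 * q by rewrite mulr_ge0 ?sqr_ge0.
by nra.
Qed.

Lemma vec_mx_cont m n : mx_cont (fun x : 'rV[R]_(m * n) => vec_mx x).
Proof. by move=> i j; under eq_fun do rewrite mxE; exact: cont_coord. Qed.

Lemma entry_le_frob m n (A : 'M[R]_(m, n)) i j : A i j ^+ 2 <= \tr (A *m A^T).
Proof.
rewrite frobE (bigD1 i) //= (bigD1 j) //= -addrA lerDl addr_ge0 //.
  by apply: sumr_ge0 => k _; exact: sqr_ge0.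
by apply: sumr_ge0 => k _; apply: sumr_ge0 => l _; exact: sqr_ge0.
Qed.

End Perturb.

Section Position.
Variables (R : realType) (n m : nat) (u : 'I_m -> 'rV[R]_n) (w : 'rV[R]_m) (delta : R).
Hypothesis n_gt0 : (0 < n)%N.
Hypothesis u1 : forall i, dot (u i) (u i) = 1.
Hypothesis w_gt0 : forall i, 0 < w 0 i.
Hypothesis bal : moment u w = 0.
Hypothesis delta01 : 0 < delta < 1.
Hypothesis near1 : forall x, `|dot (x *m gram u w) x - dot x x| <= delta * dot x x.

Let gram_lower x : (1 - delta) * dot x x <= dot (x *m gram u w) x.
Proof. by have := near1 x; rewrite ler_norml => /andP[]; lra. Qed.

Let gram_upper x : dot (x *m gram u w) x <= (1 + delta) * dot x x.
Proof. by have := near1 x; rewrite ler_norml => /andP[]; lra. Qed.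

Let n0 : 0 < n%:R :> R. Proof. by rewrite ltr0n. Qed.

Let tr_gram_lower (A : 'M[R]_n) :
  (1 - delta) * \tr (A *m A^T) <= \sum_i w 0 i * dot (u i *m A) (u i *m A).
Proof.
have H x : dot (x *m gram u (-1 *: w)) x <= - (1 - delta) * dot x x.
  by rewrite gramZ -scalemxAr dotZl; have := gram_lower x; lra.
have := tr_gram_mul_le A H.
by rewrite gramZ -scalemxAl mxtraceZ tr_gram_mul; lra.
Qed.

(** Equal to the total weight at the identity, and linear along rays. *)
Let width (A : 'M[R]_n) := \sum_i w 0 i * enorm (u i *m A).

Let width_ge0 A : 0 <= width A.
Proof. by apply: sumr_ge0 => i _; rewrite mulr_ge0 ?enorm_ge0 // ltW. Qed.

Let widthZ a A : 0 <= a -> width (a *: A) = a * width A.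
Proof.
move=> a0; rewrite /width mulr_sumr; apply: eq_bigr => i _.
by rewrite -scalemxAr enormZ ger0_norm // mulrCA.
Qed.

(** The maximum is taken under [width A <= n]; by homogeneity it bounds the
    determinant for every other value [f] of the width. *)
Let det_max : exists2 A : 'M[R]_n, 0 < \det A & width A = n%:R /\
  forall (B : 'M[R]_n) f, 0 < f -> width B <= f -> \det B <= \det A * (f / n%:R) ^+ n.
Proof.
have /andP[d0 d1] := delta01.
pose M0 := \sum_i w 0 i * (n%:R / w 0 i) ^+ 2.
pose g (o : unit) (x : 'rV[R]_(n * n)) := width (vec_mx x) - n%:R.
have cg o : continuous (g o).
  apply: cont_sub; last exact: cont_cst.
  apply: cont_sum => i _; apply: cont_mul; first exact: cont_cst.
  apply: cont_enorm; apply: mx_cont_mul; first exact: mx_cont_cst.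
  exact: vec_mx_cont.
have cF : continuous (fun x : 'rV[R]_(n * n) => \det (vec_mx x : 'M[R]_n)).
  by apply: cont_det; exact: vec_mx_cont.
have bg x : (forall o, g o x <= 0) -> forall j, `|x 0 j| <= M0 / (1 - delta) + 1.
  move=> /(_ tt); rewrite /g subr_le0 => Hx j.
  case/mxvec_indexP: j => i j; rewrite -[x]vec_mxK mxvecE; set A := vec_mx x.
  have wi k : w 0 k * enorm (u k *m A) <= n%:R.
    apply: le_trans Hx; rewrite /width (bigD1 k) //= lerDl.
    by apply: sumr_ge0 => l _; rewrite mulr_ge0 ?enorm_ge0 // ltW.
  have trA : \tr (A *m A^T) <= M0 / (1 - delta).
    rewrite ler_pdivlMr ?subr_gt0 // mulrC; apply: le_trans (tr_gram_lower A) _.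
    apply: ler_sum => k _; rewrite -sqr_enorm ler_wpM2l //; first exact: ltW.
    by rewrite ler_pXn2r ?nnegrE ?enorm_ge0 ?divr_ge0 ?ler0n ?(ltW (w_gt0 k)) // ler_pdivlMr // mulrC.
  have := le_trans (entry_le_frob A i j) trA; rewrite -real_normK ?num_real //.
  by have := normr_ge0 (A i j); set a := `|A i j|; nra.
have W0 : 0 < width 1%:M.
  have := tr_gram_lower 1%:M; rewrite trmx1 mulmx1 mxtrace1.
  have -> : \sum_i w 0 i * dot (u i *m 1%:M) (u i *m 1%:M) = width 1%:M.
    by apply: eq_bigr => i _; rewrite mulmx1 u1 /enorm u1 sqrtr1.
  by apply: lt_le_trans; rewrite mulr_gt0 // subr_gt0.
pose s := n%:R / width 1%:M.
have s0 : 0 < s by rewrite divr_gt0.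
have g0 o : g o (mxvec (s *: 1%:M)) <= 0.
  by rewrite /g mxvecK widthZ ?(ltW s0) // /s divfK ?subrr // gt_eqF.
have [x /(_ tt) gx xmax] := argmax_le0 cg cF bg g0.
rewrite /g subr_le0 in gx.
set A := (vec_mx x : 'M[R]_n) in gx xmax.
have scale B f : 0 < f -> width B <= f -> \det B <= \det A * (f / n%:R) ^+ n.
  move=> f0 Bf; have := xmax (mxvec ((n%:R / f) *: B)); rewrite mxvecK detZ => H.
  have {}H : (n%:R / f) ^+ n * \det B <= \det A.
    apply: H => -[]; rewrite /g mxvecK widthZ; last by rewrite divr_ge0 // ltW.
    by rewrite subr_le0 mulrAC ler_pdivrMr // ler_wpM2l // ltW.
  rewrite -ler_pdivrMr; last by rewrite exprn_gt0 // divr_gt0.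
  by rewrite mulrC -exprVn invf_div.
have detA : 0 < \det A.
  apply: (@lt_le_trans _ _ (\det (s *: 1%:M : 'M[R]_n))).
    by rewrite detZ det1 mulr1 exprn_gt0.
  by have := xmax _ g0; rewrite mxvecK.
exists A => //; split => //; apply/eqP; rewrite eq_le gx leNgt; apply/negP => lt.
pose f := (width A + n%:R) / 2.
have f0 : 0 < f by have := width_ge0 A; rewrite /f; lra.
have fn : f < n%:R by rewrite /f; lra.
have := scale A f f0; rewrite /f => /(_ ltac:(lra)).
rewrite -/f leNgt => /negP; apply; rewrite -[ltRHS]mulr1 ltr_pM2l //.
have h0 : 0 <= f / n%:R by rewrite divr_ge0 // ltW.
have h1 : f / n%:R < 1 by rewrite ltr_pdivrMr // mul1r.
by rewrite exprn_ilt1 // -lt0n.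
Qed.

(** The maximiser of the determinant under a bound on the weighted width
    carries the unit vectors [u i] to vectors whose directions, reweighted,
    decompose the identity exactly: this is the first-order condition.  The
    barycentre stays at the origin because the map is linear.  The longest and
    the shortest of the vectors [u i *m A] control the spectrum of [A], and
    applying this control to these vectors themselves bounds their lengths. *)
Theorem exact_position : exists (A : 'M[R]_n) (v : 'I_m -> 'rV[R]_n) (b : 'rV[R]_m),
  [/\ A \in unitmx, forall i, dot (v i) (v i) = 1, forall i, 0 < b 0 i,
      gram v b = 1%:M & moment v b = 0] /\
  [/\ forall i, u i *m A = enorm (u i *m A) *: v i,
      forall i, (1 + delta)^-1 <= enorm (u i *m A) &
      forall y, (1 - delta) * enorm (y *m A^T) <= enorm y].
Proof.
have /andP[d0 d1] := delta01.
have [A detA [wA Amax]] := det_max.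
have uA : A \in unitmx by rewrite unitmxE unitfE gt_eqF.
have uA0 i : u i *m A != 0.
  apply/eqP => /(congr1 (mulmx^~ (invmx A))); rewrite mulmxK // mul0mx => ui0.
  by have := u1 i; rewrite ui0 dot0l => /eqP; rewrite eq_sym oner_eq0.
pose rho i := enorm (u i *m A).
have rho0 i : 0 < rho i by rewrite enorm_gt0.
pose v i := (rho i)^-1 *: (u i *m A).
have uv i : u i *m A = rho i *: v i by rewrite /v scalerA divff ?scale1r // gt_eqF.
have v1 i : dot (v i) (v i) = 1.
  rewrite /v dotZl dotZr -sqr_enorm -/(rho i); have := rho0 i; move: (rho i) => r r0.
  by field; rewrite gt_eqF.
clearbody v; pose b : 'rV[R]_m := \row_i (w 0 i * rho i).
have b0 i : 0 < b 0 i by rewrite mxE mulr_gt0.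
have sumb : \sum_i b 0 i = n%:R by rewrite -wA; apply: eq_bigr => i _; rewrite mxE.
have momb : moment v b = 0.
  rewrite -(mul0mx _ A) -bal /moment mulmx_suml; apply: eq_bigr => i _.
  by rewrite -scalemxAl uv scalerA; congr (_ *: _); rewrite mxE.
pose S := gram v b.
pose s := \tr ((S - 1%:M) *m (S - 1%:M)^T).
pose H := 1%:M - S.
have trS : \tr S = n%:R by rewrite /S (tr_gram v1).
have trH : \tr H = 0 by rewrite /H raddfB /= mxtrace1 trS subrr.
have [K K0 HK] := det_traceless trH.
have tau : \sum_i b 0 i * dot (v i *m H) (v i) = - s.
  have -> : \sum_i b 0 i * dot (v i *m H) (v i) = \tr (S *m H).
    rewrite /S /gram mulmx_suml raddf_sum; apply: eq_bigr => i _ /=.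
    by rewrite -scalemxAl mxtraceZ tr_outer.
  have ST : (S - 1%:M)^T = S - 1%:M by rewrite [LHS]linearB /= trmx1 gram_tr.
  rewrite /s ST /H mulmxBl !mulmxBr !mul1mx !mulmx1 !raddfB /= mxtrace1 trS.
  by ring.
(* In the direction H the width decreases at the rate s, the squared Frobenius
   norm of S - 1, while the determinant changes to second order only; so
   s = 0. *)
pose C := \sum_i b 0 i * dot (v i *m H) (v i *m H).
have C0 : 0 <= C by apply: sumr_ge0 => i _; rewrite mulr_ge0 ?dot_ge0 // ltW.
have s_ge0 : 0 <= s by exact: frob_ge0.
have widthH t : width (A *m (1%:M + t *: H)) <= n%:R - t * s + t ^+ 2 * C.
  have -> : n%:R - t * s + t ^+ 2 * C = \sum_i b 0 i *
      (1 + t * dot (v i *m H) (v i) + t ^+ 2 * dot (v i *m H) (v i *m H)).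
    rewrite -mulrN -tau -sumb /C !mulr_sumr -!big_split /=.
    by apply: eq_bigr => i _; ring.
  apply: ler_sum => i _; rewrite mulmxA uv -scalemxAl enormZ gtr0_norm // mulrA.
  have -> : b 0 i = w 0 i * rho i by rewrite mxE.
  apply: ler_wpM2l; last exact: enorm_perturb.
  by rewrite ltW // mulr_gt0.
have s0 : s = 0.
  apply/eqP; rewrite eq_le s_ge0 andbT -oppr_ge0.
  pose t0 := Num.min 1 (1 / (s + C + 1)).
  have sC : 0 < s + C + 1 by lra.
  have t00 : 0 < t0 by rewrite lt_min ltr01 divr_gt0.
  apply: (@quad_coef_ge0 R _ (C + n%:R * K) (Num.min 1 t0)) => //.
  - by rewrite lt_min ltr01.
  - by rewrite addr_ge0 // mulr_ge0 // ltW.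
  move=> t t_gt0; rewrite !le_min => /and3P[t1 _]; rewrite ler_pdivlMr // => tsC.
  have t2 : t ^+ 2 <= t by rewrite expr2 ler_piMr // ltW.
  have [big|small] := leP (t ^+ 2 * C) (t * s); last first.
    have : 0 <= t * (t ^+ 2 * C - t * s) by rewrite mulr_ge0 ?subr_ge0 // ltW.
    have : 0 <= n%:R * K * t ^+ 3 by rewrite !mulr_ge0 ?exprn_ge0 // ltW.
    by nra.
  have n1 : 1 <= n%:R :> R by rewrite ler1n.
  have f0 : 0 < n%:R - t * s + t ^+ 2 * C.
    have : 0 <= t ^+ 2 * C by rewrite mulr_ge0 ?sqr_ge0.
    have tC : 0 <= t * C by rewrite mulr_ge0 // ltW.
    by lra.
  have := Amax _ _ f0 (widthH t); rewrite det_mulmx ler_pM2l // => Hd.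
  have := HK t t_gt0 t1 => Hk.
  have base : ((n%:R - t * s + t ^+ 2 * C) / n%:R) ^+ n <= (n%:R - t * s + t ^+ 2 * C) / n%:R.
    rewrite -[leRHS]expr1; apply: ler_wiXn2l => //.
    - by rewrite divr_ge0 // ltW.
    - by rewrite ler_pdivrMr // mul1r; lra.
  have := le_trans (le_trans Hk Hd) base; rewrite ler_pdivlMr // => Hfin.
  have : 0 <= t * (n%:R - t * s + t ^+ 2 * C - (1 - K * t ^+ 2) * n%:R).
    by rewrite mulr_ge0 ?subr_ge0 // ltW.
  by move=> h; nra.
have S1 : gram v b = 1%:M.
  by apply/eqP; rewrite -subr_eq0; apply/eqP; exact: frob_eq0.
have parseval y : dot y y = \sum_i w 0 i / rho i * dot (y *m A^T) (u i) ^+ 2.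
  rewrite -[X in dot X _]mulmx1 -S1 dot_gram; apply: eq_bigr => i _.
  have -> : dot (y *m A^T) (u i) = rho i * dot y (v i).
    by rewrite dot_mulmx trmxK uv dotZr.
  rewrite mxE; have := rho0 i; move: (rho i) (dot y (v i)) => r z r0.
  by field; rewrite gt_eqF.
have m_gt0 : (0 < m)%N.
  rewrite lt0n; apply: contraTneq n0 => m0; rewrite -sumb big1 ?ltxx // => i.
  by exfalso; have := ltn_ord i; rewrite [X in (_ < X)%N]m0.
pose i0 := Ordinal m_gt0.
have [imax _ rmax] := @arg_maxP _ R 'I_m i0 predT rho isT.
have [imin _ rmin] := @arg_minP _ R 'I_m i0 predT rho isT.
have upper y : (1 - delta) * dot (y *m A^T) (y *m A^T) <= rho imax * dot y y.
  apply: le_trans (gram_lower _) _; rewrite dot_gram parseval mulr_sumr.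
  apply: ler_sum => i _; rewrite mulrA ler_wpM2r ?sqr_ge0 //.
  rewrite mulrCA ler_peMr ?(ltW (w_gt0 i)) // ler_pdivlMr // mul1r.
  exact: rmax.
have lower y : rho imin * dot y y <= (1 + delta) * dot (y *m A^T) (y *m A^T).
  apply: le_trans (gram_upper _); rewrite dot_gram parseval mulr_sumr.
  apply: ler_sum => i _; rewrite mulrA ler_wpM2r ?sqr_ge0 //.
  rewrite mulrCA ler_piMr ?(ltW (w_gt0 i)) // ler_pdivrMr // mul1r.
  exact: rmin.
(* Apply the upper bound to the longest of the vectors. *)
have rmax1 : (1 - delta) * rho imax <= 1.
  set r := rho imax; have r0 : 0 < r by exact: rho0.
  set z := u imax *m A.
  have zz : dot z z = r ^+ 2 by rewrite /r /rho sqr_enorm.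
  have := upper z; rewrite zz -/r.
  have : (r ^+ 2) ^+ 2 <= dot (z *m A^T) (z *m A^T).
    have := cauchy_schwarz (z *m A^T) (u imax); rewrite u1 mulr1.
    by rewrite dot_mulmx trmxK -/z zz.
  move=> h1 h2.
  have : (1 - delta) * (r ^+ 2) ^+ 2 <= r * r ^+ 2.
    by apply: le_trans h2; rewrite ler_wpM2l // subr_ge0 ltW.
  have r3 : 0 < r * r ^+ 2 by rewrite mulr_gt0 ?exprn_gt0.
  have -> : (1 - delta) * (r ^+ 2) ^+ 2 = ((1 - delta) * r) * (r * r ^+ 2) by ring.
  by rewrite ger_pMl.
have rmin1 : 1 <= (1 + delta) * rho imin.
  set r := rho imin; have r0 : 0 < r by exact: rho0.
  pose y := u imin *m invmx A^T.
  have yA : y *m A^T = u imin by rewrite /y mulmxKV ?unitmx_tr.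
  have := lower y; rewrite yA u1 mulr1 -/r => h1.
  have : 1 <= dot y y * r ^+ 2.
    have := cauchy_schwarz y (u imin *m A).
    have -> : dot y (u imin *m A) = 1 by rewrite dot_mulmxr yA u1.
    by rewrite expr1n -[dot (u imin *m A) _]sqr_enorm.
  move=> h2; apply: le_trans h2 _.
  have -> : dot y y * r ^+ 2 = r * dot y y * r by ring.
  by rewrite ler_pM2r.
exists A, v, b; split; split => //.
  move=> i; rewrite -[_^-1]mul1r ler_pdivrMr; last by lra.
  by apply: le_trans rmin1 _; rewrite mulrC ler_pM2r ?rmin //; lra.
move=> y; rewrite -(@ler_pXn2r _ 2) ?nnegrE ?mulr_ge0 ?enorm_ge0 ?subr_ge0 ?(ltW d1) //.
rewrite exprMn !sqr_enorm expr2 -mulrA.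
apply: (@le_trans _ _ ((1 - delta) * (rho imax * dot y y))).
  by rewrite ler_wpM2l ?upper // subr_ge0 ltW.
by rewrite mulrA ler_piMl ?dot_ge0.
Qed.

End Position.

(** * The John position of a polytope *)

Section PolytopeJohn.
Variables (R : realType) (n N : nat) (f : 'I_N -> 'rV[R]_n) (M : R).
Hypothesis n_gt0 : (0 < n)%N.
Hypothesis f_bounded : forall x, (forall j, dot x (f j) <= 1) -> forall k, `|x 0 k| <= M.

(** The ellipsoid centred at [c] with matrix [A] lies in the polytope, in terms
    of its support function. *)
Let inside (c : 'rV[R]_n) (A : 'M[R]_n) := forall j, enorm (f j *m A^T) + dot c (f j) <= 1.

Let max_inside : exists c A, [/\ inside c A, 0 < \det A &
  forall c' A', inside c' A' -> \det A' <= \det A].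
Proof.
pose ctr (z : 'rV[R]_(n + n * n)) : 'rV[R]_n := lsubmx z.
pose shp (z : 'rV[R]_(n + n * n)) : 'M[R]_n := vec_mx (rsubmx z).
have cc : mx_cont ctr by move=> i j; under eq_fun do rewrite mxE; exact: cont_coord.
have cs : mx_cont shp by move=> i j; under eq_fun do rewrite !mxE; exact: cont_coord.
pose g j z := enorm (f j *m (shp z)^T) + dot (ctr z) (f j) - 1.
have cg j : continuous (g j).
  apply: cont_sub; last exact: cont_cst.
  apply: cont_add; last by apply: cont_dot => //; exact: mx_cont_cst.
  by apply: cont_enorm; apply: mx_cont_mul; [exact: mx_cont_cst|exact: mx_cont_tr].
have cF : continuous (fun z => \det (shp z)) by exact: cont_det.
have M0 : 0 <= M.
  by have := @f_bounded 0 (fun j => _) (Ordinal n_gt0); rewrite mxE normr0; apply => j; rewrite dot0l ler01.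
have bg z : (forall j, g j z <= 0) -> forall k, `|z 0 k| <= 2 * M.
  move=> Hz; have {}Hz : inside (ctr z) (shp z) by move=> j; rewrite -subr_le0; exact: Hz.
  have cb k : `|ctr z 0 k| <= M.
    by apply: f_bounded => j; apply: le_trans (Hz j); rewrite lerDr enorm_ge0.
  have sb i k : `|shp z i k| <= 2 * M.
    have : `|(ctr z + row i (shp z)) 0 k| <= M.
      apply: f_bounded => j; apply: le_trans (Hz j); rewrite dotDl addrC lerD2r.
      have -> : dot (row i (shp z)) (f j) = (f j *m (shp z)^T) 0 i.
        by rewrite mxE; apply: eq_bigr => l _; rewrite !mxE mulrC.
      by apply: le_trans (ler_norm _) (coord_le_enorm _ _).
    rewrite !mxE; have := cb k; rewrite /ctr mxE !ler_norml.
    by move=> /andP[? ?] /andP[? ?]; apply/andP; split; lra.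
  move=> k; rewrite -(splitK k); case: (fintype.split k) => [k'|k'] /=.
    by have := cb k'; rewrite /ctr mxE; lra.
  case/mxvec_indexP: k' => i l; have := sb i l; rewrite /shp.
  by rewrite mxE mxE.
pose s := (1 + \sum_j enorm (f j))^-1.
have S0 : 0 <= \sum_j enorm (f j) by apply: sumr_ge0 => j _; exact: enorm_ge0.
have s0 : 0 < s by rewrite invr_gt0; lra.
pose z0 : 'rV[R]_(n + n * n) := row_mx 0 (mxvec (s *: 1%:M)).
have z0c : ctr z0 = 0 by rewrite /ctr row_mxKl.
have z0s : shp z0 = s *: 1%:M by rewrite /shp row_mxKr mxvecK.
have gz0 j : g j z0 <= 0.
  rewrite /g z0c z0s dot0l addr0 [(_ *: _)^T]linearZ /= trmx1 -scalemxAr mulmx1.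
  rewrite enormZ (gtr0_norm s0) subr_le0 /s mulrC ler_pdivrMr ?mul1r; last by lra.
  rewrite (bigD1 j) //=.
  have : 0 <= \sum_(i | i != j) enorm (f i) by apply: sumr_ge0 => i _; exact: enorm_ge0.
  by lra.
have [z gz zmax] := argmax_le0 cg cF bg gz0.
exists (ctr z), (shp z); split.
- by move=> j; rewrite -subr_le0; exact: gz.
- apply: lt_le_trans (zmax _ gz0); rewrite z0s detZ det1 mulr1; exact: exprn_gt0.
move=> c' A' H; pose z' : 'rV[R]_(n + n * n) := row_mx c' (mxvec A').
have -> : A' = shp z' by rewrite /shp row_mxKr mxvecK.
apply: zmax => j; rewrite /g /ctr /shp row_mxKl row_mxKr mxvecK subr_le0.
exact: H.
Qed.

Section Multipliers.
Variable g : 'I_N -> 'rV[R]_n.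
Hypothesis g1 : forall j, dot (g j) (g j) <= 1.
Hypothesis g_opt : forall w B, (forall j, enorm (g j *m B^T) + dot w (g j) <= 1) -> \det B <= 1.

Let contact : pred 'I_N := fun j => dot (g j) (g j) == 1.

(** A direction strictly decreasing all active constraints without changing
    the trace could be followed, and then the ellipsoid inflated. *)
Let no_descent (H : 'M[R]_n) (w : 'rV[R]_n) (s : R) : \tr H = 0 -> 0 < s ->
  (forall j, contact j -> dot (g j *m H) (g j) + dot w (g j) <= - s) -> False.
Proof.
move=> trH s0 desc; pose sg := s / 2.
have sg0 : 0 < sg by rewrite divr_gt0.
have [K K0 HK] := det_traceless trH.
have [e e0 He] : exists2 e : R, 0 < e & forall j t, `|t| <= e -> 0 < t ->
    (1 + sg * t) * (enorm (g j *m (1%:M + t *: H)) + t * dot w (g j)) <= 1.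
  apply: fin_small => j; case: (boolP (contact j)) => [cj|ncj].
    pose q := dot (g j *m H) (g j *m H).
    have q0 : 0 <= q by exact: dot_ge0.
    have Q0 : 0 < q + sg * q + 1.
      have sq0 : 0 <= sg * q by rewrite mulr_ge0 // ltW.
      by lra.
    exists (Num.min 1 (sg / (q + sg * q + 1))); first by rewrite lt_min ltr01 divr_gt0.
    move=> t tle t0; move: tle; rewrite gtr0_norm // le_min ler_pdivlMr // => /andP[t1 tq].
    have := enorm_perturb H t (eqP cj); rewrite -/q => He.
    have dj := desc j cj.
    have h1 : enorm (g j *m (1%:M + t *: H)) + t * dot w (g j) <= 1 - t * s + t ^+ 2 * q.
      have : t * (dot (g j *m H) (g j) + dot w (g j)) <= t * - s by rewrite ler_pM2l.
      by lra.
    have h2 : 0 < 1 + sg * t by rewrite addr_gt0 ?mulr_gt0.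
    apply: le_trans (_ : (1 + sg * t) * (1 - t * s + t ^+ 2 * q) <= 1).
      by rewrite ler_pM2l.
    have -> : s = 2 * sg by rewrite /sg; field.
    have h3 : 0 <= sg * q * t * (1 - t) by rewrite !mulr_ge0 ?subr_ge0 // ltW.
    have h4 : 0 <= t * (sg - t * (q + sg * q + 1)) by rewrite mulr_ge0 ?subr_ge0 // ltW.
    have h5 : 0 <= sg * sg * t ^+ 2 by rewrite !mulr_ge0 ?sqr_ge0 // ltW.
    have h6 : 0 <= t * (sg * q * t * (1 - t)) by rewrite mulr_ge0 // ltW.
    have h7 : 0 <= t ^+ 2 by exact: sqr_ge0.
    by nra.
  pose a := enorm (g j).
  have a0 : 0 <= a by exact: enorm_ge0.
  have a1 : a < 1.
    have : dot (g j) (g j) < 1 by rewrite lt_neqAle ncj g1.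
    by rewrite -sqr_enorm -/a; nra.
  pose C := enorm (g j *m H) + `|dot w (g j)|.
  have C0 : 0 <= C by rewrite addr_ge0 ?enorm_ge0.
  pose D := C + sg * a + sg * C + 1.
  have D0 : 0 < D.
    have : 0 <= sg * a by rewrite mulr_ge0 // ltW.
    have : 0 <= sg * C by rewrite mulr_ge0 // ltW.
    by rewrite /D; lra.
  exists (Num.min 1 ((1 - a) / D)); first by rewrite lt_min ltr01 divr_gt0 // subr_gt0.
  move=> t tle t0; move: tle; rewrite gtr0_norm // le_min ler_pdivlMr // => /andP[t1 tD].
  have h1 : enorm (g j *m (1%:M + t *: H)) + t * dot w (g j) <= a + t * C.
    rewrite mulmxDr mulmx1 -scalemxAr; apply: le_trans (lerD (ler_enormD _ _) (lexx _)) _.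
    rewrite enormZ gtr0_norm // -addrA lerD2l /C mulrDr lerD2l ler_pM2l //.
    exact: ler_norm.
  have h2 : 0 < 1 + sg * t by rewrite addr_gt0 ?mulr_gt0.
  apply: le_trans (_ : (1 + sg * t) * (a + t * C) <= 1); first by rewrite ler_pM2l.
  have h3 : 0 <= sg * C * t * (1 - t) by rewrite !mulr_ge0 ?subr_ge0 // ltW.
  by move: tD; rewrite /D; nra.
pose mn := Num.min sg 1.
have mn0 : 0 < mn by rewrite lt_min sg0 ltr01.
pose t := Num.min (Num.min e 1) (mn / (2 * (K * (1 + sg) + 1))).
have Ksg0 : 0 <= K * (1 + sg) by rewrite mulr_ge0 // addr_ge0 // ltW.
have K1 : 0 < 2 * (K * (1 + sg) + 1) by lra.
have t0 : 0 < t by rewrite !lt_min e0 ltr01 divr_gt0.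
have te : t <= e by rewrite !ge_min lexx.
have t1 : t <= 1 by rewrite !ge_min lexx orbT.
have tK : t * (2 * (K * (1 + sg) + 1)) <= mn.
  by rewrite -ler_pdivlMr // ge_min lexx orbT.
have mns : mn <= sg by rewrite ge_min lexx.
have mn1 : mn <= 1 by rewrite ge_min lexx orbT.
have z0 : 0 < 1 + sg * t by rewrite addr_gt0 ?mulr_gt0.
have feas : \det ((1 + sg * t) *: (1%:M + t *: H)^T) <= 1.
  apply: (@g_opt ((1 + sg * t) * t *: w)) => j.
  rewrite [(_ *: _)^T]linearZ /= trmxK -scalemxAr enormZ gtr0_norm // dotZl -mulrA -mulrDr.
  by apply: He => //; rewrite gtr0_norm.
have := HK t t0 t1; move: feas; rewrite detZ det_tr => feas Hd.
have n1 : 1 + sg * t <= (1 + sg * t) ^+ n.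
  rewrite -[leLHS]expr1; apply: ler_weXn2l => //.
  by have : 0 < sg * t by [exact: mulr_gt0]; lra.
have sgt : t * (2 * (K * (1 + sg) + 1)) = 2 * (t * K) + 2 * (t * (K * sg)) + 2 * t by ring.
have h1 : t * (K * t) <= t * K by rewrite ler_pM2l // ler_piMr.
have h2 : 0 <= t * (K * sg) by rewrite !mulr_ge0 // ltW.
have h3 : t * (K * sg * t) <= t * (K * sg).
  by rewrite ler_pM2l // ler_piMr // mulr_ge0 // ltW.
have Kt : 0 < 1 - K * t ^+ 2 by lra.
have prod : (1 + sg * t) * (1 - K * t ^+ 2) <= 1.
  apply: le_trans feas; apply: le_trans (_ : (1 + sg * t) ^+ n * (1 - K * t ^+ 2) <= _).
    by rewrite ler_pM2r.
  by rewrite ler_pM2l // exprn_gt0.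
have : 0 < t * (sg - t * K - t * (K * sg * t)) by rewrite mulr_gt0 //; lra.
by have : t * (K * t) = K * t ^+ 2 by [ring]; nra.
Qed.

(** The multipliers are the weights of the point of the convex hull of the
    active pairs [(g^T g - 1/n, g)] that is nearest to the origin. *)
Lemma exists_multipliers : exists lam : 'rV[R]_N,
  [/\ forall j, 0 <= lam 0 j, forall j, 0 < lam 0 j -> dot (g j) (g j) = 1,
      gram g lam = 1%:M & moment g lam = 0].
Proof.
have n0 : 0 < n%:R :> R by rewrite ltr0n.
have [j0 cj0] : exists j, contact j.
  apply/existsP; rewrite -[[exists _, _]]negbK negb_exists; apply/negP => /forallP nc.
  apply: (@no_descent 0 0 1) => //; first by rewrite mxtrace0.
  by move=> j cj; have := nc j; rewrite cj.
pose total (lam : 'rV[R]_N) := \sum_(j | contact j) lam 0 j.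
pose Z lam := gram g lam - n%:R^-1%:M.
pose G lam := \tr (Z lam *m (Z lam)^T) + dot (moment g lam) (moment g lam).
pose c (o : option ('I_N * bool)) (lam : 'rV[R]_N) : R := match o with
  | None => (total lam - 1) * (total lam - 1)
  | Some (j, true) => - lam 0 j
  | Some (j, false) => lam 0 j - (contact j)%:R end.
have feasE lam : (forall o, c o lam <= 0) <->
    (forall j, 0 <= lam 0 j <= (contact j)%:R) /\ total lam = 1.
  split=> [H|[H1 H2] [[j []]|]] /=.
  - split=> [j|].
      have := H (Some (j, true)); have := H (Some (j, false)) => /=.
      by rewrite oppr_le0 subr_le0 => -> ->.
    have := H None; rewrite /= -expr2 => H0.
    by apply/eqP; rewrite -subr_eq0 -sqrf_eq0 eq_le H0 sqr_ge0.
  - by have /andP[? _] := H1 j; rewrite oppr_le0.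
  - by have /andP[_ ?] := H1 j; rewrite subr_le0.
  - by rewrite H2 subrr mul0r.
have cc o : continuous (c o).
  case: o => [[j []]|] /=.
  - by apply: cont_opp; exact: cont_coord.
  - by apply: cont_sub; [exact: cont_coord|exact: cont_cst].
  by apply: cont_mul; (apply: cont_sub; [apply: cont_sum => i _; exact: cont_coord|exact: cont_cst]).
have cZ : mx_cont Z.
  move=> i j; under eq_fun do rewrite !mxE summxE.
  apply: cont_sub; last exact: cont_cst.
  apply: cont_sum => k _; under eq_fun do rewrite mxE.
  by apply: cont_mul; [exact: cont_coord|exact: cont_cst].
have cmom : mx_cont (fun lam => moment g lam).
  move=> i j; under eq_fun do rewrite summxE.
  apply: cont_sum => k _; under eq_fun do rewrite mxE.
  by apply: cont_mul; [exact: cont_coord|exact: cont_cst].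
have cG : continuous G.
  apply: cont_add; last exact: cont_dot.
  by apply: cont_mxtrace; apply: mx_cont_mul => //; exact: mx_cont_tr.
have bc lam : (forall o, c o lam <= 0) -> forall j, `|lam 0 j| <= 1.
  move=> /feasE[H _] j; have /andP[l0 l1] := H j; rewrite ger0_norm //.
  by apply: le_trans l1 _; case: (contact j); rewrite ?ler01.
have total_delta j : contact j -> total (delta_mx 0 j) = 1.
  move=> cj; rewrite /total (bigD1 j) //= mxE !eqxx big1 ?addr0 // => i /andP[_ /negPf ij].
  by rewrite mxE ij andbF.
have feas_delta j : contact j -> forall o, c o (delta_mx 0 j) <= 0.
  move=> cj; apply/feasE; split; last exact: total_delta.
  move=> i; rewrite mxE eqxx /=; have [->|_] := eqVneq i j; first by rewrite cj ler01 lexx.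
  by rewrite lexx ler0n.
have [lam /feasE[lam01 lam1] lmin] := argmin_le0 cc cG bc (feas_delta j0 cj0).
have off j : ~~ contact j -> lam 0 j = 0.
  by move=> /negPf nc; apply/eqP; rewrite eq_le; have := lam01 j; rewrite nc andbC.
have trZ : \tr (Z lam) = 0.
  have tn : \tr (n%:R^-1%:M : 'M[R]_n) = 1.
    by rewrite mxtrace_scalar -[LHS]mulr_natl divff // gt_eqF.
  rewrite /Z raddfB /= tn /gram raddf_sum /=.
  apply/eqP; rewrite subr_eq0 -[in X in _ == X]lam1 /total [X in _ == X]big_mkcond /=.
  apply/eqP; apply: eq_bigr => j _; rewrite mxtraceZ tr_outer1.
  case: ifP => [/eqP->|/negbT/off->]; first by rewrite mulr1.
  by rewrite mul0r.
set s := G lam.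
have s0 : 0 <= s by rewrite addr_ge0 ?frob_ge0 ?dot_ge0.
have ZT : (Z lam)^T = Z lam by rewrite /Z linearB /= gram_tr tr_scalar_mx.
(* First variation of G in the direction of the vertex j of the simplex. *)
have var j : contact j -> s <= dot (g j *m Z lam) (g j) + dot (moment g lam) (g j).
  move=> cj; pose mu : 'rV[R]_N := delta_mx 0 j - lam.
  have gmu : gram g mu = (g j)^T *m g j - gram g lam.
    rewrite /mu -[- lam]scaleN1r gramD gramZ scaleN1r; congr (_ - _).
    rewrite /gram (bigD1 j) //= mxE !eqxx scale1r big1 ?addr0 // => i /negPf ij.
    by rewrite mxE ij andbF scale0r.
  have mmu : moment g mu = g j - moment g lam.
    rewrite /mu -[- lam]scaleN1r momentD momentZ scaleN1r; congr (_ - _).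
    rewrite /moment (bigD1 j) //= mxE !eqxx scale1r big1 ?addr0 // => i /negPf ij.
    by rewrite mxE ij andbF scale0r.
  pose Q := \tr (gram g mu *m (gram g mu)^T) + dot (moment g mu) (moment g mu).
  have Q0 : 0 <= Q by rewrite addr_ge0 ?frob_ge0 ?dot_ge0.
  pose L := \tr (Z lam *m gram g mu) + dot (moment g lam) (moment g mu).
  have Lval : L = dot (g j *m Z lam) (g j) + dot (moment g lam) (g j) - s.
    rewrite /L gmu mmu dotBr mulmxBr raddfB /= mxtrace_mulC tr_outer.
    have -> : gram g lam = Z lam + n%:R^-1%:M by rewrite /Z subrK.
    have trs : \tr (Z lam *m n%:R^-1%:M) = 0.
      by rewrite mul_mx_scalar [LHS]mxtraceZ trZ mulr0.
    rewrite [Z lam *m (_ + _%:M)]mulmxDr mxtraceD trs addr0 /s /G ZT.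
    by ring.
  have expand t : G (lam + t *: mu) = s + t * (2 * L) + t ^+ 2 * Q.
    have -> : G (lam + t *: mu) = \tr ((Z lam + t *: gram g mu) *m (Z lam + t *: gram g mu)^T)
      + dot (moment g lam + t *: moment g mu) (moment g lam + t *: moment g mu).
      by rewrite /G /Z gramD gramZ momentD momentZ addrAC.
    by rewrite frob_line dot_line gram_tr /s /G /L /Q gram_tr; ring.
  rewrite -subr_ge0 -Lval.
  have feas t : 0 <= t <= 1 -> forall o, c o (lam + t *: mu) <= 0.
    move=> /andP[t0 t1]; apply/feasE; split.
      move=> i; rewrite !mxE eqxx /=; have /andP[l0 l1] := lam01 i.
      have h1 : 0 <= t * lam 0 i by rewrite mulr_ge0.
      have h2 : 0 <= (1 - t) * lam 0 i by rewrite mulr_ge0 // subr_ge0.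
      have [ij|_] := eqVneq i j; last first.
        by rewrite mulr0n; apply/andP; split; lra.
      have ci : contact i by rewrite ij.
      have h3 : 0 <= (1 - t) * (1 - lam 0 i).
        by rewrite mulr_ge0 // subr_ge0 //; move: l1; rewrite ci.
      by rewrite ci !mulr1n; apply/andP; split; lra.
    rewrite /total (eq_bigr (fun i => lam 0 i + t * ((delta_mx 0 j : 'rV[R]_N) 0 i - lam 0 i))); last first.
      by move=> i _; rewrite !mxE.
    rewrite big_split /= -mulr_sumr sumrB -/(total (delta_mx 0 j)) -/(total lam).
    by rewrite total_delta // lam1 subrr mulr0 addr0.
  have step t : 0 < t -> t <= 1 -> 0 <= 2 * L * t ^+ 2 + Q * t ^+ 3.
    move=> t0 t1; have : G lam <= G (lam + t *: mu) by apply: lmin; apply: feas; rewrite (ltW t0).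
    rewrite expand -/s => H.
    have -> : 2 * L * t ^+ 2 + Q * t ^+ 3 = t * (t * (2 * L) + t ^+ 2 * Q) by ring.
    by rewrite mulr_ge0 ?(ltW t0) //; lra.
  by have := quad_coef_ge0 ltr01 Q0 step; lra.
have {s0} s0 : s = 0.
  apply/eqP; rewrite eq_le s0 andbT leNgt; apply/negP => s_gt0.
  apply: (@no_descent (- Z lam) (- moment g lam) s) => //.
    by rewrite raddfN /= trZ oppr0.
  by move=> j cj; rewrite mulmxN !dotNl -opprD lerN2 var.
have Z0 : Z lam = 0.
  apply: frob_eq0; apply/eqP; rewrite eq_le frob_ge0 andbT -s0 /s /G.
  by rewrite lerDl dot_ge0.
have m0 : moment g lam = 0.
  by apply/eqP; rewrite -dot_eq0 eq_le dot_ge0 andbT -s0 /s /G lerDr frob_ge0.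
exists (n%:R *: lam); split.
- by move=> j; rewrite mxE mulr_ge0 //; have /andP[] := lam01 j.
- move=> j; rewrite mxE => lj; apply/eqP; apply: contraTT lj => /off->.
  by rewrite mulr0 ltxx.
- rewrite gramZ -[gram g lam](subrK (n%:R^-1%:M)) -/(Z lam) Z0 add0r.
  by rewrite scale_scalar_mx divff // gt_eqF.
- by rewrite momentZ m0 scaler0.
Qed.

End Multipliers.

(** Carrying the ellipsoid of maximal volume to the unit ball turns the
    constraints into [g], and its maximality into the hypothesis of
    [exists_multipliers]. *)
Theorem polytope_john : exists (c : 'rV[R]_n) (A : 'M[R]_n) (g : 'I_N -> 'rV[R]_n) (lam : 'rV[R]_N),
  [/\ A \in unitmx,
      forall y, (forall j, dot (c + y *m A) (f j) <= 1) <-> (forall j, dot y (g j) <= 1) &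
      forall j, dot (g j) (g j) <= 1] /\
  [/\ forall j, 0 <= lam 0 j, forall j, 0 < lam 0 j -> dot (g j) (g j) = 1,
      gram g lam = 1%:M & moment g lam = 0].
Proof.
have [c [A [cA detA Amax]]] := max_inside.
have uA : A \in unitmx by rewrite unitmxE unitfE gt_eqF.
pose t j := 1 - dot c (f j).
have t0 j : 0 < t j.
  have := cA j; rewrite /t; have [->|fj] := eqVneq (f j) 0; first by rewrite dot0r; lra.
  suff : 0 < enorm (f j *m A^T) by lra.
  rewrite enorm_gt0; apply: contra fj => /eqP e.
  by rewrite -[f j](@mulmxK _ _ _ A^T) ?unitmx_tr // e mul0mx.
pose g j := (t j)^-1 *: (f j *m A^T).
have fg j : f j *m A^T = t j *: g j by rewrite /g scalerA divff ?scale1r // gt_eqF.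
have g1 j : dot (g j) (g j) <= 1.
  rewrite -(expr1n _ 2) -enorm_leP // -(ler_pM2l (t0 j)) mulr1.
  by have := cA j; rewrite fg enormZ gtr0_norm // /t; lra.
clearbody g; have [lam Hlam] : exists lam : 'rV[R]_N,
    [/\ forall j, 0 <= lam 0 j, forall j, 0 < lam 0 j -> dot (g j) (g j) = 1,
      gram g lam = 1%:M & moment g lam = 0].
  apply: exists_multipliers => // w B H.
  have := Amax (c + w *m A) (B *m A); rewrite det_mulmx ger_pMl //; apply=> j.
  rewrite trmx_mul mulmxA fg -scalemxAl enormZ gtr0_norm // dotDl dot_mulmx fg dotZr.
  have : t j * (enorm (g j *m B^T) + dot w (g j)) <= t j by rewrite ger_pMr.
  by rewrite /t; lra.
exists c, A, g, lam; split=> //; split=> // y.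
have E j : (dot (c + y *m A) (f j) <= 1) = (dot y (g j) <= 1).
  by rewrite dotDl dot_mulmx fg dotZr -[in RHS](ler_pM2l (t0 j)) mulr1 /t; apply/idP/idP; lra.
by split=> H j; have := H j; rewrite E.
Qed.

End PolytopeJohn.

(** * Approximating a convex body by a polytope *)

Section Approximation.
Variable (R : realType).

Lemma convex_segment n (K : set 'rV[R]_n) x y t : convex_set K -> K x -> K y ->
  0 <= t <= 1 -> K (t *: x + (1 - t) *: y).
Proof.
move=> cK Kx Ky /andP[t0 t1].
have := cK x y (Itv01 t0 t1); rewrite !inE => /(_ Kx Ky).
exact.
Qed.

Lemma convex_setI n (K : set 'rV[R]_n) :
  (forall x y t, K x -> K y -> 0 <= t <= 1 -> K (t *: x + (1 - t) *: y)) ->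
  convex_set K.
Proof.
move=> H x y t; rewrite !inE => Kx Ky; apply: (H x y t%:num) => //.
by apply/andP; split.
Qed.

Lemma enorm_lt_norm n (x : 'rV[R]_n) e : 0 < e -> enorm x < e -> `|x| < e.
Proof.
move=> e0 xe; rewrite [`|x|]mx_normrE; apply: bigmax_lt => // -[i j] _ /=.
by rewrite (ord1 i); apply: le_lt_trans (coord_le_enorm x j) xe.
Qed.

Lemma interior_ball n (K : set 'rV[R]_n) : K° !=set0 ->
  exists y0 r, 0 < r /\ forall v, enorm v < r -> K (y0 + v).
Proof.
move=> [y0 /nbhs_ballP[r /= r0 H]]; exists y0, r; split => // v vr; apply: H.
by rewrite -ball_normE /= opprD addrA subrr sub0r normrN; exact: enorm_lt_norm.
Qed.

Lemma strict_interior n (I : finType) (h : I -> 'rV[R]_n) (s : I -> R) x :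
  (forall i, dot x (h i) < s i) -> [set y | forall i, dot y (h i) <= s i]° x.
Proof.
move=> xs.
have [e e0 He] : exists2 e : R, 0 < e & forall i t, `|t| <= e ->
    dot x (h i) + t * \sum_k `|h i 0 k| <= s i.
  apply: fin_small => i; pose D := 1 + \sum_k `|h i 0 k|.
  have S0 : 0 <= \sum_k `|h i 0 k| by apply: sumr_ge0.
  have D0 : 0 < D by rewrite /D; lra.
  exists ((s i - dot x (h i)) / D); first by rewrite divr_gt0 // subr_gt0.
  move=> t; rewrite ler_pdivlMr // => tD.
  have : t * \sum_k `|h i 0 k| <= `|t| * \sum_k `|h i 0 k| by rewrite ler_wpM2r // ler_norm.
  by have := normr_ge0 t; move: tD; rewrite /D; lra.
apply/nbhs_ballP; exists e => //= y; rewrite -ball_normE /= => yx i.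
apply: le_trans (He i e _); last by rewrite gtr0_norm.
have -> : y = x + (y - x) by rewrite addrC subrK.
rewrite dotDl lerD2l /dot mulr_sumr; apply: ler_sum => k _.
apply: le_trans (ler_norm _) _; rewrite normrM ler_wpM2r //.
have : `|(y - x) 0 k| <= `|y - x|.
  by rewrite [`|y - x|]mx_normrE; apply/bigmax_geP; right => /=; exists (0, k).
by move=> /le_trans; apply; rewrite distrC ltW.
Qed.

Lemma polytope_convex_body n (I : finType) (h : I -> 'rV[R]_n) (s : I -> R) M :
  (forall i, 0 < s i) ->
  (forall x, (forall i, dot x (h i) <= s i) -> forall k, `|x 0 k| <= M) ->
  convex_body [set x | forall i, dot x (h i) <= s i].
Proof.
move=> s0 bM; split.
- have -> : [set x | forall i, dot x (h i) <= s i] = [set x | forall i, dot x (h i) - s i <= 0].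
    by apply/seteqP; split=> x /= H i; [rewrite subr_le0|rewrite -subr_le0].
  apply: (@compact_le0 R n I (fun i x => dot x (h i) - s i) M).
    move=> i; apply: cont_sub; last exact: cont_cst.
    by apply: cont_dot; [exact: mx_cont_id|exact: mx_cont_cst].
  by move=> x H; apply: bM => i; rewrite -subr_le0.
- apply: convex_setI => x y t Hx Hy /andP[t0 t1] i; rewrite dotDl !dotZl.
  have h1 : t * dot x (h i) <= t * s i by rewrite ler_wpM2l // Hx.
  have h2 : (1 - t) * dot y (h i) <= (1 - t) * s i by rewrite ler_wpM2l ?subr_ge0 // Hy.
  by lra.
- by exists 0; apply: strict_interior => i; rewrite dot0l.
Qed.

(** A point at positive distance from a convex body is cut off by a half-space
    bounding the body, normalised at an interior point of the body. *)
Lemma separation n (K : set 'rV[R]_n) y0 r x rho : compact K -> convex_set K ->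
  0 < r -> (forall v, enorm v < r -> K (y0 + v)) -> 0 < rho ->
  (forall b, K b -> rho <= enorm (y0 + x - b)) ->
  exists f, (forall b, K b -> dot (b - y0) f <= 1) /\ 1 < dot x f.
Proof.
move=> cK vK r0 Kr rho0 far.
have K0 : K !=set0 by exists (y0 + 0); apply: Kr; rewrite enorm0.
have cd : continuous (fun b : 'rV[R]_n => enorm (y0 + x - b)).
  apply: cont_enorm; apply: mx_cont_add; first exact: mx_cont_cst.
  by apply: mx_cont_opp; exact: mx_cont_id.
have [p] := EVT_min_rV K0 cK (continuous_subspaceT cd); rewrite inE => Kp pmin.
set h := y0 + x - p.
have hh : 0 < dot h h.
  by rewrite -sqr_enorm exprn_gt0 //; apply: lt_le_trans rho0 (far p Kp).
have obtuse b : K b -> dot h (b - p) <= 0.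
  move=> Kb; suff : 0 <= - (2 * dot h (b - p)) by lra.
  apply: (@quad_coef_ge0 R _ (dot (b - p) (b - p)) 1) => //; first exact: dot_ge0.
  move=> t t0 t1.
  have Kt : K (t *: b + (1 - t) *: p) by apply: convex_segment => //; rewrite (ltW t0).
  have := pmin (t *: b + (1 - t) *: p); rewrite inE => /(_ Kt).
  have -> : y0 + x - (t *: b + (1 - t) *: p) = h + (- t) *: (b - p).
    by rewrite /h; apply/rowP => k; rewrite !mxE; ring.
  rewrite -/h -(ler_pXn2r (n := 2)) ?nnegrE ?enorm_ge0 // !sqr_enorm dot_line => H.
  have : 0 <= t * (- t * (2 * dot h (b - p)) + (- t) ^+ 2 * dot (b - p) (b - p)).
    by rewrite mulr_ge0 ?(ltW t0) //; lra.
  by lra.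
pose a := dot (p - y0) h.
have bh b : K b -> dot (b - y0) h <= a.
  move=> Kb; have := obtuse b Kb; rewrite /a dotC.
  have -> : b - y0 = (p - y0) + (b - p) by apply/rowP => k; rewrite !mxE; ring.
  by move=> obt; rewrite dotDl gerDl.
have nh : 0 < enorm h by rewrite enorm_gt0 -dot_gt0.
have a0 : 0 < a.
  pose v := (r / 2 / enorm h) *: h.
  have q0 : 0 < r / 2 / enorm h by rewrite !divr_gt0.
  have Kv : K (y0 + v).
    by apply: Kr; rewrite /v enormZ gtr0_norm // divfK ?gt_eqF //; lra.
  apply: lt_le_trans (bh _ Kv); rewrite addrAC subrr add0r /v dotZl.
  exact: mulr_gt0.
exists (a^-1 *: h); split.
  by move=> b Kb; rewrite dotZr mulrC ler_pdivrMr // mul1r bh.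
rewrite dotZr mulrC ltr_pdivlMr // mul1r.
have -> : x = h + (p - y0) by rewrite /h; apply/rowP => k; rewrite !mxE; ring.
by rewrite dotDl -/a ltrDr.
Qed.

(** Points of a box at distance at least [rho] from the body form a compact set,
    which finitely many of the separating half-spaces suffice to remove.  The
    remaining points are within [rho] of the body, and contracting them
    towards a ball contained in the body brings them into it. *)
Lemma polytope_approx n (K : set 'rV[R]_n) eta : convex_body K -> 0 < eta ->
  exists (y0 : 'rV[R]_n) (N : nat) (f : 'I_N -> 'rV[R]_n) (M : R),
  [/\ forall b, K b -> forall j, dot (b - y0) (f j) <= 1,
      forall x, (forall j, dot x (f j) <= 1) -> K (y0 + (1 + eta)^-1 *: x) &
      forall x, (forall j, dot x (f j) <= 1) -> forall k, `|x 0 k| <= M].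
Proof.
move=> [cK vK iK] eta0; have [y0 [r [r0 Kr]]] := interior_ball iK.
have [M1 [_ HM]] := compact_bounded cK.
pose M := 1 + (Num.max M1 0 + 1) + `|y0|.
have M0 : 0 < M.
  by have : 0 <= Num.max M1 0 by [rewrite le_max lexx orbT]; have := normr_ge0 y0; rewrite /M; lra.
have Kbox b k : K b -> `|(b - y0) 0 k| <= M.
  move=> Kb; have : `|b| <= Num.max M1 0 + 1.
    by apply: (HM (Num.max M1 0 + 1)) => //; rewrite (@le_lt_trans _ _ (Num.max M1 0)) ?ltrDl // le_max lexx.
  have : `|(b - y0) 0 k| <= `|b - y0|.
    by rewrite [`|b - y0|]mx_normrE; apply/bigmax_geP; right => /=; exists (0, k).
  by have := ler_normB b y0; rewrite /M; lra.
pose rho := eta * r / 2.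
have rho0 : 0 < rho by rewrite divr_gt0 ?mulr_gt0.
pose g (o : ('I_n * bool) + {b | K b}) (x : 'rV[R]_n) : R := match o with
  | inl (k, true) => x 0 k - M
  | inl (k, false) => - x 0 k - M
  | inr b => rho - enorm (y0 + x - sval b) end.
have cg o : continuous (g o).
  case: o => [[k []]|[b Kb]] /=.
  - by apply: cont_sub; [exact: cont_coord|exact: cont_cst].
  - by apply: cont_sub; [apply: cont_opp; exact: cont_coord|exact: cont_cst].
  apply: cont_sub; first exact: cont_cst.
  apply: cont_enorm; apply: mx_cont_add; last exact: mx_cont_cst.
  by apply: mx_cont_add; [exact: mx_cont_cst|exact: mx_cont_id].
have bg x : (forall o, g o x <= 0) -> forall k, `|x 0 k| <= M.
  move=> H k; have := H (inl (k, true)); have := H (inl (k, false)) => /=.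
  by rewrite ler_norml => h1 h2; apply/andP; split; lra.
have := compact_le0 cg bg; rewrite compact_cover => cover.
pose D : set 'rV[R]_n := [set f | forall b, K b -> dot (b - y0) f <= 1].
have [||s sD scov] := cover _ D (fun f => [set x | 1 < dot x f]).
- move=> f _; have -> : [set x | 1 < dot x f] = (fun x => dot x f) @^-1` [set t | 1 < t] by [].
  apply: open_comp; last exact: open_gt.
  by move=> x _; apply: cont_dot; [exact: mx_cont_id|exact: mx_cont_cst].
- move=> x /= Hx; have [|f [fD fx]] := separation cK vK r0 Kr rho0 (x := x).
    by move=> b Kb; have := Hx (inr (exist _ b Kb)); rewrite /= subr_le0.
  by exists f.
pose e k : 'rV[R]_n := M^-1 *: delta_mx 0 k.
pose L := finmap.enum_fset s ++ [seq e k | k <- enum 'I_n] ++ [seq - e k | k <- enum 'I_n].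
have LD f : f \in L -> D f.
  rewrite !mem_cat => /or3P[fs|/mapP[k _ ->]|/mapP[k _ ->]].
  - by have := sD f fs; rewrite inE.
  - move=> b Kb; rewrite /e dotZr dot_delta mulrC ler_pdivrMr // mul1r.
    exact: le_trans (ler_norm _) (Kbox b k Kb).
  - move=> b Kb; rewrite /e dotNr dotZr dot_delta mulrC -mulNr ler_pdivrMr // mul1r.
    by apply: le_trans (Kbox b k Kb); rewrite -normrN ler_norm.
pose f (j : 'I_(size L)) := nth 0 L j.
have fL x : (forall j, dot x (f j) <= 1) -> forall v, v \in L -> dot x v <= 1.
  move=> H v vL; have iv : (index v L < size L)%N by rewrite index_mem.
  by have := H (Ordinal iv); rewrite /f /= nth_index.
have boxed x : (forall j, dot x (f j) <= 1) -> forall k, `|x 0 k| <= M.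
  move=> H k; rewrite ler_norml; apply/andP; split.
    have : - e k \in L.
      by rewrite !mem_cat; apply/or3P; apply: Or33; apply/mapP; exists k; rewrite ?mem_enum.
    move=> /(fL x H); rewrite /e dotNr dotZr dot_delta mulrC -mulNr ler_pdivrMr // mul1r.
    by lra.
  have : e k \in L.
    by rewrite !mem_cat; apply/or3P; apply: Or32; apply/mapP; exists k; rewrite ?mem_enum.
  by move=> /(fL x H); rewrite /e dotZr dot_delta mulrC ler_pdivrMr // mul1r.
exists y0, (size L), f, M; split => //.
  by move=> b Kb j; apply: LD => //; rewrite /f mem_nth.
move=> x Hx.
have [b Kb near] : exists2 b, K b & enorm (y0 + x - b) < rho.
  apply: contrapT => nob.
  have Zx : forall o, g o x <= 0.
    move=> [[k []]|[b Kb]] /=.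
    - by have := boxed x Hx k; rewrite ler_norml => /andP[_ ?]; rewrite subr_le0.
    - by have := boxed x Hx k; rewrite ler_norml => /andP[? _]; lra.
    - by rewrite subr_le0 leNgt; apply/negP => lt; apply: nob; exists b.
  have [v /= vs] := scov x Zx; rewrite ltNge => /negP; apply.
  by apply: (fL x Hx); rewrite mem_cat vs.
(* The contracted point is a convex combination of the near point b and of
   this point of the interior ball. *)
have Kv : K (y0 + eta^-1 *: (y0 + x - b)).
  apply: Kr; rewrite enormZ gtr0_norm ?invr_gt0 // mulrC ltr_pdivrMr //.
  by apply: lt_trans near _; rewrite /rho; have := mulr_gt0 eta0 r0; lra.
have t01 : 0 <= (1 + eta)^-1 <= 1.
  by rewrite invr_ge0 invf_le1 ?addr_ge0 ?addr_gt0 ?(ltW eta0) // lerDl ltW.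
have := convex_segment vK Kb Kv t01.
congr K; apply/rowP => k; rewrite !mxE.
by field; rewrite !gt_eqF ?addr_gt0.
Qed.

(** Two homothetic copies of a body in the ratio [t / s] with different centres
    are still concentric about a third point, so that a sandwich between
    them bounds the Banach-Mazur distance. *)
Lemma banach_mazur_sandwich n (K B : set 'rV[R]_n) (A : 'M[R]_n) p1 p2 s t :
  A \in unitmx -> 0 < s -> s < t ->
  (forall k, K k -> B (p1 + s *: (k *m A))) ->
  (forall b, B b -> exists2 k, K k & b = p2 + t *: (k *m A)) ->
  (banach_mazur K B <= (t / s)%:E)%E.
Proof.
move=> uA s0 st KB BK; have t0 : 0 < t by apply: lt_trans st.
pose x := (t - s)^-1 *: ((p1 - p2) *m invmx A).
have ts : t - s != 0 by rewrite subr_eq0 gt_eqF.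
have xA : x *m A = (t - s)^-1 *: (p1 - p2) by rewrite /x -scalemxAl mulmxKV.
pose y := p1 + s *: (x *m A).
have yE : y = p2 + t *: (x *m A).
  rewrite /y xA; apply/rowP => i; rewrite !mxE; field.
  by rewrite ?subr_eq0 ?gt_eqF.
apply: ereal_inf_lbound; exists (t / s) => //; split.
  by rewrite ler_pdivlMr // mul1r ltW.
exists (s^-1 *: invmx A), x, y; split.
- by rewrite unitmxZ ?unitfE ?invr_eq0 ?gt_eqF // unitmx_inv.
- move=> _ [k Kk <-]; exists (p1 + s *: (k *m A)); first exact: KB.
  have -> : p1 + s *: (k *m A) - y = s *: ((k - x) *m A).
    by rewrite /y mulmxBl scalerBr opprD addrACA subrr add0r.
  by rewrite -scalemxAl -scalemxAr scalerA mulmxK // mulfV ?scale1r // gt_eqF.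
- move=> _ [b Bb <-]; have [k Kk ->] := BK b Bb; exists k => //.
  have -> : p2 + t *: (k *m A) - y = t *: ((k - x) *m A).
    by rewrite yE mulmxBl scalerBr opprD addrACA subrr add0r.
  by rewrite -scalemxAl -scalemxAr scalerA mulmxK.
Qed.

End Approximation.

(** * Few contact points *)

Section FewContacts.
Variable (R : realType).

Lemma power_of_two_between (x : R) : 2^-1 <= x -> exists k, x <= (2 ^ k)%:R <= 3 * x.
Proof.
move=> x2; have x0 : 0 <= x by lra.
have ex : exists k, x <= (2 ^ k)%:R.
  exists (Num.Def.archi_bound x); apply: ltW; apply: lt_le_trans (archi_boundP x0) _.
  by rewrite ler_nat ltnW // ltn_expl.
have [k xk kmin] := ex_minnP ex; exists k; rewrite xk /=.
case: k xk kmin => [_ _|k xk kmin]; first by rewrite expn0; lra.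
rewrite expnS natrM; have : (2 ^ k)%:R < x; last by lra.
by rewrite ltNge; apply/negP => /kmin; rewrite ltnn.
Qed.

Lemma ln_ge_half n : (1 < n)%N -> 2^-1 <= ln n%:R :> R.
Proof.
move=> n1; have n0 : 0 < n%:R :> R by rewrite ltr0n ltnW.
rewrite -(@ler_expR R) lnK ?posrE //.
have := expR_ge1Dx (- 2^-1 : R); rewrite expRN => h.
have e0 : 0 < expR (2^-1 : R) by exact: expR_gt0.
have n2 : 2 <= n%:R :> R by rewrite ler_nat.
apply: le_trans n2.
have : (1 - 2^-1) * expR (2^-1 : R) <= 1 by rewrite -ler_pdivlMr // mul1r.
by lra.
Qed.

(** Sparsification with the parameters that give [O (n ln n)] points: the
    moments have order about [ln n], so that the [2 p]-th root of the
    dimension is bounded, and halving can go on until about [n * p] points are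
    left. *)
Theorem sparsify (delta : R) : 0 < delta < 1 -> exists2 C : R, 0 < C &
  forall (n N : nat) (u : 'I_N -> 'rV[R]_n) (c : 'rV[R]_N), (1 < n)%N ->
  (forall i, dot (u i) (u i) = 1) -> (forall i, 0 <= c 0 i) ->
  gram u c = 1%:M -> moment u c = 0 ->
  exists c' : 'rV[R]_N, [/\ forall i, 0 <= c' 0 i, moment u c' = 0,
    #|supp c'|%:R <= C * (n%:R * ln n%:R) &
    forall x, `|dot (x *m gram u c') x - dot x x| <= delta * dot x x].
Proof.
move=> /andP[d0 d1]; pose e : R := expR 1; have e0 : 0 < e by exact: expR_gt0.
have e1 : 1 <= e by have := expR_ge1Dx (1 : R); rewrite -/e; lra.
(* One factor e pays for the dimension, the other for the growth of the
   potential. *)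
pose d := delta ^+ 2 / e ^+ 2.
have dd0 : 0 < d by rewrite divr_gt0 ?exprn_gt0.
have dd1 : d <= 1.
  by rewrite ler_pdivrMr ?exprn_gt0 // mul1r ler_pXn2r ?nnegrE ?(ltW d0) ?(ltW e0) //; lra.
pose hc := halving_cost R; have hc0 : 0 < hc by exact: halving_cost_gt0.
exists (6 * hc / d); first by rewrite divr_gt0 // mulr_gt0.
move=> n N u c n1 u1 c0 cg cm.
have n_gt0 : (0 < n)%N by exact: ltnW.
have n0 : 0 < n%:R :> R by rewrite ltr0n.
have [k /andP[lnp pln]] := power_of_two_between (ln_ge_half n1).
set p := (2 ^ k)%N in lnp pln.
have p_gt0 : (0 < p)%N by rewrite expn_gt0.
have p1 : 1 <= p%:R :> R by rewrite ler1n.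
pose L := hc * p%:R * n%:R / d.
have L0 : 0 < L by rewrite divr_gt0 // !mulr_gt0 // ltr0n.
have EL : hc * p%:R ^+ 2 * n%:R / d / L = p%:R.
  by rewrite /L; field; rewrite !gt_eqF // ltr0n.
have nS : n.+1%:R <= 2 * n%:R :> R.
  by rewrite -natrM ler_nat mul2n -addnn -add1n leq_add2r.
have hc16 : 16 <= hc.
  by rewrite /hc /halving_cost -[16]mulr1; apply: ler_pM => //; rewrite ?ler1n // ler_nat.
have L4 : 4 * n.+1%:R <= L.
  rewrite /L ler_pdivlMr //.
  have pn : n%:R <= p%:R * n%:R :> R by rewrite ler_peMl // ltW.
  have h1 : 4 * n.+1%:R * d <= 4 * n.+1%:R by rewrite ler_piMr // mulr_ge0.
  have h2 : 16 * (p%:R * n%:R) <= hc * (p%:R * n%:R) by rewrite ler_pM2r ?mulr_gt0 // ltr0n.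
  by rewrite -mulrA; lra.
have ep : expR p%:R = e ^+ p by rewrite /e -expRM_natl mulr1.
have ne : n%:R <= e ^+ p.
  by rewrite -ep -[leLHS](@lnK R) ?posrE // ler_expR.
have Hbase : n%:R * d ^+ p * expR (hc * p%:R ^+ 2 * n%:R / d / L) <= delta ^+ p.*2.
  rewrite EL ep -muln2 mulnC exprM.
  have -> : delta ^+ 2 = e * (d * e) by rewrite /d; field; rewrite gt_eqF.
  rewrite (exprMn p e) (exprMn p d) mulrA ler_pM2r ?exprn_gt0 // ler_pM2r ?exprn_gt0 //.
have Hc : potential u p d c <= n%:R * d ^+ p *
    expR (hc * p%:R ^+ 2 * n%:R / d / Num.max #|supp c|%:R L).
  have -> : potential u p d c = n%:R * d ^+ p.
    rewrite /potential /dev cg subrr expr0n double_eq0 eqn0Ngt p_gt0 /=.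
    by rewrite mxtrace0 add0r.
  rewrite ler_peMr ?mulr_ge0 ?exprn_ge0 ?(ltW dd0) // -expR0 ler_expR.
  rewrite divr_ge0 //; last by rewrite le_max (ltW L0) orbT.
  by rewrite divr_ge0 ?(ltW dd0) // !mulr_ge0 // ltW.
have d01 : 0 <= delta <= 1 by rewrite (ltW d0) (ltW d1).
have [c' [c'0 c'm c'S c'g]] := sparsify_iter n_gt0 u1 dd0 d01 L4 Hbase c0 cm Hc.
exists c'; split => //; apply: le_trans c'S _.
rewrite /L; have -> : 2 * (hc * p%:R * n%:R / d) = 2 * hc / d * n%:R * p%:R by ring.
have -> : 6 * hc / d * (n%:R * ln n%:R) = 2 * hc / d * n%:R * (3 * ln n%:R) by ring.
by rewrite ler_pM2l // mulr_gt0 // divr_gt0 // mulr_gt0.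
Qed.

Lemma support_reindex n N (u : 'I_N -> 'rV[R]_n) (c : 'rV[R]_N) : (forall i, 0 <= c 0 i) ->
  exists (m : nat) (s : 'I_m -> 'I_N), m = #|supp c| /\
    [/\ forall j, 0 < c 0 (s j), gram (u \o s) (\row_j c 0 (s j)) = gram u c &
        moment (u \o s) (\row_j c 0 (s j)) = moment u c].
Proof.
move=> c0; exists #|supp c|, (@enum_val _ (supp c)); split => //.
have c00 i : ~~ supp c i -> c 0 i = 0.
  by rewrite /supp -leNgt => ci; apply/eqP; rewrite eq_le ci c0.
have reindex (V : nmodType) (F : 'I_N -> V) : (forall i, ~~ supp c i -> F i = 0) ->
    \sum_(j < #|supp c|) F (enum_val j) = \sum_i F i.
  move=> F0; rewrite [RHS](bigID (supp c)) /= [X in _ + X]big1 ?addr0 //.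
  by rewrite -(big_enum_val F).
split.
- by move=> j; have := enum_valP j.
- rewrite /gram -(reindex _ (fun i => c 0 i *: ((u i)^T *m u i))).
    by apply: eq_bigr => j _; rewrite mxE.
  by move=> i /c00->; rewrite scale0r.
- rewrite /moment -(reindex _ (fun i => c 0 i *: u i)).
    by apply: eq_bigr => j _; rewrite mxE.
  by move=> i /c00->; rewrite scale0r.
Qed.

Lemma closed_unit_ball n : closed (@euclidean_unit_ball R n).
Proof.
have -> : @euclidean_unit_ball R n = [set x | forall _ : unit, dot x x - 1 <= 0].
  apply/seteqP; split=> x /=; first by move=> /ballE x1 _; rewrite subr_le0.
  by move=> /(_ tt); rewrite subr_le0 => /ballE.
apply: closed_le0 => _; apply: cont_sub; last exact: cont_cst.
by apply: cont_dot; exact: mx_cont_id.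
Qed.

(** The body is cut out of a slight enlargement of the polytope by the
    half-spaces tangent to the unit ball at the points [v i].  The enlarged
    polytope contains the ball in its interior, so that the two boundaries can
    only meet at the points [v i]. *)
Lemma truncated_polytope n N m (g : 'I_N -> 'rV[R]_n) (v : 'I_m -> 'rV[R]_n)
    (b : 'rV[R]_m) (A : 'M[R]_n) (delta M : R) :
  (0 < n)%N -> 0 < delta < 3^-1 ->
  (forall j, dot (g j) (g j) <= 1) ->
  (forall y, (forall j, dot y (g j) <= 1) -> forall k, `|y 0 k| <= M) ->
  A \in unitmx -> (forall i, dot (v i) (v i) = 1) -> (forall i, 0 < b 0 i) ->
  gram v b = 1%:M -> moment v b = 0 ->
  (forall y, (1 - delta) * enorm (y *m A^T) <= enorm y) ->
  let K := [set y | (forall j, dot (y *m A^T) (g j) <= 1 + 3 * delta) /\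
                    (forall i, dot y (v i) <= 1)] in
  [/\ convex_body K, john_ellipsoid K (@euclidean_unit_ball R n) &
      exists N : nat, (contact_points K (@euclidean_unit_ball R n) #= `I_N)%card /\ (N <= m)%N].
Proof.
move=> n_gt0 /andP[d0 d3] g1 gM uA v1 b0 vb vm Abnd K.
pose h (o : 'I_N + 'I_m) : 'rV[R]_n := match o with inl j => g j *m A | inr i => v i end.
pose s (o : 'I_N + 'I_m) : R := match o with inl _ => 1 + 3 * delta | inr _ => 1 end.
have KE : K = [set y | forall o, dot y (h o) <= s o].
  apply/seteqP; split=> y /=.
    by move=> [H1 H2] [j|i] /=; rewrite ?dot_mulmxr; [exact: H1|exact: H2].
  by move=> H; split=> [j|i]; [have := H (inl j); rewrite /= dot_mulmxr|exact: (H (inr i))].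
have d13 : 0 < 1 + 3 * delta by lra.
have s0 o : 0 < s o by case: o => [j|i] //=.
pose M' := (1 + 3 * delta) * (M * \sum_i \sum_j `|invmx A^T i j|).
have bM y : (forall o, dot y (h o) <= s o) -> forall k, `|y 0 k| <= M'.
  move=> H k; pose z := (1 + 3 * delta)^-1 *: (y *m A^T).
  have zM l : `|z 0 l| <= M.
    apply: gM => j; rewrite /z dotZl mulrC ler_pdivrMr // mul1r.
    by have := H (inl j); rewrite /= dot_mulmxr.
  have -> : y = (1 + 3 * delta) *: (z *m invmx A^T).
    rewrite -scalemxAl scalerA divff ?scale1r ?gt_eqF // mulmxK ?unitmx_tr //.
  rewrite mxE normrM gtr0_norm // ler_pM2l // mxE; apply: le_trans (ler_norm_sum _ _ _) _.
  rewrite mulr_sumr; apply: ler_sum => l _; rewrite normrM; apply: ler_pM => //.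
  by rewrite (bigD1 k) //= lerDl sumr_ge0.
(* This is where delta < 1 / 3 enters: (1 - delta) * (1 + 3 * delta) > 1. *)
have sphere_in x : dot x x <= 1 -> forall j, dot (x *m A^T) (g j) < 1 + 3 * delta.
  move=> x1 j; apply: le_lt_trans (dot_le_enorm _ _) _.
  have gj : enorm (g j) <= 1 by rewrite enorm_leP // expr1n.
  have nx : enorm x <= 1 by rewrite enorm_leP // expr1n.
  have := Abnd x; have := enorm_ge0 (x *m A^T); set w := enorm (x *m A^T) => w0 wx.
  apply: (@le_lt_trans _ _ w); first by rewrite ler_piMr.
  by nra.
have DK : @euclidean_unit_ball R n `<=` K.
  move=> x /ballE x1; split=> [j|i]; first by rewrite ltW // sphere_in.
  apply: le_trans (dot_le_enorm _ _) _.
  have -> : enorm (v i) = 1 by rewrite /enorm v1 sqrtr1.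
  by rewrite mulr1 enorm_leP // expr1n.
split.
- by rewrite KE; exact: polytope_convex_body s0 bM.
- by apply: (unit_ball_is_john n_gt0 v1 b0 vb vm DK) => x i [].
have contactE : contact_points K (@euclidean_unit_ball R n) `<=` (fun k => nth 0 [seq v i | i <- enum 'I_m] k) @` `I_m.
  move=> x [[_ xK] [xD _]].
  have {}xD : dot x x <= 1.
    by move: xD; rewrite -((closure_id _).1 (@closed_unit_ball n)) => /ballE.
  have [i vi] : exists i, 1 <= dot x (v i).
    apply: contrapT => nov; apply: xK; rewrite KE; apply: strict_interior => -[j|i] /=.
      by rewrite dot_mulmxr sphere_in.
    by rewrite ltNge; apply/negP => xi; apply: nov; exists i.
  exists (i : nat); first by rewrite /= ltn_ord.
  rewrite (nth_map i) ?size_enum_ord // nth_ord_enum.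
  by apply/esym; apply: dot_unit_eq.
have fin : finite_set (contact_points K (@euclidean_unit_ball R n)).
  by apply: sub_finite_set contactE _; apply: finite_image; exact: finite_II.
have [N0 cN] := (finite_setP _).1 fin; exists N0; split => //.
rewrite -card_le_II; apply: card_le_trans (card_image_le (fun k => nth 0 [seq v i | i <- enum 'I_m] k) `I_m).
apply: card_le_trans (subset_card_le contactE).
by move: cN; rewrite card_eq_le => /andP[].
Qed.

(** The weights of a polytope in John position are made sparse, then exact by a
    linear map [A] close to an isometry on the relevant vectors, and the
    polytope is truncated at the resulting points. *)
Lemma few_contacts_nearby (delta : R) : 0 < delta < 3^-1 -> exists2 C : R, 0 < C &
  forall (n N : nat) (g : 'I_N -> 'rV[R]_n) (lam : 'rV[R]_N) (M : R), (1 < n)%N ->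
  (forall j, dot (g j) (g j) <= 1) ->
  (forall y, (forall j, dot y (g j) <= 1) -> forall k, `|y 0 k| <= M) ->
  (forall j, 0 <= lam 0 j) -> (forall j, 0 < lam 0 j -> dot (g j) (g j) = 1) ->
  gram g lam = 1%:M -> moment g lam = 0 ->
  exists (K : set 'rV[R]_n) (A : 'M[R]_n), A \in unitmx /\
  [/\ convex_body K, john_ellipsoid K (@euclidean_unit_ball R n),
      exists N : nat, (contact_points K (@euclidean_unit_ball R n) #= `I_N)%card /\
        N%:R <= C * (n%:R * ln n%:R),
      forall y, K y -> forall j, dot (y *m A) (g j) <= 1 + 3 * delta &
      forall y, (forall j, dot (y *m A) (g j) <= 1) -> K ((1 + delta)^-1 *: y)].
Proof.
move=> /andP[d0 d3]; have d1 : delta < 1 by lra.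
have dd : 0 < delta < 1 by rewrite d0.
have [C C0 HC] := sparsify dd; exists C => //.
move=> n N g lam M n1 g1 gM lam0 lam1 glam mlam.
have n_gt0 : (0 < n)%N by exact: ltnW.
have [N1 [s1 [_ [c0 cg cm]]]] := support_reindex g lam0.
rewrite glam in cg; rewrite mlam in cm.
have u1 i : dot ((g \o s1) i) ((g \o s1) i) = 1 by exact: lam1.
have c0' i : 0 <= (\row_j lam 0 (s1 j)) 0 i by rewrite mxE ltW.
have [c' [c'0 c'm c'S c'g]] := HC n N1 _ _ n1 u1 c0' cg cm.
have [m [s2 [mS [w0 wg wm]]]] := support_reindex (g \o s1) c'0.
rewrite -wg in c'g; rewrite c'm in wm.
set u := (g \o s1) \o s2 in wg wm c'g; set w := \row_j c' 0 (s2 j) in wg wm c'g.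
have {}w0 i : 0 < w 0 i by rewrite mxE.
have {}u1 i : dot (u i) (u i) = 1 by exact: u1.
have [A [v [b [[uA v1 b0 vb vm] [uv uA1 Abnd]]]]] := exact_position n_gt0 u1 w0 wm dd c'g.
have dl : 0 < delta < 3^-1 by rewrite d0.
have [cK jK [N2 [cN Nm]]] := truncated_polytope n_gt0 dl g1 gM uA v1 b0 vb vm Abnd.
set K := [set y | _] in cK jK cN.
exists K, A^T; split; first by rewrite unitmx_tr.
split => //.
- exists N2; split=> //; apply: le_trans c'S; rewrite -mS ler_nat //.
- by move=> y [].
move=> y Hy; have d10 : 0 < 1 + delta by lra.
split=> [j|i].
  rewrite -scalemxAl dotZl mulrC ler_pdivrMr //; apply: le_trans (Hy j) _.
  by rewrite -[leLHS]mul1r; apply: ler_pM => //; lra.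
rewrite dotZl mulrC ler_pdivrMr // mul1r.
have r0 : 0 < enorm (u i *m A) by apply: lt_le_trans (uA1 i); rewrite invr_gt0.
have -> : v i = (enorm (u i *m A))^-1 *: (u i *m A).
  by rewrite [in X in _ *: X]uv scalerA mulVf ?scale1r // gt_eqF.
rewrite dotZr dot_mulmxr mulrC ler_pdivrMr //.
apply: le_trans (Hy _) _; rewrite -ler_pdivrMl // mulr1; exact: uA1.
Qed.

End FewContacts.

Theorem mainTheorem2 (R : realType) (eps : R) (eps_gt0 : 0 < eps) :
  exists C : R, 0 < C /\
    forall (n : nat) (B : set 'rV[R]_n), (1 < n)%N -> convex_body B ->
      exists K D : set 'rV[R]_n,
        [/\ convex_body K,
            (banach_mazur K B <= (1 + eps)%:E)%E,
            john_ellipsoid K D &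
            exists N : nat, (contact_points K D #= `I_N)%card /\
              N%:R < C * n%:R * ln n%:R].
Proof.
(* The approximating polytope and the lengths in [few_contacts_nearby] cost a
   factor 1 + delta each, the enlargement of the polytope 1 + 3 * delta. *)
pose delta := Num.min 1 eps / 12.
have m0 : 0 < Num.min 1 eps by rewrite lt_min ltr01.
have m1 : Num.min 1 eps <= 1 by rewrite ge_min lexx.
have meps : Num.min 1 eps <= eps by rewrite ge_min lexx orbT.
have d0 : 0 < delta by rewrite divr_gt0.
have d3 : delta < 3^-1 by rewrite /delta; lra.
have dd : 0 < delta < 3^-1 by rewrite d0.
have factor : (1 + delta) * ((1 + delta) * (1 + 3 * delta)) <= 1 + eps.
  have : delta * 12 <= eps by rewrite /delta divfK.
  have : delta * 12 <= 1 by rewrite /delta divfK.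
  nra.
have [C C0 HC] := few_contacts_nearby dd.
(* The extra term makes the final inequality strict. *)
exists (C + 1); split; first by rewrite addr_gt0.
move=> n B n1 cB; have n_gt0 : (0 < n)%N by exact: ltnW.
have [y0 [N [f [M [Bf fB fM]]]]] := polytope_approx cB d0.
have [c [A0 [g [lam [[uA0 fg g1] [lam0 lam1 glam mlam]]]]]] := polytope_john n_gt0 fM.
have g_bounded y : (forall j, dot y (g j) <= 1) ->
    forall k, `|y 0 k| <= \sum_l (M + `|c 0 l|) * \sum_i \sum_j `|invmx A0 i j|.
  move=> /fg/fM Hy k; pose z := c + y *m A0.
  have -> : y = (z - c) *m invmx A0 by rewrite /z addrAC subrr add0r mulmxK.
  rewrite mxE; apply: le_trans (ler_norm_sum _ _ _) _; apply: ler_sum => l _.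
  rewrite normrM; apply: ler_pM => //.
    have -> : (z - c) 0 l = z 0 l - c 0 l by rewrite !mxE.
    by apply: le_trans (ler_normB _ _) _; rewrite lerD2r; exact: Hy.
  rewrite (bigD1 l) //= (bigD1 k) //= -addrA lerDl addr_ge0 ?sumr_ge0 // => i _.
  exact: sumr_ge0.
have [K [A [uA [cK jK [N2 [cN N2n]] Kg gK]]]] := HC n N g lam _ n1 g1 g_bounded lam0 lam1 glam mlam.
exists K, (@euclidean_unit_ball R n); split=> //; last first.
  exists N2; split=> //; apply: le_lt_trans N2n _.
  rewrite -mulrA ltr_pM2r ?ltrDl //.
  by rewrite mulr_gt0 ?ltr0n // ln_gt0 // ltr1n.
have d10 : 0 < 1 + delta by lra.
have d31 : 0 < 1 + 3 * delta by lra.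
pose s := (1 + delta)^-1 * (1 + 3 * delta)^-1.
have s0 : 0 < s by rewrite mulr_gt0 ?invr_gt0.
have s1 : s < 1 by rewrite /s -invfM invf_lt1 ?mulr_gt0 //; nra.
have ts : (1 + delta) / s = (1 + delta) * ((1 + delta) * (1 + 3 * delta)).
  by rewrite /s invfM !invrK.
apply: (@le_trans _ _ ((1 + delta) / s)%:E); last by rewrite lee_fin ts.
apply: (@banach_mazur_sandwich _ _ K B (A *m A0) (y0 + (1 + delta)^-1 *: c) (y0 + c)) => //.
- by rewrite unitmx_mul uA.
- by lra.
- move=> k Kk; pose y := (1 + 3 * delta)^-1 *: (k *m A).
  have /fg/fB : forall j, dot y (g j) <= 1.
    by move=> j; rewrite dotZl mulrC ler_pdivrMr // mul1r Kg.
  congr B; rewrite scalerDr addrA; congr (_ + _).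
  by rewrite /y -scalemxAl scalerA mulmxA.
- move=> b Bb; pose y := (b - y0 - c) *m invmx A0.
  have yA : c + y *m A0 = b - y0 by rewrite /y mulmxKV // addrC subrK.
  have Hy : forall j, dot y (g j) <= 1 by apply/fg; rewrite yA; exact: Bf.
  exists ((1 + delta)^-1 *: (y *m invmx A)).
    by apply: gK => j; rewrite mulmxKV.
  rewrite -scalemxAl scalerA divff ?scale1r ?gt_eqF // mulmxA mulmxKV //.
  by rewrite -addrA yA addrC subrK.
Qed.
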